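(* Let $p\in(0,1)$. For every $\Phi\in\mathcal F$, the collection $\{M_n^\Phi\}_{n\ge 0}$ is a coherent system; that is, each $M_n^\Phi$ is a probability measure on $\mathbb G_n^p$, and for every $n\ge 0$ and every $\mu\in\mathbb G^p_n$ $$\sum_{\lambda\in\mathbb G^p_{n+1}}M^\Phi_{n+1}(\lambda)\,\frac{G_{\lambda/\mu}^{(0,-p)}(1)\,G_\mu^{(0,-p)}(1^n)}{G_{\lambda}^{(0,-p)}(1^{n+1})}=M^\Phi_n(\mu).$$
   Context: $\mathbb G^p_n$ is the set of partitions $\lambda=(\lambda_1\ge\lambda_2\ge\dots\ge\lambda_n\ge 0)$ with at most $n$ nonzero parts; $\mathbb G_0^p=\{\varnothing\}$. Grothendieck polynomials: for $\lambda\in\mathbb G^p_n$, $$G_\lambda^{(0,-p)}(x_1,\dots,x_n)=\frac{\det\left[x_i^{\lambda_j+n-j}(1-p x_i)^{j-1}\right]_{1\le i,j\le n}}{\det\left[x_i^{n-j}\right]_{1\le i,j\le n}},$$ a symmetric polynomial; $1^n$ means that all $n$ variables equal $1$ (and $G^{(0,-p)}_\varnothing=1$ for $n=0$). Write $\mu\preceq\lambda$ if $\lambda_1\ge\mu_1\ge\lambda_2\ge\mu_2\ge\dots$. The one-variable skew polynomial at $1$ is $G^{(0,-p)}_{\lambda/\mu}(1)=(1-p)^{\#\{i\ge 1:\ \mu_i>\lambda_{i+1}\}}$ if $\mu\preceq\lambda$, and $0$ otherwise. The space $\mathcal F$: let $\overline{\mathbb D}=\{z\in\mathbb C:|z|\le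 1\}$. $\mathcal F$ is the set of complex functions $\Phi$ on $\overline{\mathbb D}$ which are uniform limits on $\overline{\mathbb D}$ of sequences of rational functions of the form $$\Phi_k(z)=\prod_{i=1}^{n_k}\frac{1-x_{i,k}(z-1)}{1-y_{i,k}(z-1)},\qquad x_{i,k}\in\left[-1,\tfrac{p}{1-p}\right],\quad y_{i,k}\ge 0,\quad y_{i,k}\ge x_{i,k}.$$ Such $\Phi$ are analytic in the unit disk and $\Phi(1)=1$. For $\Phi\in\mathcal F$, the numbers $M_n^\Phi(\lambda)$, $n\ge 1$, $\lambda\in\mathbb G^p_n$, are defined by the identity of formal power series in $z_1,\dots,z_n$ (where $\Phi$ is identified with its Taylor series at $0$) $$\sum_{\lambda\in\mathbb G^p_n} M_n^\Phi(\lambda)\,\frac{G_{\lambda}^{(0,-p)}(z_1,\dots,z_n)}{G_{\lambda}^{(0,-p)}(1^n)}=\Phi(z_1)\Phi(z_2)\cdots\Phi(z_n),$$ and $M_0^\Phi(\varnothing)=1$. These numbers are uniquely determined because $G_\lambda^{(0,-p)}$ equals the Schur polynomial $s_\lambda$ plus terms of higher degree. *)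

(* Defs.v *)
From HB Require Import structures.
From mathcomp Require Import all_boot all_order all_algebra.
From mathcomp Require Import all_classical all_reals all_analysis.
From mathcomp Require Import complex.
From mathcomp Require Import -(notations) mpoly.

Set Implicit Arguments.
Unset Strict Implicit.
Unset Printing Implicit Defensive.

Import Order.TTheory GRing.Theory Num.Theory.
Import numFieldNormedType.Exports.

Local Open Scope classical_set_scope.
Local Open Scope ring_scope.
Local Open Scope complex_scope.

(* Partitions with at most n nonzero parts, padded with zeros to length n. *)
Definition partition_le (n : nat) := {t : n.-tuple nat | sorted geq t}.

(* Parts are numbered from 0, and vanish from index n on: [part l i] is the
   part $\lambda_{i+1}$. *)
Definition part (n : nat) (l : partition_le n) (i : nat) : nat :=
  nth 0%N (val l) i.

Section Grothendieck.
Context {R : realType} (p : R).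

(* The exponents $\lambda_j+n-j$ and $j-1$ (j from 1) are
   [part l j + (n.-1 - j)] and [j] when j is counted from 0. *)
Definition groth_num (n : nat) (l : partition_le n) : mpoly n R :=
  \det (\matrix_(i < n, j < n)
    (mpolyX R (mnm1 i) ^+ (part l j + (n.-1 - j)) *
     (1 - p *: mpolyX R (mnm1 i)) ^+ j)).

Definition groth_den (n : nat) : mpoly n R :=
  \det (\matrix_(i < n, j < n) mpolyX R (mnm1 i) ^+ (n.-1 - j)).

(* The polynomial $G_\lambda^{(0,-p)}$, quotient of the two determinants:
   [groth_den n] is nonzero in an integral domain, so at most one polynomial
   satisfies the equation. *)
Definition groth (n : nat) (l : partition_le n) : mpoly n R :=
  xget 0 [set g | g * groth_den n = groth_num l].

(* The value at $1^n$. *)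
Definition groth1 (n : nat) (l : partition_le n) : R :=
  meval (fun=> 1) (groth l).

Definition interlace (m n : nat) (mu : partition_le m) (l : partition_le n) :=
  `[< forall i, (part mu i <= part l i)%N && (part l i.+1 <= part mu i)%N >].

(* An i with $\mu_i > \lambda_{i+1}$ is at most m, as $\mu_i=0$ beyond. *)
Definition groth_skew1 (m n : nat) (l : partition_le n) (mu : partition_le m)
    : R :=
  if interlace mu l
  then (1 - p) ^+ #|[pred i : 'I_m | (part l i.+1 < part mu i)%N]|
  else 0.

Definition unit_cdisk : set R[i] := [set z | `|z| <= 1].

Definition rat_prod (s : seq (R * R)) (z : R[i]) : R[i] :=
  \prod_(q <- s) ((1 - q.1%:C * (z - 1)) / (1 - q.2%:C * (z - 1))).

Definition admissible (q : R * R) : Prop :=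
  [/\ -1 <= q.1, q.1 <= p / (1 - p), 0 <= q.2 & q.1 <= q.2].

(* A function on the closed disk is represented by a total function on the
   complex numbers, whose values outside the disk are never used. *)
Definition calF : set (R[i] -> R[i]) :=
  [set Phi | exists s : nat -> seq (R * R),
     (forall k q, q \in s k -> admissible q) /\
     {uniform unit_cdisk,
       (fun k => rat_prod (s k) : R[i] -> R[i]^o) @ \oo
         --> (Phi : R[i] -> R[i]^o)}].

(* [complex R] carries a topology only through its copy [R[i]^o], whence the
   casts. *)
Definition taylor_coef (Phi : R[i] -> R[i]) (k : nat) : R[i] :=
  derive1n k (Phi : R[i] -> R[i]^o) 0 / k`!%:R.

(* Identity of formal power series in n variables, coefficient by
   coefficient.  Only the finitely many l with |l| <= |m| contribute to the
   coefficient of the monomial m, since [groth l] has no term of degree less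
   than |l|; the finitely supported sum [\sum_(_ \in _)] is thus meaningful. *)
Definition expansion (Phi : R[i] -> R[i]) (n : nat)
    (M : partition_le n -> R[i]) : Prop :=
  forall m : multinom n,
    \sum_(l \in [set: partition_le n])
       M l * ((mcoeff m (groth l) / groth1 l)%:C) =
    \prod_(i < n) taylor_coef Phi (m i).

(* The family M is uniquely determined by the expansion, [groth l] being the
   Schur polynomial of l plus terms of higher degree. *)
Definition MPhi (Phi : R[i] -> R[i]) (n : nat) : partition_le n -> R[i] :=
  if n == 0%N then fun=> 1
  else xget (fun=> 0) [set M | expansion Phi M].

Definition is_probability (n : nat) (M : partition_le n -> R) : Prop :=
  (forall l, 0 <= M l) /\
  (\esum_(l in [set: partition_le n]) (M l)%:E = 1)%E.

Definition coherent_system (M : forall n, partition_le n -> R) : Prop :=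
  (forall n, is_probability (M n)) /\
  (forall n (mu : partition_le n),
     (\esum_(l in [set: partition_le n.+1])
        (M n.+1 l * (groth_skew1 l mu * groth1 mu / groth1 l))%:E =
      (M n mu)%:E)%E).

End Grothendieck.

(* Main.v *)
Require Import Defs.
From mathcomp Require Import all_boot all_order all_algebra fingroup perm.
From mathcomp Require Import all_classical all_reals all_analysis.
From mathcomp Require Import complex.
From mathcomp Require Import -(notations) mpoly.
From mathcomp Require Import zify ring lra.
Set Implicit Arguments.
Unset Strict Implicit.
Unset Printing Implicit Defensive.
Import Order.TTheory GRing.Theory Num.Theory.
Import numFieldNormedType.Exports.
Local Open Scope classical_set_scope.
Local Open Scope ring_scope.

(** Write h(z) for Phi(z_1) ... Phi(z_n) and V for the Vandermonde determinant.
    Multiplying by V turns the Grothendieck polynomials into the alternants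
    with entries z_i^(l_j + n - j) (1 - p z_i)^(j - 1), so that the numbers
    c(l) = M(l) / G_l(1, ..., 1) are the coordinates of the antisymmetric
    series h V in the basis of alternants.  These coordinates exist and are
    unique because the alternants are triangular with respect to the leading
    monomials (expands_rec, groth_expandsP, MPhiE).

    Positivity.  For a single factor psi(z) = (u - v z) / (1 - a z),
    multiplication by psi(z_1) ... psi(z_n) acts on alternants by an explicit
    Pieri rule (pieri_alternant) whose coefficients are products, over the
    rows, of powers of a and p and of u, u a - v and u p - v.  The conditions
    on the parameters of a factor say exactly that these are nonnegative.  The
    rule comes from column operations: column j divided by 1 - p z is column
    j - 1 up to a power of z, so the correction to column j is a multiple of
    column j - 1, and the terms that are not partitions cancel.  Starting from
    the constant series 1, whose only nonzero coordinate is that of the empty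
    partition, the coordinates of a finite product of factors are nonnegative.

    Passing to the limit.  A finite product of factors has nonnegative Taylor
    coefficients of sum 1.  Uniform convergence on the closed disk makes the
    coefficients converge, hence also the coordinates, each of which is
    determined by finitely many coefficients (expands_limit); and Phi is the
    power series of the limits, which are therefore its Taylor coefficients
    (power_series_derive1n).  They again sum to 1, since convergence is uniform
    up to z = 1.

    Coherence.  Set z_(n+1) = r.  The alternant of l becomes the product of the
    z_i - r times the sum over mu of G_(l/mu)(r) times the alternant of mu
    (det_branch).  Comparing coordinates gives, as power series in r,
      sum over l of c(l) G_(l/mu)(r) = Phi(r) c(mu)
    (coordinates_branch).  Here G_(l/mu)(r) is a power of r times a power, at
    most the n-th, of 1 - p r, so it has coefficients of both signs; but after
    division by (1 - p r)^n every series involved has nonnegative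
    coefficients, and summing the coefficients, that is setting r = 1, is
    licit.  This is coherence, as Phi(1) = 1 (esum_branch).  Summing over mu
    shows that the masses of levels n and n + 1 are equal, and level 0 has
    mass 1 (coherent_coordinates). *)

(** * Determinants *)

Lemma det_sum_rows (A : comNzRingType) n (T : finType)
    (a : 'I_n -> T -> A) (b : 'I_n -> T -> 'I_n -> A) :
  \det (\matrix_(i < n, j < n) \sum_k a i k * b i k j) =
  \sum_(g : {ffun 'I_n -> T})
     (\prod_i a i (g i)) * \det (\matrix_(i < n, j < n) b i (g i) j).
Proof.
rewrite /determinant.
under eq_bigr => s _ do
  (under eq_bigr => i _ do rewrite mxE; rewrite bigA_distr_bigA /= mulr_sumr).
rewrite exchange_big /=; apply: eq_bigr => g _; rewrite mulr_sumr.
apply: eq_bigr => s _; rewrite big_split /= mulrCA; congr (_ * (_ * _)).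
by apply: eq_bigr => i _; rewrite mxE.
Qed.

Lemma det_sum_cols (A : comNzRingType) n (T : finType)
    (a : 'I_n -> T -> A) (b : 'I_n -> 'I_n -> T -> A) :
  \det (\matrix_(i < n, j < n) \sum_k a j k * b i j k) =
  \sum_(g : {ffun 'I_n -> T})
     (\prod_j a j (g j)) * \det (\matrix_(i < n, j < n) b i j (g j)).
Proof.
rewrite -det_tr; transitivity (\det (\matrix_(j < n, i < n)
    \sum_k a j k * b i j k)); first by congr (\det _); apply/matrixP => i j; rewrite !mxE.
rewrite (det_sum_rows a (fun j k i => b i j k)); apply: eq_bigr => g _.
by rewrite -det_tr; congr (_ * \det _); apply/matrixP => i j; rewrite !mxE.
Qed.

(** The columns are indexed by natural numbers rather than ordinals, so that
    the neighbour of a column needs no bound check. *)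
Lemma det_add_prev_col (A : comNzRingType) n (F : 'I_n -> nat -> A) (c : nat -> A) :
  \det (\matrix_(i < n, j < n)
     (F i j + (if (j : nat) is j'.+1 then c j * F i j' else 0))) =
  \det (\matrix_(i < n, j < n) F i j).
Proof.
pose U : 'M[A]_n := \matrix_(k, j)
  ((k == j)%:R + c j * (k.+1 == j :> nat)%:R).
have -> : (\matrix_(i < n, j < n)
     (F i j + (if (j : nat) is j'.+1 then c j * F i j' else 0))) =
   (\matrix_(i < n, j < n) F i j) *m U.
  apply/matrixP => i j; rewrite !mxE.
  under eq_bigr => k _ do rewrite !mxE mulrDr.
  rewrite big_split /=; congr (_ + _).
    rewrite (bigD1 j) //= eqxx mulr1 big1 ?addr0 // => k /negbTE ->.
    by rewrite mulr0.
  case: (j : nat) (ltn_ord j) => [|j'] ltj.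
    by rewrite big1 // => k _; rewrite !mulr0.
  rewrite (bigD1 (Ordinal (ltnW ltj))) //= eqxx mulr1 mulrC.
  rewrite big1 ?addr0 // => k nk; rewrite eqSS.
  suff /negbTE -> : (k : nat) != j' by rewrite !mulr0.
  by apply: contra nk => /eqP kE; apply/eqP/val_inj.
have trigU : is_trig_mx U^T.
  apply/is_trig_mxP => i j ltij; rewrite !mxE.
  have -> : (j == i) = false by apply/negbTE; rewrite neq_ltn ltij orbT.
  by rewrite gtn_eqF ?mulr0 ?addr0 // ltnW.
rewrite det_mulmx -(det_tr U) (det_trig trigU).
rewrite [X in _ * X]big1 ?mulr1 // => i _; rewrite !mxE eqxx.
by rewrite (gtn_eqF (ltnSn _)) mulr0 addr0.
Qed.

Lemma det_comb_next_col (A : comNzRingType) n (F : 'I_n -> nat -> A)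
    (a b : nat -> A) : b n.-1 = 0 ->
  \det (\matrix_(i < n, j < n) (a j * F i j + b j * F i j.+1)) =
  (\prod_(j < n) a j) * \det (\matrix_(i < n, j < n) F i j).
Proof.
move=> bn0.
pose U : 'M[A]_n := \matrix_(k, j)
  (a j * (k == j)%:R + b j * (k == j.+1 :> nat)%:R).
have -> : (\matrix_(i < n, j < n) (a j * F i j + b j * F i j.+1)) =
   (\matrix_(i < n, j < n) F i j) *m U.
  apply/matrixP => i j; rewrite !mxE.
  under eq_bigr => k _ do rewrite !mxE mulrDr.
  rewrite big_split /=; congr (_ + _).
    rewrite (bigD1 j) //= eqxx mulr1 mulrC big1 ?addr0 // => k /negbTE ->.
    by rewrite !mulr0.
  have [ltj|lejn] := ltnP j.+1 n.
    rewrite (bigD1 (Ordinal ltj)) //= eqxx mulr1 mulrC.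
    rewrite big1 ?addr0 // => k nk.
    suff /negbTE -> : (k : nat) != j.+1 by rewrite !mulr0.
    by apply: contra nk => /eqP kE; apply/eqP/val_inj.
  have -> : (j : nat) = n.-1 by have := ltn_ord j; lia.
  by rewrite bn0 mul0r big1 // => k _; rewrite mul0r mulr0.
have trigU : is_trig_mx U.
  apply/is_trig_mxP => i j ltij; rewrite !mxE.
  have -> : (i == j) = false by apply/negbTE; rewrite neq_ltn ltij.
  by rewrite ltn_eqF ?mulr0 ?addr0 // ltnW.
rewrite det_mulmx (det_trig trigU).
rewrite mulrC; congr (_ * _); apply: eq_bigr => i _; rewrite !mxE eqxx.
by rewrite (ltn_eqF (ltnSn _)) mulr0 addr0 mulr1.
Qed.

Lemma det_scale_rows (A : comNzRingType) n (a : 'I_n -> A) (M : 'M[A]_n) :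
  \det (\matrix_(i < n, j < n) (a i * M i j)) = (\prod_i a i) * \det M.
Proof.
rewrite /determinant mulr_sumr; apply: eq_bigr => s _; rewrite mulrCA; congr (_ * _).
by rewrite -big_split; apply: eq_bigr => i _; rewrite mxE.
Qed.

(** * Partitions *)

Lemma part_out n (l : partition_le n) i : (n <= i)%N -> part l i = 0%N.
Proof. by move=> le_ni; rewrite /part nth_default // size_tuple. Qed.

Lemma part_le n (l : partition_le n) i j : (i <= j)%N -> (part l j <= part l i)%N.
Proof.
move=> leij; have [ltjn|lenj] := ltnP j n; last by rewrite (part_out _ lenj).
have srt := valP l.
rewrite /part; apply: (sorted_leq_nth _ _ 0%N srt) => //.
- by move=> a b c /= h1 h2; exact: leq_trans h2 h1.
- by move=> a /=.
- by rewrite inE size_tuple; exact: leq_ltn_trans ltjn.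
- by rewrite inE size_tuple.
Qed.

Lemma part_inj n (l l' : partition_le n) :
  (forall i, (i < n)%N -> part l i = part l' i) -> l = l'.
Proof.
move=> eqp; apply/val_inj/val_inj/(@eq_from_nth _ 0%N); first by rewrite !size_tuple.
by move=> i; rewrite size_tuple => ltin; exact: eqp.
Qed.

Definition ord_tuple_val n N (g : {ffun 'I_n -> 'I_N}) : n.-tuple nat :=
  [tuple val (g i) | i < n].

(** Sums over all partitions become sums over these finite lists: the terms
    met below vanish as soon as one part is large. *)
Definition partitions_below n N : seq (partition_le n) :=
  pmap insub (map (@ord_tuple_val n N) (index_enum {ffun 'I_n -> 'I_N})).

Lemma ord_tuple_val_inj n N : injective (@ord_tuple_val n N).
Proof.
move=> g h eqgh; apply/ffunP => i; apply/val_inj.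
by have := congr1 (fun t : n.-tuple nat => tnth t i) eqgh; rewrite !tnth_mktuple.
Qed.

Lemma part_mk n (f : nat -> nat) : (forall i j, (i <= j < n)%N -> (f j <= f i)%N) ->
  exists l : partition_le n, forall i, (i < n)%N -> part l i = f i.
Proof.
move=> f_le; pose t := [tuple f i | i < n].
have tE i : (i < n)%N -> nth 0%N t i = f i.
  move=> ltin; have := tnth_mktuple (fun i : 'I_n => f i) (Ordinal ltin).
  by rewrite (tnth_nth 0%N).
have srt : sorted geq t.
  apply/(sortedP 0%N) => i; rewrite size_tuple => ltin.
  by rewrite !tE /= ?f_le ?leqnSn //; exact: ltnW.
by exists (exist _ t srt) => i ltin; exact: tE.
Qed.

Lemma mem_partitions_below n N (l : partition_le n) :
  (l \in partitions_below n N) = [forall i : 'I_n, part l i < N]%N.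
Proof.
rewrite /partitions_below mem_pmap_sub; apply/mapP/forallP => [[g _ lE] i|ltN].
  by rewrite /part lE -(tnth_nth 0%N) tnth_mktuple; exact: ltn_ord.
exists [ffun i => Ordinal (ltN i)]; first by rewrite mem_index_enum.
apply: eq_from_tnth => i; rewrite tnth_mktuple ffunE /=.
by rewrite (tnth_nth 0%N).
Qed.

Lemma uniq_partitions_below n N : uniq (partitions_below n N).
Proof.
rewrite /partitions_below; apply: pmap_sub_uniq.
by rewrite (map_inj_uniq (@ord_tuple_val_inj n N)) index_enum_uniq.
Qed.

(** Row lengths are read as functions on all natural numbers, zero beyond n,
    so that part l and a family g of bounded entries can be treated alike. *)
Definition extend0 n N (g : {ffun 'I_n -> 'I_N}) : nat -> nat :=
  nth 0%N (ord_tuple_val g).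

Lemma extend0E n N (g : {ffun 'I_n -> 'I_N}) (i : 'I_n) : extend0 g i = g i.
Proof. by rewrite /extend0 -tnth_nth tnth_mktuple. Qed.

Lemma extend0_ord n N (g : {ffun 'I_n -> 'I_N}) i (ltin : (i < n)%N) :
  extend0 g i = g (Ordinal ltin).
Proof. exact: (extend0E g (Ordinal ltin)). Qed.

Lemma extend0_out n N (g : {ffun 'I_n -> 'I_N}) i : (n <= i)%N -> extend0 g i = 0%N.
Proof. by move=> leni; rewrite /extend0 nth_default // size_tuple. Qed.

Lemma big_partitions_below (V : nmodType) n N (H : (nat -> nat) -> V) :
  \sum_(l <- partitions_below n N) H (part l) =
  \sum_(g : {ffun 'I_n -> 'I_N} | sorted geq (ord_tuple_val g)) H (extend0 g).
Proof.
rewrite /partitions_below big_pmap big_map [RHS]big_mkcond; apply: eq_bigr => g _.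
by case: insubP => [l -> lE|/negbTE -> //]; rewrite /= /extend0 -lE.
Qed.

Lemma sorted_ord_tuple n N (g : {ffun 'I_n -> 'I_N}) :
  sorted geq (ord_tuple_val g) =
  [forall i : 'I_n, extend0 g i.+1 <= extend0 g i]%N.
Proof.
apply/idP/forallP => [srt i|le_g].
  have [lt1|le1] := ltnP i.+1 n; last by rewrite (extend0_out _ le1).
  by have /(sortedP 0%N)/(_ i) := srt; rewrite size_tuple => /(_ lt1).
apply/(sortedP 0%N) => i; rewrite size_tuple => lt1.
exact: (le_g (Ordinal (ltnW lt1))).
Qed.

(** Multilinear expansions of determinants run over all g; the partitions are
    the g that are sorted. *)
Lemma big_partitions_cond (V : nmodType) n N (H : (nat -> nat) -> V) :
  (forall g : {ffun 'I_n -> 'I_N},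
     ~~ sorted geq (ord_tuple_val g) -> H (extend0 g) = 0) ->
  \sum_(l <- partitions_below n N) H (part l) =
  \sum_(g : {ffun 'I_n -> 'I_N}) H (extend0 g).
Proof.
move=> H0; rewrite big_partitions_below big_mkcond; apply: eq_bigr => g _.
by case: ifPn => // /H0.
Qed.

Definition psize n (l : partition_le n) : nat := (\sum_(i < n) part l i)%N.

Lemma part_le_psize n (l : partition_le n) i : (part l i <= psize l)%N.
Proof.
have [ltin|lein] := ltnP i n; last by rewrite part_out.
by rewrite /psize (bigD1 (Ordinal ltin)) //= leq_addr.
Qed.

Lemma partitions_below_stable (V : nmodType) n N N' (H : partition_le n -> V) :
  (N <= N')%N ->
  (forall l, l \notin partitions_below n N -> H l = 0) ->
  \sum_(l <- partitions_below n N') H l = \sum_(l <- partitions_below n N) H l.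
Proof.
move=> leN H0; rewrite (bigID (mem (partitions_below n N))) /=.
rewrite [X in _ + X]big1 ?addr0 => [|l /H0 //].
rewrite -big_filter; apply: perm_big; apply: uniq_perm.
- by rewrite filter_uniq ?uniq_partitions_below.
- exact: uniq_partitions_below.
move=> l; rewrite mem_filter /= !mem_partitions_below.
apply: andb_idr => /forallP ltN; apply/forallP => i.
exact: leq_trans leN.
Qed.

(** * Branching *)

(** The polynomial x^(k + n - 1 - j) (1 - q x)^j, whose value at z_i is the
    entry (i, j) of the numerator of a Grothendieck polynomial when the part
    number j is k. *)
Definition gcol (A : nzRingType) (q : A) n k j : {poly A} :=
  'X^(k + (n.-1 - j)) * (1 - q *: 'X) ^+ j.

(** Weight of the part m of the smaller partition, lying between the parts b
    and a of the larger one, in a one-variable skew polynomial at r. *)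
Definition branch_weight (A : nzRingType) (q r : A) (a b m : nat) : A :=
  if (b <= m <= a)%N then r ^+ (a - m) * (if (b < m)%N then 1 - q * r else 1)
  else 0.

Lemma det_last_row (A : comNzRingType) n (M : 'M[A]_n.+1) :
  (forall j : 'I_n.+1, (j < n)%N -> M ord_max j = 0) ->
  \det M = M ord_max ord_max *
    \det (\matrix_(i < n, j < n) M (lift ord_max i) (lift ord_max j)).
Proof.
move=> M0; rewrite (expand_det_row _ ord_max) (bigD1 ord_max) //= big1 => [|j nj].
  rewrite addr0 /cofactor addnn -signr_odd odd_double mul1r.
  by congr (_ * \det _); apply/matrixP => i j; rewrite !mxE.
rewrite M0 ?mul0r // ltn_neqAle -ltnS ltn_ord andbT.
by apply: contra nj => /eqP jn; apply/eqP/val_inj.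
Qed.

Section Branching.
Variables (A : idomainType) (q r : A).

(** Both sides are a geometric sum, the left one vanishing at r. *)
Lemma branch_poly d :
  (1 - q * r) *: 'X^(d.+1) - r ^+ d.+1 *: (1 - q *: 'X) =
  ('X - r%:P) * \sum_(k < d.+1)
     (r ^+ (d - k) * (if (0 < k)%N then 1 - q * r else 1)) *: 'X^k.
Proof.
elim: d => [|d IHd].
  by rewrite big_ord1 /= subnn !expr1 expr0 mulr1 scale1r mulr1
    -!mul_polyC !(polyCB, polyCM, polyC1, polyC0); ring.
rewrite big_ord_recr /= subnn expr0 mul1r.
have -> : \sum_(k < d.+1) (r ^+ (d.+1 - k) *
     (if (0 < k)%N then 1 - q * r else 1)) *: 'X^k =
   r *: \sum_(k < d.+1) (r ^+ (d - k) *
     (if (0 < k)%N then 1 - q * r else 1)) *: 'X^k :> {poly A}.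
  rewrite scaler_sumr; apply: eq_bigr => k _.
  by rewrite scalerA mulrA -exprS subSn // -ltnS.
rewrite mulrDr -scalerAr -IHd -!mul_polyC !(polyCB, polyCM, polyC1, rmorphXn) /=.
rewrite !exprS; ring.
Qed.

Lemma gcol_horner n k j :
  (gcol q n k j).[r] = r ^+ (k + (n.-1 - j)) * (1 - q * r) ^+ j.
Proof. by rewrite /gcol !hornerE. Qed.

Lemma gcol_branch n a b j B : (j < n)%N -> (b <= a < B)%N ->
  (1 - q * r) *: gcol q n.+1 a j - r ^+ (a - b).+1 *: gcol q n.+1 b j.+1 =
  \sum_(m < B) branch_weight q r a b m *: (('X - r%:P) * gcol q n m j).
Proof.
move=> ltjn /andP[leba ltaB].
pose K : {poly A} := 'X^(b + (n.-1 - j)) * (1 - q *: 'X) ^+ j.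
have -> : gcol q n.+1 a j = 'X^((a - b).+1) * K.
  rewrite /gcol /K mulrA -exprD; congr ('X^_ * _); lia.
have -> : gcol q n.+1 b j.+1 = (1 - q *: 'X) * K.
  rewrite /gcol /K mulrCA exprS; congr ('X^_ * _); lia.
rewrite !scalerAl -mulrBl branch_poly -mulrA mulr_suml mulr_sumr.
pose G (m : nat) : {poly A} :=
  branch_weight q r a b m *: (('X - r%:P) * gcol q n m j).
rewrite (eq_bigr (fun k : 'I_(a - b).+1 => G (b + k)%N)) => [|k _].
  rewrite -(big_mkord predT (fun k => G (b + k)%N)) -(big_mkord predT G) /=.
  rewrite [RHS](big_cat_nat (n := b)) //=; last exact: leq_trans leba (ltnW ltaB).
  rewrite [X in _ = X + _]big_nat [X in _ = X + _]big1 ?add0r => [|m /andP[_ ltm]]; last first.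
    by rewrite /G /branch_weight leqNgt ltm /= scale0r.
  rewrite [RHS](big_cat_nat (n := a.+1)) //=; last exact: leqW.
  rewrite [X in _ = _ + X]big_nat [X in _ = _ + X]big1 ?addr0 => [|m /andP[ltm _]]; last first.
    by rewrite /G /branch_weight [(m <= a)%N]leqNgt ltm andbF scale0r.
  have := big_addn 0 a.+1 b predT G; rewrite add0n subSn // => ->.
  by apply: eq_bigr => m _; rewrite addnC.
have lek : (k <= a - b)%N by rewrite -ltnS.
rewrite /G /branch_weight leq_addr /= -leq_subRL // lek.
have -> : (b < b + k)%N = (0 < k)%N by lia.
have -> : (a - (b + k) = a - b - k)%N by lia.
rewrite -scalerAl -!scalerAr; congr (_ *: (_ * _)).
by rewrite /gcol /K mulrA -exprD; congr ('X^_ * _); lia.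
Qed.

Section Rows.
Variables (n : nat) (L : 'I_n.+1 -> {poly A} -> A).
Hypothesis L_lin : forall i a P Q, L i (a *: P + Q) = a * L i P + L i Q.
Hypothesis L_last : forall P, L ord_max P = P.[r].

Let L0 i : L i 0 = 0.
Proof. by have := L_lin i (-1) 0 0; rewrite scaler0 addr0 mulN1r addNr. Qed.

Let LZ i a P : L i (a *: P) = a * L i P.
Proof. by have := L_lin i a P 0; rewrite L0 !addr0. Qed.

Let LD i P Q : L i (P + Q) = L i P + L i Q.
Proof. by have := L_lin i 1 P Q; rewrite scale1r mul1r. Qed.

Let L_sum i B (c : nat -> A) (P : nat -> {poly A}) :
  L i (\sum_(m < B) c m *: P m) = \sum_(m < B) c m * L i (P m).
Proof.
elim: B => [|B IH]; first by rewrite !big_ord0 L0.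
by rewrite !big_ord_recr LD IH LZ.
Qed.

(** Subtracting from each column the multiple of the next one that vanishes
    at r clears the last row, and leaves a factor 'X - r in every column. *)
Lemma det_branch (lam : nat -> nat) B :
  1 - q * r != 0 -> (forall j, lam j.+1 <= lam j)%N -> (lam 0 < B)%N ->
  \det (\matrix_(i < n.+1, j < n.+1) L i (gcol q n.+1 (lam j) j)) =
  \sum_(g : {ffun 'I_n -> 'I_B})
    (r ^+ lam n * \prod_(j < n) branch_weight q r (lam j) (lam j.+1) (g j)) *
    \det (\matrix_(i < n, j < n)
       L (lift ord_max i) (('X - r%:P) * gcol q n (g j) j)).
Proof.
move=> nz lam_le ltB.
have lamB j : (lam j < B)%N.
  by elim: j => // j; apply: leq_ltn_trans; exact: lam_le.
pose F i j := L i (gcol q n.+1 (lam j) j).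
pose a j := if (j < n)%N then 1 - q * r else 1.
pose b j := if (j < n)%N then - r ^+ (lam j - lam j.+1).+1 else 0.
have := @det_comb_next_col _ n.+1 F a b.
rewrite /= /b ltnn => /(_ erefl).
have aE : a n = 1 by rewrite /a ltnn.
rewrite big_ord_recr /= aE mulr1.
rewrite (eq_bigr (fun=> 1 - q * r)) => [|i _]; last by rewrite /a /= ltn_ord.
rewrite prodr_const card_ord => detE.
apply: (mulfI (expf_neq0 n nz)); rewrite -detE {detE}.
rewrite det_last_row => [|j ltjn].
  have lastE : (gcol q n.+1 (lam n) n).[r] = r ^+ lam n * (1 - q * r) ^+ n.
    by rewrite gcol_horner subnn addn0.
  rewrite mxE /a /b /= ltnn mul1r mul0r addr0 /F L_last lastE.
  rewrite (mulrC (r ^+ lam n)) -mulrA; congr (_ * _).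
  under [RHS]eq_bigr => g _ do rewrite -mulrA.
  rewrite -mulr_sumr; congr (_ * _).
  rewrite -(det_sum_cols (fun (j : 'I_n) (m : 'I_B) =>
      branch_weight q r (lam j) (lam j.+1) m)
    (fun i j m => L (lift ord_max i) (('X - r%:P) * gcol q n m j))).
  congr (\det _); apply/matrixP => i j; rewrite !mxE !lift_max /= ltn_ord.
  rewrite -(L_sum _ _ _ (fun m => ('X - r%:P) * gcol q n m j)).
  rewrite -gcol_branch ?ltn_ord ?lam_le ?lamB // LD -scaleNr !LZ.
  by rewrite /F.
rewrite mxE /a /b ltjn /F !L_last !gcol_horner /=.
have -> : (lam j + (n - j) = (lam j - lam j.+1).+1 + (lam j.+1 + (n - j.+1)))%N.
  by have := lam_le j; lia.
by rewrite exprD !exprS; ring.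
Qed.

Lemma det_branch_power (T : {poly A}) :
  \det (\matrix_(i < n.+1, j < n.+1) L i (T * 'X^(n - j))) =
  T.[r] * \det (\matrix_(i < n, j < n)
       L (lift ord_max i) (('X - r%:P) * (T * 'X^(n.-1 - j)))).
Proof.
pose F i j := L i (T * 'X^(n - j)).
pose b j := if (j < n)%N then - r else 0.
have := @det_comb_next_col _ n.+1 F (fun=> 1) b.
rewrite /= /b ltnn => /(_ erefl); rewrite big1 ?mul1r // => <-.
rewrite det_last_row => [|j ltjn].
  rewrite mxE /b /= ltnn mul1r mul0r addr0 /F L_last subnn mulr1.
  congr (_ * \det _); apply/matrixP => i j.
  rewrite !mxE !lift_max /= ltn_ord mul1r -LZ -LD; congr (L _ _).
  have -> : (n - j = (n.-1 - j).+1)%N by have := ltn_ord j; lia.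
  have -> : (n - j.+1 = n.-1 - j)%N by lia.
  by rewrite exprS -mul_polyC polyCN; ring.
rewrite mxE /b ltjn /F !L_last !hornerM !hornerXn.
have -> : (n - j = (n - j.+1).+1)%N by lia.
by rewrite exprS; ring.
Qed.

End Rows.
End Branching.

(** * Alternants and their coefficients *)

(** The coefficient of the monomial with exponents e in the determinant with
    entries (P j)(z_i). *)
Definition coef_det (A : comNzRingType) n (P : nat -> {poly A}) (e : 'I_n -> nat) : A :=
  \det (\matrix_(i < n, j < n) (P j)`_(e i)).

Definition alternant (A : comNzRingType) (q : A) n (lam : nat -> nat) (e : 'I_n -> nat) : A :=
  coef_det (fun j => gcol q n (lam j) j) e.

Lemma eq_coef_det (A : comNzRingType) n (P Q : nat -> {poly A}) (e e' : 'I_n -> nat) :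
  (forall i j : 'I_n, (P j)`_(e i) = (Q j)`_(e' i)) -> coef_det P e = coef_det Q e'.
Proof. by move=> eqPQ; congr (\det _); apply/matrixP => i j; rewrite !mxE. Qed.

Lemma eq_alternant (A : comNzRingType) (q : A) n lam lam' (e : 'I_n -> nat) :
  (forall i, (i < n)%N -> lam i = lam' i) ->
  alternant q lam e = alternant q lam' e.
Proof. by move=> eql; apply: eq_coef_det => i j; rewrite eql. Qed.

Lemma gcol_coef (A : comNzRingType) (q : A) n k j e :
  (gcol q n k j)`_e = if (e < k + (n.-1 - j))%N then 0
                      else ((1 - q *: 'X) ^+ j)`_(e - (k + (n.-1 - j))).
Proof. by rewrite /gcol coefXnM. Qed.

Lemma lin_exp_coef0 (A : comNzRingType) (q : A) j : ((1 - q *: 'X) ^+ j)`_0 = 1.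
Proof.
by rewrite -horner_coef0 horner_exp hornerD hornerN hornerZ hornerX hornerC mulr0 subr0 expr1n.
Qed.

Lemma size_lin_exp (A : comNzRingType) (q : A) j :
  (size ((1 - q *: 'X) ^+ j : {poly A})%R <= j.+1)%N.
Proof.
have le2 : (size (1 - q *: 'X : {poly A})%R <= 2)%N.
  rewrite (leq_trans (size_polyD _ _)) // size_poly1 size_polyN geq_max /=.
  by rewrite (leq_trans (size_scale_leq _ _)) // size_polyX.
elim: j => [|j IH]; first by rewrite expr0 size_poly1.
rewrite exprS (leq_trans (size_polyMleq _ _)) // -subn1 leq_subLR.
by rewrite (leq_trans (leq_add le2 IH)) // -addn1.
Qed.

(** A permutation cannot match exponents of small sum with the lower bounds d
    on the order of vanishing of the columns. *)
Lemma coef_det_low_degree (A : comNzRingType) n (P : nat -> {poly A})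
    (e : 'I_n -> nat) (d : nat -> nat) :
  (forall (j : 'I_n) k, (k < d j)%N -> (P j)`_k = 0) ->
  (\sum_(i < n) e i < \sum_(j < n) d j)%N -> coef_det P e = 0.
Proof.
move=> P0 lt_ed; rewrite /coef_det /determinant big1 // => s _.
have [i lti] : exists i, (e i < d (s i))%N.
  apply/existsP; apply: contraLR lt_ed; rewrite negb_exists -leqNgt => /forallP le_de.
  rewrite (reindex_inj (@perm_inj _ s)) /=; apply: leq_sum => i _.
  by rewrite leqNgt.
by rewrite (bigD1 i) //= mxE P0 // mul0r mulr0.
Qed.

Definition stair n (l : partition_le n) (i : 'I_n) : nat := (part l i + (n.-1 - i))%N.

Lemma alternant_low_degree (A : comNzRingType) (q : A) n (l : partition_le n)
    (e : 'I_n -> nat) :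
  (\sum_(i < n) e i < psize l + \sum_(i < n) (n.-1 - i))%N ->
  alternant q (part l) e = 0.
Proof.
rewrite /psize -big_split /= => lt_e.
apply: (coef_det_low_degree (d := fun j => part l j + (n.-1 - j))%N) => // j k ltk.
by rewrite gcol_coef ltk.
Qed.

Lemma alternant_big_part (A : comNzRingType) (q : A) n (lam : nat -> nat)
    (e : 'I_n -> nat) (j : 'I_n) :
  (forall i, e i < lam j)%N -> alternant q lam e = 0.
Proof.
move=> lt_e; rewrite /alternant /coef_det (expand_det_col _ j) big1 // => i _.
by rewrite mxE gcol_coef (leq_trans (lt_e i)) ?leq_addr // mul0r.
Qed.

(** An increasing permutation and its inverse both move every point up. *)
Lemma homo_perm_id n (s : 'S_n) :
  (forall i j : 'I_n, (i < j)%N -> (s i < s j)%N) -> s = 1%g.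
Proof.
have grows (t : 'S_n) (i : 'I_n) :
    (forall i j : 'I_n, (i < j)%N -> (t i < t j)%N) -> (i <= t i)%N.
  move=> t_homo; case: i => m; elim: m => [|m IH] ltm //.
  have := IH (ltnW ltm); have /= := t_homo (Ordinal (ltnW ltm)) (Ordinal ltm) (ltnSn m).
  by move=> h1 h2; exact: leq_ltn_trans h2 h1.
move=> s_homo; apply/permP => i; rewrite perm1; apply/val_inj/eqP.
rewrite eqn_leq grows // andbT.
have := grows (s^-1)%g (s i); rewrite permK; apply=> {}i j ltij.
rewrite ltnNge leq_eqVlt; apply/negP => /orP[/eqP/val_inj/perm_inj eqji|].
  by rewrite eqji ltnn in ltij.
by move/s_homo; rewrite !permKV ltnNge ltnW.
Qed.

(** The exponents in a nonzero term of the determinant bound those of l' from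
    above, up to a permutation.  The size hypothesis makes the sums equal,
    hence the sequences, and both being strictly decreasing the permutation is
    the identity. *)
Lemma alternant_lead (A : comNzRingType) (q : A) n (l l' : partition_le n) :
  (psize l <= psize l')%N -> alternant q (part l') (stair l) = (l' == l)%:R.
Proof.
move=> le_ll'; rewrite /alternant /coef_det /determinant.
have key (s : 'S_n) :
    (\prod_i (\matrix_(i < n, j < n) (gcol q n (part l' j) j)`_(stair l i)) i (s i) != 0) ->
    s = 1%g /\ l' = l.
  move=> nz.
  have le_i i : (stair l' (s i) <= stair l i)%N.
    rewrite leqNgt; apply: contra nz => lti.
    by rewrite (bigD1 i) //= mxE gcol_coef lti mul0r.
  have eq_i i : stair l' (s i) = stair l i.
    have leq_s : (\sum_i stair l' (s i) <= \sum_i stair l i ?= iff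
      [forall (i | true), stair l' (s i) == stair l i])%N.
      by apply: leqif_sum => j _; apply/leqif_eq.
    have /eqP : \sum_i stair l' (s i) = \sum_i stair l i.
      apply/eqP; rewrite eqn_leq leq_s /=.
      have <- : \sum_i stair l' i = \sum_i stair l' (s i).
        by rewrite (reindex_inj (@perm_inj _ s)).
      by rewrite /stair !big_split /= leq_add2r.
    by rewrite leq_s => /forallP /(_ i)/eqP.
  have stair_lt (k : partition_le n) (i j : 'I_n) : (i < j)%N -> (stair k j < stair k i)%N.
    move=> ltij; rewrite /stair -ltnS -addSn; have := part_le k (ltnW ltij).
    by have := ltn_ord j; lia.
  have s1 : s = 1%g.
    apply: homo_perm_id => i j ltij; rewrite ltnNge leq_eqVlt.
    apply/negP => /orP[/eqP/val_inj/perm_inj eqji|].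
      by rewrite eqji ltnn in ltij.
    move/(stair_lt l'); rewrite !eq_i => /ltnW; rewrite leqNgt.
    by rewrite stair_lt.
  split=> //; apply: part_inj => i ltin.
  have := eq_i (Ordinal ltin); rewrite s1 perm1 /stair /=.
  by move/addIn.
rewrite (bigD1 1%g) //= [X in _ + X]big1 ?addr0 => [|s ns1]; last first.
  have [->|/key[s1 _]] := eqVneq
    (\prod_i (\matrix_(i < n, j < n) (gcol q n (part l' j) j)`_(stair l i)) i (s i)) 0.
    by rewrite mulr0.
  by rewrite s1 eqxx in ns1.
rewrite odd_perm1 expr0 mul1r.
have [->|nll'] := eqVneq l' l; last first.
  apply/eqP; apply: contraNT nll' => /key[_ ->]; exact: eqxx.
by apply: big1 => i _; rewrite mxE perm1 gcol_coef ltnn subnn lin_exp_coef0.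
Qed.

(** Coordinates in the basis of alternants, for formal power series; the
    bound M keeps the sum finite and does not matter once it exceeds the
    exponents. *)
Definition expands (A : comNzRingType) (q : A) n (c : partition_le n -> A)
    (B : ('I_n -> nat) -> A) : Prop :=
  forall M (e : 'I_n -> nat), (forall i, e i < M)%N ->
  \sum_(l <- partitions_below n M) c l * alternant q (part l) e = B e.

Lemma stair_lt n (l : partition_le n) i : (stair l i < psize l + n)%N.
Proof.
have := part_le_psize l i; have := ltn_ord i; rewrite /stair; lia.
Qed.

(** Triangularity: the coefficient at the leading monomial of l gives c l
    from the coordinates of smaller degree. *)
Lemma expands_rec (A : comNzRingType) (q : A) n c B (l : partition_le n) :
  expands q c B ->
  c l = B (stair l) -
    \sum_(l' <- partitions_below n (psize l + n) | (psize l' < psize l)%N)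
       c l' * alternant q (part l') (stair l).
Proof.
move=> /(_ _ _ (stair_lt l)) <-.
rewrite (bigID (fun l' => (psize l' < psize l)%N)) /= addrAC subrr add0r.
have inl : l \in partitions_below n (psize l + n).
  rewrite mem_partitions_below; apply/forallP => i.
  by have := part_le_psize l i; have := ltn_ord i; lia.
rewrite (big_rem l) //= ltnn alternant_lead // eqxx mulr1.
rewrite big1_seq ?addr0 // => l' /andP[]; rewrite -leqNgt => le_l.
rewrite (mem_rem_uniq _ (uniq_partitions_below _ _)) inE => /andP[/negbTE nl _].
by rewrite alternant_lead // nl mulr0.
Qed.

Lemma expands_unique (A : comNzRingType) (q : A) n c c' B :
  expands q (n := n) c B -> expands q c' B -> forall l, c l = c' l.
Proof.
move=> Ec Ec' l; have [m] := ubnP (psize l); elim: m l => // m IH l.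
rewrite ltnS => le_m; rewrite (expands_rec l Ec) (expands_rec l Ec').
congr (_ - _); apply: eq_bigr => l' ltl'; rewrite IH //.
exact: leq_trans ltl' le_m.
Qed.

(** The alternant of the empty partition is the Vandermonde determinant: its
    columns are a unitriangular combination of powers. *)
Lemma alternant_empty (A : comNzRingType) (q : A) n (e : 'I_n -> nat) :
  alternant q (fun=> 0%N) e = coef_det (fun j => 'X^(n.-1 - j)) e.
Proof.
pose U : 'M[A]_n := \matrix_(k, j)
  (if (k <= j)%N then ((1 - q *: 'X) ^+ j)`_(j - k) else 0).
have trigU : is_trig_mx U^T.
  by apply/is_trig_mxP => i j ltij; rewrite !mxE leqNgt ltij.
have detU : \det U = 1.
  rewrite -det_tr (det_trig trigU) big1 // => i _.
  by rewrite !mxE leqnn subnn lin_exp_coef0.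
rewrite -[RHS]mulr1 -detU -det_mulmx; congr (\det _); apply/matrixP => i j.
rewrite !mxE gcol_coef add0n.
under eq_bigr => k _ do rewrite !mxE coefXn.
have ltjn := ltn_ord j.
have [ltne|le_en] := ltnP n.-1 (e i).
  rewrite ltnNge (leq_trans (leq_subr _ _) (ltnW ltne)) /= big1 => [|k _].
    rewrite nth_default // (leq_trans (size_lin_exp _ _)) //; lia.
  by rewrite gtn_eqF ?mul0r // (leq_ltn_trans (leq_subr _ _) ltne).
have ltk : (n.-1 - e i < n)%N by lia.
rewrite (bigD1 (Ordinal ltk)) //= subKn // eqxx mul1r big1 ?addr0 => [|k nk].
  have -> : (n.-1 - e i <= j)%N = ~~ (e i < n.-1 - j)%N by lia.
  case: ifP => //= ge_e; congr (_`_ _); lia.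
suff /negbTE -> : e i != (n.-1 - k)%N by rewrite mul0r.
apply: contra nk => /eqP eE; apply/eqP/val_inj => /=.
by have := ltn_ord k; lia.
Qed.

(** * Congruence of polynomials modulo a power of the variable *)

Definition eqmodX (A : nzRingType) N (P Q : {poly A}) :=
  forall e, (e < N)%N -> P`_e = Q`_e.

Section EqmodX.
Variables (A : comNzRingType) (N : nat).
Implicit Types P Q : {poly A}.

Lemma eqmodXM P P' Q Q' :
  eqmodX N P P' -> eqmodX N Q Q' -> eqmodX N (P * Q) (P' * Q').
Proof.
move=> hP hQ e lt_e; rewrite !coefM; apply: eq_bigr => i _.
rewrite hP ?hQ //; first exact: leq_ltn_trans (leq_subr _ _) lt_e.
by apply: leq_ltn_trans lt_e; rewrite -ltnS.
Qed.

Lemma eqmodXMl P Q Q' : eqmodX N Q Q' -> eqmodX N (P * Q) (P * Q').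
Proof. exact: eqmodXM. Qed.

Lemma eqmodXMr P P' Q : eqmodX N P P' -> eqmodX N (P * Q) (P' * Q).
Proof. by move=> hP; apply: eqmodXM. Qed.

Lemma eqmodX_trans Q P S : eqmodX N P Q -> eqmodX N Q S -> eqmodX N P S.
Proof. by move=> h1 h2 e lt_e; rewrite h1 ?h2. Qed.

(** The polynomial 1 - a X is invertible modulo a power of X. *)
Lemma eqmodX_unitl (a : A) P Q :
  eqmodX N ((1 - a *: 'X) * P) ((1 - a *: 'X) * Q) -> eqmodX N P Q.
Proof.
have co (S : {poly A}) e :
    ((1 - a *: 'X) * S)`_e.+1 = S`_e.+1 - a * S`_e.
  by rewrite mulrBl mul1r coefB -scalerAl coefZ coefXM.
move=> hPQ; elim=> [|e IH] lt_e.
  have := hPQ 0%N lt_e; rewrite !mulrBl !mul1r !coefB -!scalerAl !coefZ !coefXM.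
  by rewrite mulr0 !subr0.
have := hPQ _ lt_e; rewrite !co IH ?(ltnW lt_e) //.
by move/addIr.
Qed.

Lemma eqmodX_addXn P Q Z : P = Q + 'X^N * Z -> eqmodX N P Q.
Proof. by move=> -> e lt_e; rewrite coefD coefXnM lt_e addr0. Qed.

Definition geom_poly (a : A) d : {poly A} := \poly_(k < d) a ^+ k.

Lemma geom_polyE a d :
  (1 - a *: 'X) * geom_poly a d = 1 - (a ^+ d) *: 'X^d.
Proof.
apply/polyP => -[|e].
  rewrite mulrBl mul1r -scalerAl !(coefB, coefZ, coefXM, coefXn, coef1) coef_poly.
  by case: d => [|d] /=; rewrite ?mulr0 ?mulr1 ?subr0 ?subrr ?expr0 ?mulr1 ?subrr.
rewrite mulrBl mul1r -scalerAl !(coefB, coefZ, coefXM, coefXn, coef1) !coef_poly /=.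
case: (ltngtP e.+1 d) => [lt|gt|eqd].
- by rewrite exprS !mulr0 !subr0 subrr.
- by rewrite !mulr0 !subr0.
- by rewrite -eqd mulr1 exprS.
Qed.

End EqmodX.

(** * A Pieri rule *)

(** Taylor coefficients of (u - v z) / (1 - a z). *)
Definition homography_coef (A : nzRingType) (u v a : A) (k : nat) : A :=
  if k is k'.+1 then (u * a - v) * a ^+ k' else u.

(** Row j of l contributes this factor to the coefficient of the alternant of
    l in the product of the alternant of mu by all (u - v z_i) / (1 - a z_i).
    It sees only the parts mu j and mu j.-1: new boxes in columns not covered
    by row j.-1 of mu bear powers of a, those below row j.-1 powers of q. *)
Definition pieri_weight (A : nzRingType) (q u v a : A) (mu : nat -> nat) (j m : nat) : A :=
  if (m < mu j)%N then 0
  else if (j == 0%N) || (m <= mu j.-1)%N then homography_coef u v a (m - mu j)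
  else a ^+ (mu j.-1 - mu j) * (u * q - v) * q ^+ (m - (mu j.-1).+1).

Section Pieri.
Variables (A : comNzRingType) (q u v a : A).

Definition homography_poly N : {poly A} := \poly_(k < N) homography_coef u v a k.

Lemma homography_polyE N :
  eqmodX N (homography_poly N) ((u%:P - v *: 'X) * geom_poly a N).
Proof.
move=> e lt_e; rewrite /homography_poly coef_poly lt_e mulrBl mul_polyC -scalerAl.
rewrite coefB !coefZ coefXM !coef_poly lt_e.
case: e lt_e => [|e] lt_e /=; first by rewrite mulr0 subr0 mulr1.
by rewrite ltnW // exprS mulrBl mulrA.
Qed.

Lemma homography_poly_lin N :
  eqmodX N ((1 - a *: 'X) * homography_poly N) (u%:P - v *: 'X).
Proof.
apply: eqmodX_trans (eqmodXMl _ (@homography_polyE N)) _.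
apply: (eqmodX_addXn (Z := - (a ^+ N) *: (u%:P - v *: 'X))).
by rewrite mulrCA geom_polyE -!mul_polyC polyCN; ring.
Qed.

Lemma gcolD n j k0 k : gcol q n (k0 + k) j = 'X^k * gcol q n k0 j.
Proof. by rewrite /gcol mulrA -exprD; congr ('X^_ * _); lia. Qed.

(** Terms of index at least N are invisible modulo X^N, so the sum can be
    recentred at the first index k0 where w is nonzero. *)
Lemma gcol_series n j k0 N (w : nat -> A) :
  (forall m, (m < k0)%N -> w m = 0) ->
  eqmodX N (\sum_(m < N) w m *: gcol q n m j)
           ((\poly_(k < N) w (k0 + k)%N) * gcol q n k0 j).
Proof.
move=> w0 e lt_e; pose G m := w m *: gcol q n m j.
have -> : (\poly_(k < N) w (k0 + k)%N) * gcol q n k0 j = \sum_(0 <= m < k0 + N) G m.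
  rewrite (big_cat_nat (n := k0)) ?leq_addr //=.
  rewrite big_nat big1 ?add0r => [|m /andP[_ /w0 wm]]; last by rewrite /G wm scale0r.
  have := big_addn 0 (k0 + N) k0 predT G; rewrite add0n addKn => ->.
  rewrite poly_def mulr_suml big_mkord; apply: eq_bigr => m _.
  by rewrite /G [(m + _)%N]addnC gcolD scalerAl.
rewrite -(big_mkord predT G) [in RHS](big_cat_nat (n := N)) ?leq_addl //= coefD.
rewrite [in X in _ = _ + X]big_nat [X in _ = _ + X]coef_sum.
rewrite [X in _ = _ + X]big1 ?addr0 // => m /andP[leN _].
rewrite /G coefZ gcol_coef ifT ?mulr0 //.
by apply: leq_trans lt_e _; apply: leq_trans leN (leq_addr _ _).
Qed.

(** Column j.+1 has one factor 1 - q X more than column j, and its exponent of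
    X is smaller by one, which the part k.+1 in place of k makes up for. *)
Lemma geom_gcol n j k N : (j.+1 < n)%N ->
  eqmodX N (geom_poly q N * gcol q n k.+1 j.+1) (gcol q n k j).
Proof.
move=> ltj; apply: (eqmodX_addXn (Z := - q ^+ N *: gcol q n k j)).
have -> : gcol q n k.+1 j.+1 = (1 - q *: 'X) * gcol q n k j.
  rewrite /gcol exprS mulrCA; congr (_ * ('X^_ * _)); lia.
rewrite mulrA [geom_poly _ _ * _]mulrC geom_polyE -!mul_polyC polyCN; ring.
Qed.

(** The first column, with no neighbour to its left. *)
Lemma pieri_col0 n mu N :
  eqmodX N (\sum_(m < N) pieri_weight q u v a mu 0 m *: gcol q n m 0)
           (homography_poly N * gcol q n (mu 0%N) 0).
Proof.
apply: eqmodX_trans (@gcol_series _ _ (mu 0%N) _ _ _) _ => [m ltm|].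
  by rewrite /pieri_weight ltm.
apply: eqmodXMr => e lt_e; rewrite !coef_poly lt_e /pieri_weight /=.
by rewrite ltnNge leq_addr /= addKn.
Qed.

(** The generating series of the weights, starting at mu j.+1, is
    (u - v X) / (1 - a X) times 1 + (q - a) a^d X^(d + 1) / (1 - q X),
    where d = mu j - mu j.+1.  The second term
    is a multiple of the preceding column, which a column operation removes. *)
Lemma pieri_colS n mu j N : (j.+1 < n)%N -> (mu j.+1 <= mu j)%N ->
  eqmodX N (\sum_(m < N) pieri_weight q u v a mu j.+1 m *: gcol q n m j.+1)
           (homography_poly N * (gcol q n (mu j.+1) j.+1 +
              ((q - a) * a ^+ (mu j - mu j.+1)) *: gcol q n (mu j) j)).
Proof.
move=> ltj le_mu; set d := (mu j - mu j.+1)%N; set kap := (q - a) * a ^+ d.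
apply: eqmodX_trans (@gcol_series _ _ (mu j.+1) _ _ _) _ => [m ltm|].
  by rewrite /pieri_weight ltm.
pose W := u%:P + (u * a - v) *: ('X * geom_poly a d) +
  (a ^+ d * (u * q - v)) *: ('X^(d.+1) * geom_poly q N).
have hW : eqmodX N (\poly_(k < N) pieri_weight q u v a mu j.+1 (mu j.+1 + k)) W.
  move=> e lt_e; rewrite coef_poly lt_e /pieri_weight /= ltnNge leq_addr /=.
  rewrite /W !(coefD, coefZ, coefC, coefXM, coefXnM, coef_poly) addKn.
  have -> : (mu j.+1 + e <= mu j)%N = (e <= d)%N by rewrite /d; lia.
  have -> : (mu j.+1 + e - (mu j).+1 = e - d.+1)%N by rewrite /d; lia.
  case: e lt_e => [|e] lt_e /=; first by rewrite !mulr0 !addr0.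
  rewrite ltnS; case: (ltnP e d) => led; first by rewrite add0r mulr0 addr0.
  by rewrite mulr0 !add0r ifT // (leq_ltn_trans (leq_subr _ _)).
have hWlin : eqmodX N W (homography_poly N * (1 + kap *: ('X^(d.+1) * geom_poly q N))).
  apply: (@eqmodX_unitl _ _ a); rewrite mulrA.
  apply: eqmodX_trans _ (fun e lt => esym (eqmodXMr _ (@homography_poly_lin N) lt)).
  apply: (@eqmodX_unitl _ _ q); apply: (eqmodX_addXn (Z := (q ^+ N) *: ('X^(d.+1) *
    (kap *: (u%:P - v *: 'X) - (a ^+ d * (u * q - v)) *: (1 - a *: 'X))))).
  have -> : (1 - q *: 'X) * ((1 - a *: 'X) * W) =
    (1 - q *: 'X) * (u *: (1 - a *: 'X) + (u * a - v) *: ('X * ((1 - a *: 'X) * geom_poly a d)))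
    + (a ^+ d * (u * q - v)) *: ('X^(d.+1) * (1 - a *: 'X) * ((1 - q *: 'X) * geom_poly q N)).
    by rewrite /W -!mul_polyC; ring.
  have -> : (1 - q *: 'X) * ((u%:P - v *: 'X) *
        (1 + kap *: ('X^(d.+1) * geom_poly q N))) =
     (u%:P - v *: 'X) * (1 - q *: 'X + kap *: ('X^(d.+1) *
        ((1 - q *: 'X) * geom_poly q N))).
    by rewrite -!mul_polyC; ring.
  rewrite !geom_polyE /kap exprS -!mul_polyC !(polyCB, polyCM, polyC_exp); ring.
apply: eqmodX_trans (eqmodXMr _ hW) _; apply: eqmodX_trans (eqmodXMr _ hWlin) _.
rewrite -mulrA; apply: eqmodXMl => e lt_e.
rewrite mulrDl mul1r !coefD; congr (_ + _).
rewrite -scalerAl !coefZ; congr (_ * _).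
rewrite [_ * geom_poly _ _]mulrC -mulrA -gcolD.
have -> : (mu j.+1 + d.+1 = (mu j).+1)%N by rewrite /d; lia.
exact: geom_gcol.
Qed.

Lemma gcol_geom n j k N : (j.+1 < n)%N ->
  eqmodX N (\sum_(m < N | (k < m)%N) q ^+ (m - k.+1) *: gcol q n m j.+1)
           (gcol q n k j).
Proof.
move=> ltj e lt_e; rewrite -(geom_gcol k ltj lt_e) big_mkcond /=.
pose w m := if (k < m)%N then q ^+ (m - k.+1) else 0.
rewrite (eq_bigr (fun m : 'I_N => w m *: gcol q n m j.+1)) => [|m _]; last first.
  by rewrite /w; case: ifP => // _; rewrite scale0r.
rewrite (@gcol_series _ _ k.+1 _ _ _) // => [|m ltm]; last by rewrite /w ltnNge -ltnS ltm.
apply: (@eqmodXMr _ N) => // i lti; rewrite !coef_poly lti /w.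
by rewrite ltnS leq_addr addKn.
Qed.

(** The contributions of the g whose first ascent is at k cancel: summing over
    the entry at k.+1 makes column k.+1 proportional to column k. *)
Lemma pieri_cancel n mu N (e : 'I_n -> nat) (k : nat) :
  (forall j, mu j.+1 <= mu j)%N -> (forall i, e i < N)%N -> (k.+1 < n)%N ->
  \sum_(g : {ffun 'I_n -> 'I_N} |
      [forall i : 'I_n, (i < k)%N ==> (extend0 g i.+1 <= extend0 g i)%N] &&
      (extend0 g k < extend0 g k.+1)%N)
    (\prod_(j < n) pieri_weight q u v a mu j (extend0 g j)) *
    alternant q (extend0 g) e = 0.
Proof.
move=> mu_le lt_e ltk1; have ltk := ltnW ltk1.
pose j0 := Ordinal ltk; pose j1 := Ordinal ltk1.
have N_gt0 : (0 < N)%N by apply: leq_ltn_trans (lt_e j0).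
pose upd (h : {ffun 'I_n -> 'I_N}) m := [ffun i => if i == j1 then m else h i].
pose z0 := Ordinal N_gt0.
rewrite (partition_big (fun g => upd g z0) predT) //=; apply: big1 => h _.
have updE h' m (i : nat) : i != k.+1 -> extend0 (upd h' m) i = extend0 h' i.
  move=> ni; have [lti|lei] := ltnP i n; last by rewrite !extend0_out.
  rewrite !(extend0_ord _ lti) ffunE ifN //.
have updk1 h' m : extend0 (upd h' m) k.+1 = m.
  by rewrite (extend0_ord _ ltk1) ffunE eqxx.
rewrite (reindex_onto (upd h) (fun g => g j1)) => [|g /andP[_ /eqP <-]]; last first.
  by apply/ffunP => i; rewrite !ffunE; case: eqP => [->|].
pose C := [forall i : 'I_n, (i < k)%N ==> (extend0 h i.+1 <= extend0 h i)%N] &&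
  (h j1 == z0).
rewrite (eq_bigl (fun m : 'I_N => C && (extend0 h k < m)%N)) => [|m]; last first.
  have -> : [forall i : 'I_n, (i < k)%N ==>
        (extend0 (upd h m) i.+1 <= extend0 (upd h m) i)%N] =
      [forall i : 'I_n, (i < k)%N ==> (extend0 h i.+1 <= extend0 h i)%N].
    apply: eq_forallb => i; case: (ltnP i k) => //= lti.
    by rewrite !updE // ltn_eqF // ltnW.
  have -> : (upd (upd h m) z0 == h) = (h j1 == z0).
    apply/eqP/eqP => [<-|h0]; first by rewrite ffunE eqxx.
    by apply/ffunP => i; rewrite !ffunE; case: eqP => [->|].
  rewrite ffunE eqxx eqxx andbT updk1 (updE _ _ k) ?ltn_eqF // /C.
  by rewrite -!andbA; congr (_ && _); rewrite andbC.
case: C; last by rewrite big_pred0.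
pose W := \prod_(j < n | j != j1) pieri_weight q u v a mu j (extend0 h j).
have prodE (m : 'I_N) : \prod_(j < n) pieri_weight q u v a mu j (extend0 (upd h m) j) =
    pieri_weight q u v a mu k.+1 m * W.
  rewrite (bigD1 j1) //= updk1; congr (_ * _); apply: eq_bigr => j nj.
  by rewrite updE //; apply: contra nj => /eqP jk; apply/eqP/val_inj.
under eq_bigr => m _ do rewrite prodE.
have [lt_mu|le_mu] := ltnP (extend0 h k) (mu k).
  apply: big1 => m _; rewrite /W (bigD1 j0) //=; last by rewrite -val_eqE /= ltn_eqF.
  by rewrite /pieri_weight lt_mu mul0r mulr0 mul0r.
pose K := a ^+ (mu k - mu k.+1) * (u * q - v) * q ^+ (extend0 h k - mu k).
have wE (m : 'I_N) : (extend0 h k < m)%N ->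
    pieri_weight q u v a mu k.+1 m = K * q ^+ (m - (extend0 h k).+1).
  move=> ltm; rewrite /pieri_weight /= ifN; last first.
    by rewrite -leqNgt (leq_trans (mu_le k)) // (leq_trans le_mu) // ltnW.
  rewrite ifN -?ltnNge ?(leq_ltn_trans le_mu) // /K -[RHS]mulrA -exprD.
  by congr (_ * _ ^+ _); lia.
pose M0 := \matrix_(i < n, j < n)
  (if j == j1 then gcol q n (extend0 h k) k else gcol q n (extend0 h j) j)`_(e i).
have detM0 : \det M0 = 0.
  rewrite -det_tr; apply: (@determinant_alternate _ _ _ j0 j1).
    by rewrite -val_eqE /= ltn_eqF.
  move=> i; rewrite !mxE eqxx ifN //.
  by rewrite -val_eqE /= ltn_eqF.
have altE (m : 'I_N) : alternant q (extend0 (upd h m)) e =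
    \sum_i (gcol q n m k.+1)`_(e i) * cofactor M0 i j1.
  rewrite /alternant /coef_det (expand_det_col _ j1); apply: eq_bigr => i _.
  rewrite mxE updk1; congr (_ * (_ * \det _)); apply/matrixP => i' j'; rewrite !mxE.
  have nl : lift j1 j' != j1 by rewrite eq_sym neq_lift.
  rewrite (negbTE nl) updE //.
transitivity (\sum_(m < N | (extend0 h k < m)%N) \sum_i
   (K * W * cofactor M0 i j1) * (q ^+ (m - (extend0 h k).+1) * (gcol q n m k.+1)`_(e i))).
  apply: eq_bigr => m ltm; rewrite wE // altE mulr_sumr; apply: eq_bigr => i _; ring.
rewrite exchange_big /=.
under eq_bigr => i _ do rewrite -mulr_sumr.
transitivity (K * W * \det M0); last by rewrite detM0 mulr0.
rewrite (expand_det_col _ j1) mulr_sumr; apply: eq_bigr => i _.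
rewrite mxE eqxx -(gcol_geom _ ltk1 (lt_e i)) coef_sum -mulrA; congr (_ * _).
rewrite mulrC; congr (_ * _); apply: eq_bigr => m _; exact/esym/coefZ.
Qed.

(** Replacing each column by the weighted sum of all admissible ones does not
    change the determinant; expanding it gives all sequences g, and those that
    are not partitions cancel, grouped by their first ascent. *)
Lemma pieri_alternant n mu N (e : 'I_n -> nat) :
  (forall j, mu j.+1 <= mu j)%N -> (forall i, e i < N)%N ->
  coef_det (fun j => homography_poly N * gcol q n (mu j) j) e =
  \sum_(l <- partitions_below n N)
    (\prod_(j < n) pieri_weight q u v a mu j (part l j)) *
    alternant q (part l) e.
Proof.
move=> mu_le lt_e.
pose H (lam : nat -> nat) := (\prod_(j < n) pieri_weight q u v a mu j (lam j)) *
    alternant q lam e.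
rewrite (@big_partitions_below _ _ _ H).
have -> : coef_det (fun j => homography_poly N * gcol q n (mu j) j) e =
    \sum_(g : {ffun 'I_n -> 'I_N}) H (extend0 g).
  pose F (i : 'I_n) j := (homography_poly N * gcol q n (mu j) j)`_(e i).
  pose c j := if j is j'.+1 then (q - a) * a ^+ (mu j' - mu j) else 0.
  rewrite /coef_det -[LHS](det_add_prev_col F c).
  transitivity (\det (\matrix_(i < n, j < n) \sum_(m < N)
      pieri_weight q u v a mu j m * (gcol q n m j)`_(e i))).
    congr (\det _); apply/matrixP => i j; rewrite !mxE /F /c.
    case: (j : nat) (ltn_ord j) => [|j'] ltj.
      rewrite addr0 -pieri_col0 // coef_sum.
      by apply: eq_bigr => m _; rewrite coefZ.
    rewrite -coefZ -coefD scalerAr -mulrDr -pieri_colS // coef_sum.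
    by apply: eq_bigr => m _; rewrite coefZ.
  rewrite det_sum_cols; apply: eq_bigr => g _; rewrite /H.
  congr (_ * _); first by apply: eq_bigr => j _; rewrite extend0E.
  by congr (\det _); apply/matrixP => i j; rewrite !mxE extend0E.
rewrite (bigID (fun g => sorted geq (ord_tuple_val g))) /= -[RHS]addr0.
congr (_ + _).
pose asc (g : {ffun 'I_n -> 'I_N}) (k : 'I_n) :=
  [forall i : 'I_n, (i < k)%N ==> (extend0 g i.+1 <= extend0 g i)%N] &&
      (extend0 g k < extend0 g k.+1)%N.
have asc_uniq g (k k' : 'I_n) : asc g k -> asc g k' -> k = k'.
  move=> /andP[/forallP h1 h2] /andP[/forallP h1' h2']; apply/val_inj => /=.
  case: (ltngtP k k') => // lt.
    by have := implyP (h1' k) lt; rewrite leqNgt h2.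
  by have := implyP (h1 k') lt; rewrite leqNgt h2'.
have asc_ex g : ~~ sorted geq (ord_tuple_val g) -> exists k, asc g k.
  rewrite sorted_ord_tuple negb_forall => /existsP ex.
  have ex' : exists m, (m < n)%N && (extend0 g m < extend0 g m.+1)%N.
    by case: ex => k; rewrite -ltnNge => h; exists k; rewrite ltn_ord.
  case: (ex_minnP ex') => m /andP[ltm h] minm.
  exists (Ordinal ltm); rewrite /asc /= h andbT.
  apply/forallP => i; apply/implyP => lti; rewrite leqNgt; apply/negP => h'.
  by have := minm i; rewrite ltn_ord h' leqNgt lti => /(_ isT).
have asc_unsorted g k : asc g k -> ~~ sorted geq (ord_tuple_val g).
  move=> /andP[_ h]; rewrite sorted_ord_tuple negb_forall.
  by apply/existsP; exists k; rewrite -ltnNge.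
transitivity (\sum_(k < n) \sum_(g | asc g k) H (extend0 g)).
  under [RHS]eq_bigr => k _ do rewrite big_mkcond.
  rewrite [RHS]exchange_big /= [LHS]big_mkcond; apply: eq_bigr => g _.
  case: ifPn => [/asc_ex[k0 asc0]|sg].
    rewrite (bigD1 k0) //= asc0 big1 ?addr0 // => k nk.
    by case: ifP => // /(asc_uniq _ _ _ asc0) eqk; rewrite eqk eqxx in nk.
  by rewrite big1 // => k _; case: ifP => // /asc_unsorted; rewrite (negbTE sg).
apply: big1 => k _; have [ltk|lek] := ltnP k.+1 n.
  exact: pieri_cancel.
by apply: big1 => g /andP[_]; rewrite (extend0_out _ lek).
Qed.

End Pieri.

(** * Products of power series in the basis of alternants *)

Lemma partitions_below_eq (V : nmodType) n N N' (H : partition_le n -> V) :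
  (forall l, H l != 0 ->
     (l \in partitions_below n N) && (l \in partitions_below n N')) ->
  \sum_(l <- partitions_below n N) H l = \sum_(l <- partitions_below n N') H l.
Proof.
move=> Hin; transitivity (\sum_(l <- partitions_below n (maxn N N')) H l).
  symmetry; apply: partitions_below_stable; first exact: leq_maxl.
  by move=> l; apply: contraNeq => /Hin/andP[].
apply: partitions_below_stable; first exact: leq_maxr.
by move=> l; apply: contraNeq => /Hin/andP[].
Qed.

Definition series_mul (A : nzRingType) (s t : nat -> A) (k : nat) : A :=
  \sum_(i < k.+1) s i * t (k - i)%N.

(** Coefficients of f(z_1) ... f(z_n) times the Vandermonde determinant, where
    t lists the coefficients of f. *)
Definition series_det (A : comNzRingType) n (t : nat -> A) (e : 'I_n -> nat) : A :=
  \det (\matrix_(i < n, j < n)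
    if (n.-1 - j <= e i)%N then t (e i - (n.-1 - j))%N else 0).

Lemma series_detE (A : comNzRingType) n (t : nat -> A) (e : 'I_n -> nat) M :
  (forall i, e i < M)%N ->
  series_det t e = coef_det (fun j => \poly_(k < M) t k * 'X^(n.-1 - j)) e.
Proof.
move=> lt_e; congr (\det _); apply/matrixP => i j; rewrite !mxE coefMXn.
case: (ltnP (e i) (n.-1 - j)) => // lee; rewrite coef_poly.
by rewrite (leq_ltn_trans (leq_subr _ _)).
Qed.

(** Multiplication by S(z_1) ... S(z_n) acts on each row separately. *)
Lemma coef_det_mull (A : comNzRingType) n (S : {poly A}) (P : nat -> {poly A})
    (e : 'I_n -> nat) M :
  (forall i, e i < M)%N ->
  coef_det (fun j => S * P j) e =
  \sum_(d : {ffun 'I_n -> 'I_M})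
    (\prod_i (if (d i <= e i)%N then S`_(e i - d i) else 0)) * coef_det P (fun i => d i).
Proof.
move=> lt_e; rewrite -(det_sum_rows
  (fun i (k : 'I_M) => if (k <= e i)%N then S`_(e i - k) else 0)
  (fun i (k : 'I_M) j => (P j)`_k)).
congr (\det _); apply/matrixP => i j; rewrite !mxE coefMr.
rewrite (big_ord_widen M (fun k => S`_(e i - k) * (P j)`_k)) //.
rewrite big_mkcond; apply: eq_bigr => k _; rewrite ltnS.
by case: ifP; rewrite ?mul0r.
Qed.

Definition pieri_prod (A : comNzRingType) (q u v a : A) n (mu l : partition_le n) : A :=
  \prod_(j < n) pieri_weight q u v a (part mu) j (part l j).

Definition pieri_step (A : comNzRingType) (q u v a : A) n (c : partition_le n -> A)
    (l : partition_le n) : A :=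
  \sum_(mu <- partitions_below n (psize l).+1) c mu * pieri_prod q u v a mu l.

Lemma pieri_prod_neq0 (A : comNzRingType) (q u v a : A) n (mu l : partition_le n) (i : 'I_n) :
  pieri_prod q u v a mu l != 0 -> (part mu i <= part l i)%N.
Proof.
rewrite leqNgt; apply: contra => lt_l.
by rewrite /pieri_prod (bigD1 i) //= /pieri_weight lt_l mul0r.
Qed.

(** Multiplying a series by a homography transforms its coordinates by the
    Pieri rule: all sums involved are finite once the exponents are fixed. *)
Lemma expands_pieri (A : comNzRingType) (q u v a : A) n (c : partition_le n -> A) t :
  expands q c (series_det t) ->
  expands q (pieri_step q u v a c)
    (series_det (series_mul (homography_coef u v a) t)).
Proof.
move=> Ec M e lt_e.
transitivity (\sum_(l <- partitions_below n M) \sum_(mu <- partitions_below n M)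
    c mu * (pieri_prod q u v a mu l * alternant q (part l) e)).
  rewrite !big_seq; apply: eq_bigr => l.
  rewrite mem_partitions_below => /forallP ltM; rewrite /pieri_step mulr_suml.
  under [RHS]eq_bigr => mu _ do rewrite mulrA.
  apply: partitions_below_eq => mu nz.
  have le_l (i : 'I_n) : (part mu i <= part l i)%N.
    apply: (@pieri_prod_neq0 _ q u v a); apply: contraNneq nz => ->.
    by rewrite mulr0 mul0r.
  rewrite !mem_partitions_below; apply/andP; split; apply/forallP => i.
    by rewrite ltnS (leq_trans (le_l i)) ?part_le_psize.
  exact: leq_ltn_trans (le_l i) (ltM i).
rewrite exchange_big /=.
transitivity (\sum_(mu <- partitions_below n M) c mu *
    coef_det (fun j => homography_poly u v a M * gcol q n (part mu j) j) e).
  apply: eq_bigr => mu _; rewrite -mulr_sumr -pieri_alternant // => j.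
  exact: part_le.
pose W (d : {ffun 'I_n -> 'I_M}) := \prod_i
  (if (d i <= e i)%N then (homography_poly u v a M)`_(e i - d i) else 0).
transitivity (\sum_(d : {ffun 'I_n -> 'I_M}) W d * series_det t (fun i => d i)).
  under eq_bigr => mu _ do rewrite (coef_det_mull _ _ lt_e) mulr_sumr.
  rewrite exchange_big /=; apply: eq_bigr => d _.
  rewrite -(Ec M) => [|i]; last exact: ltn_ord.
  by rewrite mulr_sumr; apply: eq_bigr => mu _; rewrite mulrCA.
transitivity (coef_det (fun j => homography_poly u v a M *
    (\poly_(k < M) t k * 'X^(n.-1 - j))) e).
  rewrite (coef_det_mull _ _ lt_e); apply: eq_bigr => d _; congr (_ * _).
  by apply: series_detE => i; exact: ltn_ord.
rewrite (series_detE _ lt_e); apply: eq_coef_det => i j.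
rewrite mulrA !coefMXn; case: ifP => // _; rewrite coefM coef_poly.
rewrite (leq_ltn_trans (leq_subr _ _)) //; apply: eq_bigr => k _.
have lt_k : (k < M)%N.
  by apply: leq_trans (ltn_ord k) _; apply: leq_ltn_trans (leq_subr _ _) (lt_e i).
rewrite !coef_poly lt_k ifT //.
by apply: leq_ltn_trans (leq_subr _ _) _; apply: leq_ltn_trans (leq_subr _ _) (lt_e i).
Qed.

Lemma expands_one (A : comNzRingType) (q : A) n :
  expands q (fun l : partition_le n => (psize l == 0)%:R)
    (series_det (fun k => (k == 0)%:R)).
Proof.
move=> M e lt_e.
have [l0 l0E] : exists l : partition_le n, forall i, (i < n)%N -> part l i = 0%N.
  exact: (@part_mk n (fun=> 0%N)).
have ps0 l : (psize l == 0%N) = (l == l0).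
  apply/eqP/eqP => [ps|->].
    apply: part_inj => i lti; rewrite l0E //; apply/eqP; rewrite -leqn0 -ps.
    exact: part_le_psize.
  by apply: big1 => i _; exact: l0E.
rewrite (big_rem l0) /=; last first.
  rewrite mem_partitions_below; apply/forallP => i.
  by rewrite l0E ?ltn_ord // (leq_ltn_trans _ (lt_e i)).
rewrite ps0 eqxx mul1r big1_seq ?addr0 => [|l]; last first.
  rewrite (mem_rem_uniq _ (uniq_partitions_below _ _)) inE => /andP[_ /andP[/negbTE nl _]].
  by rewrite ps0 nl mul0r.
rewrite (@eq_alternant _ _ _ _ (fun=> 0%N)) // alternant_empty.
congr (\det _); apply/matrixP => i j; rewrite !mxE coefXn.
case: leqP => [le_e|lt].
  by congr (nat_of_bool _)%:R; lia.
by rewrite ltn_eqF.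
Qed.

(** * Grothendieck polynomials *)

(** Reducing each column modulo the monic polynomial with roots z_i writes it
    as a combination of 1, ..., z^(n-1), so the matrix is a Vandermonde matrix
    times another one. *)
Lemma det_horner_vander (A : comNzRingType) n (z : 'I_n -> A) (P : nat -> {poly A}) :
  exists g, \det (\matrix_(i < n, j < n) (P j).[z i]) =
            g * \det (\matrix_(i < n, j < n) z i ^+ (n.-1 - j)).
Proof.
pose Q := \prod_(i < n) ('X - (z i)%:P).
have Qmonic : Q \is monic by exact: monic_prod_XsubC.
have sizeQ : size Q = n.+1 by rewrite size_prod_XsubC -sum1_size sum1_card card_ord.
pose r j := Pdiv.CommonRing.rmodp (P j) Q.
exists (\det (\matrix_(k < n, j < n) (r j)`_(n.-1 - k))).
rewrite mulrC -det_mulmx; congr (\det _); apply/matrixP => i j; rewrite !mxE.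
have -> : (P j).[z i] = (r j).[z i].
  rewrite {1}(Pdiv.RingMonic.rdivp_eq Qmonic (P j)) hornerD hornerM.
  rewrite [Q.[_]]horner_prod (bigD1 i) //= hornerXsubC subrr mul0r mulr0.
  by rewrite add0r.
rewrite (@horner_coef_wide _ n); last first.
  by rewrite -ltnS -sizeQ Pdiv.CommonRing.ltn_rmodpN0 ?monic_neq0.
rewrite (reindex_inj rev_ord_inj) /=; apply: eq_bigr => k _; rewrite !mxE mulrC.
by have -> : (n - k.+1 = n.-1 - k)%N by lia.
Qed.

Section Groth.
Variables (R : realType) (p : R).
Hypothesis p_neq1 : p != 1.

Local Notation Xv i := (mpolyX R (mnm1 i)).

Lemma mcoeff_prod_horner n (Q : 'I_n -> {poly R}) (m : multinom n) :
  mcoeff m (\prod_(i < n) (map_poly (mpolyC n (R := R)) (Q i)).[Xv i]) =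
  \prod_(i < n) (Q i)`_(m i).
Proof.
pose N := (\max_(i < n) size (Q i) + \max_(i < n) m i).+1.
have sizeN i : (size (Q i) <= N)%N.
  by apply: leqW; apply: leq_trans (leq_addr _ _); exact: leq_bigmax.
have ltN i : (m i < N)%N.
  by rewrite ltnS; apply: leq_trans (leq_addl _ _); exact: leq_bigmax.
under eq_bigr => i _ do
  rewrite (@horner_coef_wide _ N) ?(leq_trans _ (sizeN i)) ?size_map_poly //.
rewrite bigA_distr_bigA /= raddf_sum /=.
have termE (f : {ffun 'I_n -> 'I_N}) :
    \prod_(i < n) ((map_poly (mpolyC n (R := R)) (Q i))`_(f i) * Xv i ^+ f i) =
    mpolyC n (\prod_(i < n) (Q i)`_(f i)) * mpolyX R (Multinom [tuple (f i : nat) | i < n]).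
  rewrite big_split /= rmorph_prod /= mpolyXE_id; congr (_ * _).
    by apply: eq_bigr => i _; rewrite coef_map.
  by apply: eq_bigr => i _; rewrite mnmE.
under eq_bigr => f _ do rewrite termE mcoeffCM mcoeffX.
rewrite (bigD1 [ffun i => Ordinal (ltN i)]) //= [X in _ + X]big1 ?addr0 => [|f nf].
  have -> : Multinom [tuple (([ffun i => Ordinal (ltN i)] : {ffun 'I_n -> 'I_N}) i : nat) | i < n] = m.
    by apply/mnmP => i; rewrite mnmE ffunE.
  by rewrite eqxx mulr1; apply: eq_bigr => i _; rewrite ffunE.
rewrite (_ : _ == m = false) ?mulr0 //; apply: contraNF nf => /eqP fE.
apply/eqP/ffunP => i; apply/val_inj; rewrite ffunE /= -fE.
by rewrite mnmE.
Qed.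

Lemma mcoeff_det_horner n (P : nat -> {poly R}) (m : multinom n) :
  mcoeff m (\det (\matrix_(i < n, j < n)
     (map_poly (mpolyC n (R := R)) (P j)).[Xv i])) = coef_det P m.
Proof.
rewrite /coef_det /determinant raddf_sum /=; apply: eq_bigr => s _.
rewrite !mulr_sign (fun_if (mcoeff m)) mcoeffN.
have -> : \prod_(i < n) (\matrix_(i < n, j < n)
     (map_poly (mpolyC n (R := R)) (P j)).[Xv i]) i (s i) =
   \prod_(i < n) (map_poly (mpolyC n (R := R)) (P (s i))).[Xv i].
  by apply: eq_bigr => i _; rewrite mxE.
rewrite mcoeff_prod_horner.
have -> : \prod_(i < n) (\matrix_(i < n, j < n) (P j)`_(m i)) i (s i) =
    \prod_(i < n) (P (s i))`_(m i) by apply: eq_bigr => i _; rewrite mxE.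
by [].
Qed.

Lemma gcol_map (A B : nzRingType) (f : {rmorphism A -> B}) (q : A) n k j :
  map_poly f (gcol q n k j) = gcol (f q) n k j.
Proof.
by rewrite /gcol rmorphM rmorphXn /= map_polyX rmorphXn rmorphB rmorph1 /=
   map_polyZ map_polyX.
Qed.

Lemma groth_numE n (l : partition_le n) :
  groth_num p l = \det (\matrix_(i < n, j < n)
     (gcol (mpolyC n p) n (part l j) j).[Xv i]).
Proof.
congr (\det _); apply/matrixP => i j; rewrite !mxE gcol_horner.
by rewrite mul_mpolyC.
Qed.

Lemma mcoeff_groth_num n (l : partition_le n) (m : multinom n) :
  mcoeff m (groth_num p l) = alternant p (part l) m.
Proof.
rewrite groth_numE /alternant -mcoeff_det_horner; congr (mcoeff m (\det _)).
by apply/matrixP => i j; rewrite !mxE gcol_map.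
Qed.

Lemma mcoeff_groth_den n (m : multinom n) :
  mcoeff m (groth_den (R := R) n) = coef_det (fun j => 'X^(n.-1 - j)) m.
Proof.
rewrite -mcoeff_det_horner; congr (mcoeff m (\det _)).
by apply/matrixP => i j; rewrite !mxE map_polyXn hornerXn.
Qed.

Lemma groth_den_neq0 n : groth_den (R := R) n != 0.
Proof.
have [l0 l0E] : exists l : partition_le n, forall i, (i < n)%N -> part l i = 0%N.
  exact: (@part_mk n (fun=> 0%N)).
pose m := Multinom [tuple stair l0 i | i < n].
have : mcoeff m (groth_den (R := R) n) = 1.
  rewrite mcoeff_groth_den -(alternant_empty 0) -(@eq_alternant _ _ _ (part l0)) //.
  transitivity (alternant (0 : R) (part l0) (stair l0)).
    by apply: eq_coef_det => i j; rewrite /m mnmE.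
  by rewrite alternant_lead // eqxx.
by apply: contra_eq_neq => ->; rewrite mcoeff0 eq_sym oner_neq0.
Qed.

Lemma groth_mul_den n (l : partition_le n) :
  groth p l * groth_den n = groth_num p l.
Proof.
suff : exists g, g * groth_den n = groth_num p l by move/(xgetPex 0).
have [g gE] := det_horner_vander (fun i => Xv i)
  (fun j => gcol (mpolyC n p) n (part l j) j).
by exists g; rewrite groth_numE gE.
Qed.

(** Branching weight of a pair of partitions, for one variable equal to r. *)
Definition branch_prod (A : comNzRingType) (q r : A) n (lam mu : nat -> nat) : A :=
  r ^+ lam n * \prod_(j < n) branch_weight q r (lam j) (lam j.+1) (mu j).

Lemma branch_prod_unsorted (A : comNzRingType) (q r : A) n N lam
    (g : {ffun 'I_n -> 'I_N}) :
  ~~ sorted geq (ord_tuple_val g) -> branch_prod q r n lam (extend0 g) = 0.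
Proof.
rewrite sorted_ord_tuple negb_forall => /existsP[ i ]; rewrite -ltnNge => lti.
have [lt1|le1] := ltnP i.+1 n; last by rewrite (extend0_out _ le1) in lti.
rewrite /branch_prod (bigD1 i) //=.
case: (leqP (lam i.+1) (extend0 g i)) => lei; last first.
  by rewrite {1}/branch_weight leqNgt lei /= mul0r mulr0.
rewrite (bigD1 (Ordinal lt1)) /=; last by rewrite -val_eqE /= gtn_eqF.
rewrite {2}/branch_weight [(extend0 g i.+1 <= _)%N]leqNgt (leq_ltn_trans lei lti).
by rewrite andbF mul0r !mulr0.
Qed.

Lemma branch_prod_map (A B : comNzRingType) (f : {rmorphism A -> B}) q r n lam mu :
  f (branch_prod q r n lam mu) = branch_prod (f q) (f r) n lam mu.
Proof.
rewrite /branch_prod rmorphM rmorphXn rmorph_prod; congr (_ * _).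
apply: eq_bigr => j _; rewrite /branch_weight (fun_if f) rmorphM rmorphXn.
by rewrite (fun_if f) rmorphB rmorphM rmorph1 rmorph0.
Qed.

(** Substituting 1 for the last variable turns both determinants of the
    quotient into n by n ones with the factors z_i - 1; these cancel, and only
    then are the remaining variables set to 1. *)
Lemma groth_branch n (l : partition_le n.+1) B : (part l 0 < B)%N ->
  groth1 p l = \sum_(mu <- partitions_below n B)
     branch_prod p 1 n (part l) (part mu) * groth1 p mu.
Proof.
move=> ltB.
pose h (i : 'I_n.+1) : mpoly n R := if unlift ord_max i is Some j then Xv j else 1.
pose hs : n.+1.-tuple (mpoly n R) := [tuple h i | i < n.+1].
pose L i (P : {poly mpoly n R}) := P.[h i].
have hlast : h ord_max = 1 by rewrite /h unlift_none.
have hlift i : h (lift ord_max i) = Xv i by rewrite /h liftK.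
have L_lin i a P Q : L i (a *: P + Q) = a * L i P + L i Q.
  by rewrite /L hornerD hornerZ.
have L_last P : L ord_max P = P.[1] by rewrite /L hlast.
pose D := \prod_(i < n) (Xv i - 1).
have X1_neq0 (i : 'I_n) : Xv i - 1 != 0 :> mpoly n R.
  apply/eqP => /(congr1 (mcoeff (mnm1 i))).
  rewrite mcoeffB mcoeffXU eqxx mcoeff1 mnm1_eq0 subr0 mcoeff0.
  by apply/eqP; exact: oner_neq0.
have D_neq0 : D * groth_den (R := R) n != 0.
  by rewrite mulf_neq0 ?groth_den_neq0 //; apply/prodf_neq0 => i _.
have detX (P : nat -> {poly mpoly n R}) :
    \det (\matrix_(i < n, j < n) L (lift ord_max i) (('X - 1%:P) * P j)) =
    D * \det (\matrix_(i < n, j < n) (P j).[Xv i]).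
  rewrite -det_scale_rows; congr (\det _); apply/matrixP => i j.
  by rewrite !mxE /L hlift hornerM hornerXsubC.
have evX i : comp_mpoly hs (Xv i) = h i.
  by rewrite comp_mpolyXU -tnth_nth tnth_mktuple.
have ev_det (M : 'M[mpoly n.+1 R]_n.+1) :
    comp_mpoly hs (\det M) = \det (map_mx (comp_mpoly hs) M).
  by rewrite det_map_mx.
have ev_den : comp_mpoly hs (groth_den n.+1) = D * groth_den n.
  rewrite /groth_den ev_det.
  have -> : map_mx (comp_mpoly hs) (\matrix_(i, j) Xv i ^+ (n.+1.-1 - j)) =
      \matrix_(i < n.+1, j < n.+1) L i (1 * 'X^(n - j)).
    by apply/matrixP => i j; rewrite !mxE rmorphXn /= evX /L mul1r hornerXn.
  rewrite (det_branch_power L_lin L_last) hornerC mul1r.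
  rewrite (detX (fun j => 1 * 'X^(n.-1 - j))); congr (_ * \det _).
  by apply/matrixP => i j; rewrite !mxE mul1r hornerXn.
pose q : mpoly n R := mpolyC n p.
have ev_num : comp_mpoly hs (groth_num p l) = D * groth_den n *
    \sum_(mu <- partitions_below n B)
      mpolyC n (branch_prod p 1 n (part l) (part mu)) * groth p mu.
  rewrite groth_numE ev_det.
  have -> : map_mx (comp_mpoly hs) (\matrix_(i, j)
       (gcol (mpolyC n.+1 p) n.+1 (part l j) j).[Xv i]) =
      \matrix_(i < n.+1, j < n.+1) L i (gcol q n.+1 (part l j) j).
    apply/matrixP => i j; rewrite !mxE /L !gcol_horner.
    by rewrite rmorphM !rmorphXn rmorphB rmorph1 rmorphM /= evX comp_mpolyC.
  rewrite (det_branch L_lin L_last _ _ ltB); first last.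
  - by move=> j; exact: part_le.
  - rewrite mulr1; apply/eqP => /(congr1 (mcoeff (mnm0 (n := n)))).
    rewrite mcoeffB mcoeff1 mcoeffC eqxx mulr1 mcoeff0 => /eqP.
    by rewrite subr_eq0 eq_sym (negbTE p_neq1).
  pose H (mu : nat -> nat) := mpolyC n (branch_prod p 1 n (part l) mu) *
    (D * \det (\matrix_(i < n, j < n) (gcol q n (mu j) j).[Xv i])).
  transitivity (\sum_(mu <- partitions_below n B) H (part mu)).
    rewrite big_partitions_cond => [|g /branch_prod_unsorted unsg]; last first.
      by rewrite /H unsg mpolyC0 mul0r.
    apply: eq_bigr => g _; rewrite /H -(detX (fun j => gcol q n (extend0 g j) j)).
    rewrite (branch_prod_map (@mpolyC n R)) /= mpolyC1; apply: congr2; last first.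
      by congr (\det _); apply/matrixP => i j; rewrite !mxE extend0E.
    by rewrite /branch_prod; congr (_ * _); apply: eq_bigr => j _; rewrite extend0E.
  rewrite mulr_sumr; apply: eq_bigr => mu _.
  rewrite /H -groth_numE -groth_mul_den; ring.
have ev_groth : comp_mpoly hs (groth p l) = \sum_(mu <- partitions_below n B)
      mpolyC n (branch_prod p 1 n (part l) (part mu)) * groth p mu.
  by apply: (mulfI D_neq0); rewrite -ev_num -groth_mul_den rmorphM /= ev_den mulrC.
have := congr1 (meval (fun=> 1)) ev_groth.
rewrite comp_mpoly_meval raddf_sum /= => eval_eq.
rewrite /groth1; transitivity (meval (fun i => meval (fun=> 1) (tnth hs i)) (groth p l)).
  apply: meval_eq => i; rewrite tnth_mktuple /h.
  by case: unlift => [j|]; rewrite ?mevalXU ?meval1.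
rewrite eval_eq; apply: eq_bigr => mu _.
by rewrite mevalM mevalC.
Qed.

End Groth.

Section GrothExpansion.
Variables (R : realType) (p : R).
Hypotheses (p_gt0 : 0 < p) (p_lt1 : p < 1).

Local Notation Xv i := (mpolyX R (mnm1 i)).

Lemma branch_weight1_ge0 a b m : 0 <= branch_weight p 1 a b m.
Proof.
rewrite /branch_weight; case: ifP => // _; rewrite expr1n mul1r mulr1.
by case: ifP => _; rewrite ?subr_ge0 ?ltW.
Qed.

Lemma branch_prod1_ge0 n lam mu : 0 <= branch_prod p 1 n lam mu.
Proof.
rewrite /branch_prod expr1n mul1r; apply: prodr_ge0 => j _.
exact: branch_weight1_ge0.
Qed.

Lemma groth_skew1E n (l : partition_le n.+1) (mu : partition_le n) :
  groth_skew1 p l mu = branch_prod p 1 n (part l) (part mu).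
Proof.
rewrite /groth_skew1 /branch_prod expr1n mul1r.
case: ifPn => [/asboolP inter|ninter].
  rewrite -prodr_const big_mkcond; apply: eq_bigr => j _.
  rewrite /branch_weight; have := inter j; rewrite andbC => ->.
  by rewrite expr1n mul1r mulr1.
suff [j /negbTE nj] : exists j : 'I_n, ~~ (part l j.+1 <= part mu j <= part l j)%N.
  by rewrite (bigD1 j) //= /branch_weight nj mul0r.
apply/existsP; apply: contraNT ninter; rewrite negb_exists => /forallP inter.
apply/asboolP => i; have [lti|lei] := ltnP i n.
  by have := inter (Ordinal lti); rewrite negbK andbC.
by rewrite (part_out mu lei) (@part_out _ l i.+1) // leq0n.
Qed.

Lemma groth1_gt0 n (l : partition_le n) : 0 < groth1 p l.
Proof.
elim: n l => [|n IHn] l.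
  have := groth_mul_den p l; rewrite /groth_den /groth_num !det_mx00 mulr1.
  by rewrite /groth1 => ->; rewrite meval1.
rewrite (groth_branch (negbT (lt_eqF p_lt1)) (ltnSn (part l 0))).
have [mu muE] : exists mu : partition_le n, forall i, (i < n)%N -> part mu i = part l i.
  by apply: part_mk => i j /andP[leij _]; exact: part_le.
have in_mu : mu \in partitions_below n (part l 0).+1.
  rewrite mem_partitions_below; apply/forallP => i.
  by rewrite muE // ltnS part_le.
rewrite (big_rem mu) //= ltr_wpDr ?sumr_ge0 // => [nu _|].
  by rewrite mulr_ge0 ?branch_prod1_ge0 ?ltW.
rewrite mulr_gt0 // /branch_prod expr1n mul1r prodr_gt0 // => j _.
rewrite /branch_weight muE // leqnn part_le ?leqnSn //= expr1n mul1r mulr1.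
by case: ifP; rewrite ?subr_gt0.
Qed.

(** The lowest monomials of two polynomials multiply to that of the product,
    so dividing by the Vandermonde determinant, of degree at most d, lowers
    degrees by at most d. *)
Lemma mcoeff_div_den n N (P : mpoly n R) :
  (forall m, (mdeg m < N + \sum_(i < n) (n.-1 - i))%N ->
     mcoeff m (P * groth_den n) = 0) ->
  forall m, (mdeg m < N)%N -> mcoeff m P = 0.
Proof.
move=> PD0 m ltN; apply/eqP; apply: contraT => nz_m.
have P_neq0 : P != 0 by apply: contraNneq nz_m => ->; rewrite mcoeff0.
set D := groth_den n in PD0; have D_neq0 : D != 0 by exact: groth_den_neq0.
have supp_m : m \in msupp P by rewrite mcoeff_msupp.
have degP : (mdeg (mlast P) < N)%N.
  exact: leq_ltn_trans (lemc_mdeg (mlast_lemc supp_m)) ltN.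
have [s] : exists s : {perm 'I_n}, \prod_i ('X^(n.-1 - s i) : {poly R})`_(mlast D i) != 0.
  apply/existsP; apply: contraT; rewrite negb_exists => /forallP z0.
  have := mlast_supp D_neq0; rewrite mcoeff_msupp mcoeff_groth_den => /negP[].
  apply/eqP; rewrite /coef_det /determinant big1 // => s _.
  under eq_bigr => i _ do rewrite mxE.
  by have := z0 s; rewrite negbK => /eqP ->; rewrite mulr0.
move/prodf_neq0 => nz.
have degD : mdeg (mlast D) = (\sum_(i < n) (n.-1 - i))%N.
  rewrite mdegE [RHS](reindex_inj (@perm_inj _ s)); apply: eq_bigr => i _.
  by have := nz i isT; rewrite coefXn; case: (mlast D i =P _) => [-> //|_]; rewrite eqxx.
have := PD0 (mnm_add (mlast P) (mlast D)).
rewrite mdegD degD ltn_add2r => /(_ degP) /eqP.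
set mP := mlast P; set mD := mlast D.
have ltP1 : (mdeg mP < (mdeg (mnm_add mP mD)).+1)%N by rewrite ltnS mdegD leq_addr.
have ltD1 : (mdeg mD < (mdeg (mnm_add mP mD)).+1)%N by rewrite ltnS mdegD leq_addl.
rewrite mcoeffM (bigD1 (BMultinom ltP1, BMultinom ltD1)) //= big1 ?addr0.
  by rewrite mulf_eq0 !mcoeff_eq0 !mlast_supp.
move=> [[k1 lt1] [k2 lt2]] /= /andP[/eqP eqk nk].
case: (ltgtP k1 mP) => [lt|gt|eq1].
- by rewrite mcoeff_lt_mlast ?mul0r.
- rewrite [mcoeff k2 D]mcoeff_lt_mlast ?mulr0 //.
  have [lt2'|le2] := ltP k2 mD => //.
  have := ltmc_le_add gt le2; rewrite eqk addmC.
  by rewrite ltxx.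
- move: nk; rewrite -pair_eqE /= /pair_eq /= -!val_eqE /= eq1 eqxx /=.
  by move: eqk; rewrite eq1 => /addmI ->; rewrite eqxx.
Qed.

Local Notation vdeg n := (\sum_(i < n) (n.-1 - i))%N.

Lemma mcoeff_groth_low n (l : partition_le n) (m : multinom n) :
  (mdeg m < psize l)%N -> mcoeff m (groth p l) = 0.
Proof.
apply: mcoeff_div_den => {}m lt_m; rewrite groth_mul_den mcoeff_groth_num.
by apply: alternant_low_degree; rewrite -mdegE.
Qed.

Lemma mcoeff_groth_out n N (l : partition_le n) (m : multinom n) :
  (mdeg m < N)%N -> l \notin partitions_below n N -> mcoeff m (groth p l) = 0.
Proof.
rewrite mem_partitions_below negb_forall => ltN /existsP[ i ]; rewrite -leqNgt => le_i.
apply: mcoeff_groth_low; apply: leq_trans ltN _; apply: leq_trans le_i _.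
exact: part_le_psize.
Qed.

Definition groth_expands n (c : partition_le n -> R) (t : nat -> R) : Prop :=
  forall N (m : multinom n), (mdeg m < N)%N ->
  \sum_(l <- partitions_below n N) c l * mcoeff m (groth p l) =
  \prod_(i < n) t (m i).

Lemma mcoeff_prod_series n K (t : nat -> R) (m : multinom n) :
  (forall i, m i < K)%N ->
  let S := \prod_(i < n) (map_poly (@mpolyC n R) (\poly_(k < K) t k)).[Xv i] in
  mcoeff m S = \prod_(i < n) t (m i) /\
  mcoeff m (S * groth_den n) = series_det t m.
Proof.
move=> ltK S; split.
  rewrite mcoeff_prod_horner; apply: eq_bigr => i _.
  by rewrite coef_poly ltK.
rewrite (series_detE _ ltK) -mcoeff_det_horner /S /groth_den -det_scale_rows.
congr (mcoeff m (\det _)); apply/matrixP => i j; rewrite !mxE.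
by rewrite rmorphM /= map_polyXn hornerM hornerXn.
Qed.

Lemma mdeg_ge n (m : multinom n) (i : 'I_n) : (m i <= mdeg m)%N.
Proof. by rewrite mdegE (bigD1 i) //= leq_addr. Qed.

(** Multiplying or dividing by the Vandermonde determinant. *)
Lemma groth_expandsP n (c : partition_le n -> R) t :
  groth_expands c t <-> expands p c (series_det t).
Proof.
pose P K : mpoly n R := \sum_(l <- partitions_below n K) c l *: groth p l -
  \prod_(i < n) (map_poly (@mpolyC n R) (\poly_(k < K) t k)).[Xv i].
have coefP K (m : multinom n) : (mdeg m < K)%N -> mcoeff m (P K) =
    \sum_(l <- partitions_below n K) c l * mcoeff m (groth p l) -
    \prod_(i < n) t (m i).
  move=> ltK; have ltm i := leq_ltn_trans (mdeg_ge m i) ltK.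
  rewrite mcoeffB (mcoeff_prod_series t ltm).1 raddf_sum; congr (_ - _).
  by apply: eq_bigr => l _; rewrite /= mcoeffZ.
have coefPD K (m : multinom n) : (mdeg m < K)%N -> mcoeff m (P K * groth_den n) =
    \sum_(l <- partitions_below n K) c l * alternant p (part l) m - series_det t m.
  move=> ltK; have ltm i := leq_ltn_trans (mdeg_ge m i) ltK.
  rewrite mulrBl mcoeffB (mcoeff_prod_series t ltm).2; congr (_ - _).
  rewrite mulr_suml raddf_sum; apply: eq_bigr => l _ /=.
  by rewrite -scalerAl mcoeffZ groth_mul_den mcoeff_groth_num.
split=> [Ec M e lt_e|Ec N m lt_m].
  pose m : multinom n := Multinom [tuple e i | i < n].
  have mE i : m i = e i by rewrite mnmE.
  pose K := (mdeg m + M).+1.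
  have ltK : (mdeg m < K)%N by rewrite ltnS leq_addr.
  have PD0 : mcoeff m (P K * groth_den n) = 0.
    rewrite mcoeffM big1 // => -[[k1 lt1] [k2 lt2]] /= _.
    rewrite coefP ?Ec ?subrr ?mul0r //; exact: leq_trans lt1 _.
  have altE lam : alternant p lam m = alternant p lam e.
    by apply: eq_coef_det => i j; rewrite mE.
  have serE : series_det t m = series_det t e.
    by congr (\det _); apply/matrixP => i j; rewrite !mxE mE.
  move: PD0; rewrite coefPD // => /eqP; rewrite subr_eq0 serE => /eqP <-.
  symmetry; under eq_bigr => l _ do rewrite altE.
  apply: partitions_below_stable; first by rewrite /K leqW ?leq_addl.
  move=> l; rewrite mem_partitions_below negb_forall => /existsP[ i ].
  rewrite -leqNgt => le_i; rewrite (@alternant_big_part _ _ _ _ _ i) ?mulr0 // => j.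
  exact: leq_trans (lt_e j) le_i.
pose K := (N + vdeg n)%N.
transitivity (\sum_(l <- partitions_below n K) c l * mcoeff m (groth p l)).
  symmetry; apply: partitions_below_stable; first exact: leq_addr.
  by move=> l /(mcoeff_groth_out lt_m) ->; rewrite mulr0.
apply/eqP; rewrite -subr_eq0 -coefP ?(leq_trans lt_m) ?leq_addr //; apply/eqP.
apply: (@mcoeff_div_den _ N) => // k lt_k; rewrite coefPD //.
rewrite Ec ?subrr // => i; exact: leq_ltn_trans (mdeg_ge k i) lt_k.
Qed.

Lemma fsum_partitions (V : nmodType) n N (F : partition_le n -> V) :
  (forall l, l \notin partitions_below n N -> F l = 0) ->
  \sum_(l \in [set: partition_le n]) F l = \sum_(l <- partitions_below n N) F l.
Proof.
move=> F0; rewrite -(fsbig_widen [set` partitions_below n N]) //.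
  by rewrite -fsbig_seq // uniq_partitions_below.
by move=> l [_ /= /negP]; exact: F0.
Qed.

Local Notation to_C := (real_complex R).

Lemma ReMr (z : R[i]) (x : R) : complex.Re (z * to_C x) = complex.Re z * x.
Proof. by case: z => a b; rewrite /= mulr0 subr0. Qed.

Lemma ImMr (z : R[i]) (x : R) : complex.Im (z * to_C x) = complex.Im z * x.
Proof. by case: z => a b; rewrite /= mulr0 add0r. Qed.

Lemma ReD (x y : R[i]) : complex.Re (x + y) = complex.Re x + complex.Re y.
Proof. by case: x y => a b [c d]. Qed.

Lemma ImD (x y : R[i]) : complex.Im (x + y) = complex.Im x + complex.Im y.
Proof. by case: x y => a b [c d]. Qed.

(** The equations that define M, having real coefficients, hold separately
    for its real and imaginary parts; the imaginary part is the family of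
    coordinates of the zero series. *)
Lemma MPhiE (Phi : R[i] -> R[i]) n (c : partition_le n -> R) (t : nat -> R) :
  (forall k, taylor_coef Phi k = to_C (t k)) -> expands p c (series_det t) ->
  forall l, MPhi p Phi l = to_C (c l * groth1 p l).
Proof.
move=> tE Ec l; rewrite /MPhi; case: eqP => [n0|/eqP n_neq0].
  subst n; have g1 : groth1 p l = 1.
    have := groth_mul_den p l; rewrite /groth_den /groth_num !det_mx00 mulr1.
    by rewrite /groth1 => ->; rewrite meval1.
  have psize0 : psize l = 0%N by rewrite /psize big_ord0.
  rewrite g1 mulr1 (expands_rec l Ec) psize0 big_pred0 // subr0.
  by rewrite /series_det det_mx00 rmorph1.
have g_neq0 l' : groth1 p l' != 0 by rewrite gt_eqF ?groth1_gt0.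
have expandC (M : partition_le n -> R[i]) (m : multinom n) N : (mdeg m < N)%N ->
    \sum_(l \in [set: partition_le n])
       M l * to_C (mcoeff m (groth p l) / groth1 p l) =
    \sum_(l <- partitions_below n N)
       M l * to_C (mcoeff m (groth p l) / groth1 p l).
  move=> ltN; apply: fsum_partitions => l' out.
  by rewrite (mcoeff_groth_out ltN out) mul0r rmorph0 mulr0.
have prodC (m : multinom n) :
    \prod_(i < n) taylor_coef Phi (m i) = to_C (\prod_(i < n) t (m i)).
  by rewrite rmorph_prod; apply: eq_bigr => i _; rewrite tE.
suff -> : xget (fun=> 0) [set M | expansion p Phi M] =
    (fun l => to_C (c l * groth1 p l)) by [].
apply: xget_unique => [|M EM] /=.
  move=> m; rewrite prodC (expandC _ m _ (ltnSn _)).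
  have [_ /(_ Ec) gE] := groth_expandsP c t.
  rewrite -(gE _ _ (ltnSn (mdeg m))) rmorph_sum; apply: eq_bigr => l' _.
  by rewrite -rmorphM mulrACA divff // mulr1.
have ReM : groth_expands (fun l => complex.Re (M l) / groth1 p l) t.
  move=> N m ltN; have := congr1 (@complex.Re R) (EM m).
  rewrite prodC (expandC _ _ _ ltN) (big_morph _ (@ReD) (erefl : complex.Re 0 = 0)) /= => <-.
  by apply: eq_bigr => l' _; rewrite ReMr mulrAC mulrA.
have ImM : groth_expands (fun l => complex.Im (M l) / groth1 p l) (fun=> 0).
  move=> N m ltN; have := congr1 (@complex.Im R) (EM m).
  rewrite prodC (expandC _ _ _ ltN) (big_morph _ (@ImD) (erefl : complex.Im 0 = 0)) /=.
  move=> eq0; rewrite prodr_const card_ord expr0n (negbTE n_neq0) -[RHS]eq0.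
  by apply: eq_bigr => l' _; rewrite ImMr mulrAC mulrA.
have zeroE : expands p (fun=> 0) (series_det (n := n) (fun=> (0 : R))).
  move=> N e _; rewrite big1 => [|l' _]; last by rewrite mul0r.
  rewrite /series_det; case: n n_neq0 {EM ReM ImM expandC prodC l Ec c g_neq0 M} e => // n _ e.
  rewrite (expand_det_col _ ord0) big1 // => i _.
  by rewrite mxE if_same mul0r.
apply/funext => l'.
have /(_ l') ReE := expands_unique ((groth_expandsP _ _).1 ReM) Ec.
have /(_ l') ImE := expands_unique ((groth_expandsP _ _).1 ImM) zeroE.
apply/eqP; rewrite eq_complex /= -ReE divfK ?g_neq0 // eqxx /=.
by have /eqP := ImE; rewrite mulf_eq0 invr_eq0 (negbTE (g_neq0 _ l')) orbF.
Qed.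

End GrothExpansion.

(** * Branching of the coordinates *)

Definition interlaced n (lam mu : nat -> nat) : bool :=
  [forall j : 'I_n, lam j.+1 <= mu j <= lam j]%N.

Definition descents n (lam mu : nat -> nat) : nat :=
  #|[pred j : 'I_n | lam j.+1 < mu j]%N|.

(** The one-variable skew polynomial: r to the number of added boxes times a
    power of 1 - q r. *)
Lemma branch_prodE (A : comNzRingType) (q r : A) n lam mu :
  branch_prod q r n lam mu =
  if interlaced n lam mu
  then r ^+ (\sum_(j < n.+1) lam j - \sum_(j < n) mu j)%N *
       (1 - q * r) ^+ descents n lam mu
  else 0.
Proof.
rewrite /branch_prod; case: ifPn => [/forallP inter|]; last first.
  rewrite negb_forall => /existsP[j /negbTE nj].
  by rewrite (bigD1 j) //= {1}/branch_weight nj mul0r mulr0.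
under eq_bigr => j _ do rewrite /branch_weight inter.
rewrite big_split /= mulrA prodrXr -exprD; congr (_ ^+ _ * _); last first.
  by rewrite /descents -prodr_const [RHS]big_mkcond.
rewrite big_ord_recr /= addnC -addnBAC; last first.
  by apply: leq_sum => j _; have /andP[] := inter j.
by congr (_ + _)%N; rewrite sumnB // => j _; have /andP[] := inter j.
Qed.

Lemma branch_coef_low (R : comNzRingType) (p : R) n (l : partition_le n.+1)
    (mu : partition_le n) k :
  (psize mu + k < psize l)%N ->
  (branch_prod p%:P 'X n (part l) (part mu))`_k = 0.
Proof.
move=> lt_k; rewrite branch_prodE; case: ifP => [inter|_]; last by rewrite coef0.
by rewrite coefXnM ltn_subRL lt_k.
Qed.

(** Only the last row depends on the variable, and the determinant is linear
    in it. *)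
Lemma coef_det_last (R : comNzRingType) n (a : 'I_n -> nat -> R) (b : nat -> {poly R}) k :
  (\det (\matrix_(i < n.+1, j < n.+1)
     if unlift ord_max i is Some i' then (a i' j)%:P else b j))`_k =
  \det (\matrix_(i < n.+1, j < n.+1)
     if unlift ord_max i is Some i' then a i' j else (b j)`_k).
Proof.
rewrite !(expand_det_row _ ord_max) coef_sum; apply: eq_bigr => j _.
rewrite !mxE unlift_none.
have -> : cofactor (\matrix_(i < n.+1, j < n.+1)
     if unlift ord_max i is Some i' then (a i' j)%:P else b j) ord_max j =
   (cofactor (\matrix_(i < n.+1, j < n.+1)
     if unlift ord_max i is Some i' then a i' j else (b j)`_k) ord_max j)%:P.
  rewrite /cofactor rmorphM rmorph_sign -det_map_mx; congr (_ * \det _).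
  by apply/matrixP => i' j'; rewrite !mxE liftK.
by rewrite coefMC.
Qed.

Section BranchCoordinates.
Variables (R : idomainType) (p : R) (n : nat).

Section Exponents.
Variable e : 'I_n -> nat.

Let L (i : 'I_n.+1) (P : {poly {poly R}}) : {poly R} :=
  if unlift ord_max i is Some j then P`_(e j).+1 else P.['X].

Let L_lin i a P Q : L i (a *: P + Q) = a * L i P + L i Q.
Proof. by rewrite /L; case: unlift => [j|]; rewrite ?coefD ?coefZ ?hornerD ?hornerZ. Qed.

Let L_last P : L ord_max P = P.['X].
Proof. by rewrite /L unlift_none. Qed.

Definition extend_exp k (i : 'I_n.+1) : nat :=
  if unlift ord_max i is Some j then (e j).+1 else k.

(** The determinant of the columns P, as a series in z_1, ..., z_n, times the
    product of the z_i - r; r is the variable of the ring of coefficients. *)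
Definition shifted_det (P : nat -> {poly R}) : {poly R} :=
  \det (\matrix_(i < n, j < n) (((P j)`_(e i))%:P - 'X * ((P j)`_(e i).+1)%:P)).

Let shifted_detE (P : nat -> {poly R}) :
  \det (\matrix_(i < n, j < n)
     L (lift ord_max i) (('X - 'X%:P) * map_poly polyC (P j))) = shifted_det P.
Proof.
congr (\det _); apply/matrixP => i j; rewrite !mxE /L liftK.
by rewrite mulrBl coefB coefXM coefCM !coef_map.
Qed.

Let L_coef (P : nat -> {poly R}) k :
  (\det (\matrix_(i < n.+1, j < n.+1) L i (map_poly polyC (P j))))`_k =
  coef_det P (extend_exp k).
Proof.
have -> : \matrix_(i < n.+1, j < n.+1) L i (map_poly polyC (P j)) =
  \matrix_(i < n.+1, j < n.+1)
     if unlift ord_max i is Some i' then ((P j)`_(e i').+1)%:P else P j.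
  apply/matrixP => i j; rewrite !mxE /L.
  case: unlift => [i'|]; first by rewrite coef_map.
  by rewrite -[LHS]/((P j) \Po 'X) comp_polyXr.
rewrite (coef_det_last (fun i j => (P j)`_(e i).+1)); congr (\det _).
by apply/matrixP => i j; rewrite !mxE /extend_exp; case: unlift.
Qed.

(** Linear in the coefficients of the determinant of the columns P: hence
    expansions in alternants carry over. *)
Lemma shifted_det_sum (P : nat -> {poly R}) :
  shifted_det P = \sum_(g : {ffun 'I_n -> bool})
    (\prod_i (if g i then - 'X else 1)) * (coef_det P (fun i => (e i + g i)%N))%:P.
Proof.
transitivity (\det (\matrix_(i < n, j < n) \sum_(b : bool)
    (if b then - 'X else 1) * ((P j)`_(e i + b))%:P)).
  congr (\det _); apply/matrixP => i j; rewrite !mxE big_bool /=.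
  by rewrite addn1 addn0 mul1r mulNr addrC.
rewrite (det_sum_rows (fun _ (b : bool) => if b then - 'X else 1)
  (fun i (b : bool) j => ((P j)`_(e i + b))%:P)); apply: eq_bigr => g _.
rewrite -det_map_mx; congr (_ * \det _).
by apply/matrixP => i j; rewrite !mxE.
Qed.

Lemma coef0_shifted_det (P : nat -> {poly R}) : (shifted_det P)`_0 = coef_det P e.
Proof.
rewrite -horner_coef0 /shifted_det -[LHS]/(horner_eval 0 _) -det_map_mx.
congr (\det _); apply/matrixP => i j; rewrite !mxE /= /horner_eval.
by rewrite hornerD hornerN hornerM hornerX !hornerC mul0r subr0.
Qed.

Lemma alternant_branch (l : partition_le n.+1) B k : (part l 0 < B)%N ->
  alternant p (part l) (extend_exp k) =
  (\sum_(mu <- partitions_below n B)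
     branch_prod p%:P 'X n (part l) (part mu) *
     shifted_det (fun j => gcol p n (part mu j) j))`_k.
Proof.
move=> ltB; rewrite /alternant -L_coef; apply: (congr1 (fun P : {poly R} => P`_k)).
have -> : \matrix_(i < n.+1, j < n.+1) L i (map_poly polyC (gcol p n.+1 (part l j) j)) =
    \matrix_(i < n.+1, j < n.+1) L i (gcol p%:P n.+1 (part l j) j).
  by apply/matrixP => i j; rewrite !mxE gcol_map.
have nz : 1 - p%:P * 'X != 0 :> {poly R}.
  apply/eqP => /(congr1 (fun P : {poly R} => P`_0)).
  rewrite coefB coef1 coefCM coefX mulr0 subr0 coef0 => /eqP.
  by rewrite (negbTE (oner_neq0 _)).
rewrite (det_branch L_lin L_last nz _ ltB); last by move=> j; exact: part_le.
pose H (mu : nat -> nat) : {poly R} := branch_prod p%:P 'X n (part l) mu *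
     shifted_det (fun j => gcol p n (mu j) j).
rewrite (@big_partitions_cond _ _ _ H) => [|g unsg]; last first.
  by rewrite /H branch_prod_unsorted ?mul0r.
apply: eq_bigr => g _; rewrite /H -shifted_detE /branch_prod; apply: congr2.
  by congr (_ * _); apply: eq_bigr => j _; rewrite extend0E.
by congr (\det _); apply/matrixP => i j; rewrite !mxE gcol_map extend0E.
Qed.

Lemma series_det_branch (t : nat -> R) K k :
  (forall i, (e i).+1 < K)%N -> (k < K)%N ->
  series_det t (extend_exp k) =
  ((\poly_(i < K) t i) *
     shifted_det (fun j => \poly_(i < K) t i * 'X^(n.-1 - j)))`_k.
Proof.
move=> lt_e lt_k; rewrite (@series_detE _ _ _ _ K); last first.
  by move=> i; rewrite /extend_exp; case: unlift.
rewrite -L_coef; apply: (congr1 (fun P : {poly R} => P`_k)).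
have -> : \matrix_(i < n.+1, j < n.+1) L i
     (map_poly polyC (\poly_(k < K) t k * 'X^(n.+1.-1 - j))) =
   \matrix_(i < n.+1, j < n.+1) L i (map_poly polyC (\poly_(k < K) t k) * 'X^(n - j)).
  by apply/matrixP => i j; rewrite !mxE rmorphM /= map_polyXn.
rewrite (det_branch_power L_lin L_last) -shifted_detE; apply: congr2.
  by rewrite -[LHS]/((\poly_(k < K) t k) \Po 'X) comp_polyXr.
by congr (\det _); apply/matrixP => i j; rewrite !mxE rmorphM /= map_polyXn.
Qed.

End Exponents.

(** Setting the last variable to r and comparing coefficients of r^k.  The
    common factor, the product of the z_i - r, is the product of the z_i
    modulo r, so it can be cancelled by induction on k. *)
Lemma coordinates_branch (c : partition_le n -> R) (c' : partition_le n.+1 -> R) t :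
  expands p c (series_det t) -> expands p c' (series_det t) ->
  forall (mu : partition_le n) k N, (psize mu + k < N)%N ->
  \sum_(l <- partitions_below n.+1 N)
     c' l * (branch_prod p%:P 'X n (part l) (part mu))`_k = t k * c mu.
Proof.
move=> Ec Ec'.
pose x k (mu : partition_le n) := \sum_(l <- partitions_below n.+1 (psize mu + k).+1)
     c' l * (branch_prod p%:P 'X n (part l) (part mu))`_k - t k * c mu.
have xE k mu N : (psize mu + k < N)%N -> x k mu =
    \sum_(l <- partitions_below n.+1 N)
       c' l * (branch_prod p%:P 'X n (part l) (part mu))`_k - t k * c mu.
  move=> ltN; congr (_ - _); symmetry; apply: partitions_below_stable => // l.
  rewrite mem_partitions_below negb_forall => /existsP[ i ]; rewrite -leqNgt => lei.
  rewrite branch_coef_low ?mulr0 //; exact: leq_trans lei (part_le_psize _ _).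
suff x0 k mu : x k mu = 0.
  by move=> mu k N ltN; apply/eqP; rewrite -subr_eq0 -xE // x0.
have zeroE : expands p (fun _ : partition_le n => 0) (fun=> 0).
  by move=> M e _; rewrite big1 // => l _; rewrite mul0r.
elim/ltn_ind: k mu => k IHk; apply: (expands_unique _ zeroE) => M0 e lt_e.
pose M := M0.+1; pose N := (n * M + k + M).+2.
have lt_e1 i : ((e i).+1 < M)%N by rewrite ltnS.
pose E (mu : partition_le n) := shifted_det e (fun j => gcol p n (part mu j) j).
have E0 mu : mu \notin partitions_below n M -> E mu = 0.
  rewrite mem_partitions_below negb_forall => /existsP[ i ]; rewrite -leqNgt => lei.
  rewrite /E shifted_det_sum big1 // => g _.
  rewrite -[coef_det _ _]/(alternant p (part mu) _) (@alternant_big_part _ _ _ _ _ i) ?mulr0 //.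
  move=> j; apply: leq_trans lei; case: (g j); rewrite ?addn1 ?addn0 //.
  exact: ltnW.
have psizeM mu : mu \in partitions_below n M -> (psize mu <= n * M)%N.
  rewrite mem_partitions_below => /forallP ltM.
  rewrite -[n in (n * _)%N]card_ord -sum_nat_const; apply: leq_sum => i _; exact: ltnW.
have lt_ee i : (extend_exp e k i < N)%N.
  rewrite /extend_exp /N; case: unlift => [j|]; last by lia.
  by have := lt_e1 j; lia.
pose T : {poly R} := \poly_(i < N) t i.
have ET : shifted_det e (fun j => T * 'X^(n.-1 - j)) =
    \sum_(mu <- partitions_below n M) (c mu)%:P * E mu.
  under [RHS]eq_bigr => mu _ do rewrite /E shifted_det_sum mulr_sumr.
  rewrite exchange_big shifted_det_sum; apply: eq_bigr => g _.
  under [RHS]eq_bigr => mu _ do rewrite mulrCA.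
  rewrite -mulr_sumr; congr (_ * _).
  have lt_eg i : (e i + g i < M)%N.
    by apply: leq_ltn_trans (lt_e1 i); case: (g i); rewrite ?addn1 ?addn0.
  have lt_egN i : (e i + g i < N)%N.
    by apply: leq_trans (lt_eg i) _; rewrite /N; lia.
  rewrite -(series_detE t lt_egN) -(Ec _ _ lt_eg) rmorph_sum.
  by apply: eq_bigr => mu _; rewrite /= rmorphM.
have key : (\sum_(mu <- partitions_below n M)
    (\sum_(l <- partitions_below n.+1 N)
        (c' l)%:P * branch_prod p%:P 'X n (part l) (part mu) - (c mu)%:P * T) * E mu)`_k = 0.
  under eq_bigr => mu _ do rewrite mulrBl mulr_suml.
  rewrite sumrB coefB; apply/eqP; rewrite subr_eq0; apply/eqP.
  transitivity (series_det t (extend_exp e k)); last first.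
    rewrite (@series_det_branch e t N k); last 2 first.
    - by move=> i; have := lt_e1 i; rewrite /N; lia.
    - by rewrite /N; lia.
    rewrite ET -/T mulr_sumr; apply: (congr1 (fun P : {poly R} => P`_k)).
    by apply: eq_bigr => mu _; ring.
  rewrite -(Ec' _ _ lt_ee) exchange_big /= coef_sum !big_seq.
  apply: eq_bigr => l; rewrite mem_partitions_below => /forallP ltN.
  rewrite (alternant_branch e k (ltN ord0)).
  rewrite -coefCM mulr_sumr; apply: (congr1 (fun P : {poly R} => P`_k)).
  rewrite (@partitions_below_stable _ _ M N); first last.
  - by move=> mu out; rewrite -/(E mu) E0 // !mulr0.
  - by rewrite /N; lia.
  by apply: eq_bigr => mu _; rewrite -mulrA.
rewrite -[RHS]key coef_sum.
rewrite -(@partitions_below_stable _ _ M0 M); first last.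
- move=> mu; rewrite mem_partitions_below negb_forall => /existsP[ i ]; rewrite -leqNgt => lei.
  by rewrite (@alternant_big_part _ _ _ _ _ i) ?mulr0 // => j; exact: leq_trans (lt_e j) lei.
- exact: leqnSn.
rewrite !big_seq; apply: eq_bigr => mu in_mu.
set Y : {poly R} := _ - _.
have Yx i : (i <= k)%N -> Y`_i = x i mu.
  move=> leik; rewrite (@xE _ _ N); last by have := psizeM _ in_mu; rewrite /N; lia.
  rewrite /Y coefB coef_sum coefCM coef_poly ifT; last by rewrite /N; lia.
  by rewrite [c mu * _]mulrC; congr (_ - _); apply: eq_bigr => l _; rewrite coefCM.
rewrite coefM big_ord_recr /= big1 ?add0r => [|i _]; last first.
  by rewrite Yx ?IHk ?mul0r // ltnW.
by rewrite subnn coef0_shifted_det Yx.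
Qed.

End BranchCoordinates.

(** * Nonnegative sequences with a given sum *)

Section HasSum.
Variable R : realType.
Implicit Types (x : nat -> R) (S : R).

Definition has_sum x S : Prop :=
  (forall k, 0 <= x k) /\
  (fun N => \sum_(0 <= k < N) x k) @ \oo --> S.

Lemma has_sum_esum x S : has_sum x S -> (\esum_(k in [set: nat]) (x k)%:E = S%:E)%E.
Proof.
move=> [x_ge0 x_cvg]; rewrite -nneseries_esumT => [|k]; last by rewrite lee_fin.
transitivity (limn (EFin \o (fun N => \sum_(0 <= k < N) x k))).
  by congr (limn _); apply/funext => N /=; rewrite sumEFin.
by rewrite EFin_lim; [congr EFin; exact/cvg_lim | apply/cvg_ex; exists S].
Qed.

Lemma has_sumZ a x S : 0 <= a -> has_sum x S -> has_sum (fun k => a * x k) (a * S).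
Proof.
move=> a_ge0 [x_ge0 x_cvg]; split=> [k|]; first exact: mulr_ge0.
under eq_fun do rewrite -mulr_sumr.
by apply: cvgM => //; exact: cvg_cst.
Qed.

Lemma has_sum_delta d : has_sum (fun k => (k == d)%:R) 1.
Proof.
split=> [k|]; first exact: ler0n.
rewrite -(cvg_shiftn d.+1); apply: cvg_near_cst; near=> N => /=.
rewrite (bigD1_seq d) ?iota_uniq ?mem_index_iota //=; last by lia.
by rewrite eqxx big1 ?addr0 // => k /negbTE ->.
Unshelve. all: by end_near. Qed.

Definition geo (p : R) x : nat -> R := series_mul (fun i => p ^+ i) x.

Lemma geo0 p x : geo p x 0%N = x 0%N.
Proof. by rewrite /geo /series_mul big_ord1 expr0 mul1r. Qed.

Lemma geoS p x k : geo p x k.+1 = x k.+1 + p * geo p x k.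
Proof.
rewrite /geo /series_mul big_ord_recl expr0 mul1r subn0; congr (_ + _).
by rewrite mulr_sumr; apply: eq_bigr => i _; rewrite exprS mulrA.
Qed.

(** Multiplication by 1 / (1 - p z) divides the sum of coefficients by 1 - p. *)
Lemma has_sum_geo p x S : 0 < p -> p < 1 -> has_sum x S ->
  has_sum (geo p x) (S / (1 - p)).
Proof.
move=> p_gt0 p_lt1 [x_ge0 x_cvg].
have y_ge0 k : 0 <= geo p x k.
  by apply: sumr_ge0 => i _; rewrite mulr_ge0 ?exprn_ge0 // ltW.
have q_gt0 : 0 < 1 - p by rewrite subr_gt0.
split=> //; set Y := fun N => _; pose X N := \sum_(0 <= k < N) x k.
have YR N : Y N.+1 = Y N + geo p x N by rewrite /Y big_nat_recr.
have XR N : X N.+1 = X N + x N by rewrite /X big_nat_recr.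
have YS N : Y N.+1 = X N.+1 + p * Y N.
  elim: N => [|N IH].
    by rewrite YR XR /Y /X !big_geq // mulr0 addr0 geo0.
  have := IH; rewrite (YR N.+1) (XR N.+1) geoS (YR N) => eqN.
  by rewrite {1}eqN; ring.
have Ynd : nondecreasing_seq Y.
  apply/nondecreasing_seqP => N; rewrite YR lerDl; exact: y_ge0.
have Xnd : nondecreasing_seq X.
  by apply/nondecreasing_seqP => N; rewrite XR lerDl.
have Xle N : X N <= S.
  rewrite -(cvg_lim _ x_cvg) //; apply: nondecreasing_cvgn_le => //.
  by apply/cvg_ex; exists S.
have Yle N : Y N <= S / (1 - p).
  rewrite ler_pdivlMr // mulrBr mulr1 lerBlDr mulrC.
  by apply: le_trans (Ynd _ _ (leqnSn N)) _; rewrite YS lerD2r.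
have Ycvg : cvgn Y.
  apply: nondecreasing_is_cvgn => //.
  by exists (S / (1 - p)) => _ [N _ <-].
have eqL : limn Y = S + p * limn Y.
  rewrite -{1}(cvg_lim _ (_ : (fun N => Y N.+1) @ \oo --> limn Y)) //; last first.
    by rewrite cvg_shiftS.
  apply: cvg_lim => //; under eq_fun do rewrite YS.
  by apply: cvgD; [rewrite (cvg_shiftS X) | apply: cvgM => //; exact: cvg_cst].
suff -> : S / (1 - p) = limn Y by exact: Ycvg.
have -> : S = limn Y * (1 - p) by rewrite mulrBr mulr1 {1}eqL [p * _]mulrC addrK.
by rewrite mulfK // gt_eqF.
Qed.

End HasSum.

(** * Coherence *)
Section GeoIter.
Variables (R : realType) (p : R).

Lemma eq_geo (x y : nat -> R) K :
  (forall k, (k <= K)%N -> x k = y k) -> geo p x K = geo p y K.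
Proof.
move=> eqxy; apply: eq_bigr => i _; rewrite eqxy //; exact: leq_subr.
Qed.

Lemma eq_iter_geo d (x y : nat -> R) K :
  (forall k, (k <= K)%N -> x k = y k) -> iter d (geo p) x K = iter d (geo p) y K.
Proof.
elim: d K => [|d IH] K eqxy /=; first exact: eqxy.
apply: eq_geo => k lek; apply: IH => i lei; apply: eqxy.
exact: leq_trans lei lek.
Qed.

Lemma geo_sum (I : Type) (s : seq I) (a : I -> R) (x : I -> nat -> R) k :
  geo p (fun k => \sum_(i <- s) a i * x i k) k = \sum_(i <- s) a i * geo p (x i) k.
Proof.
rewrite /geo /series_mul; under eq_bigr => j _ do rewrite mulr_sumr.
rewrite exchange_big; apply: eq_bigr => i _; rewrite mulr_sumr.
by apply: eq_bigr => j _; rewrite mulrCA.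
Qed.

Lemma iter_geo_sum d (I : Type) (s : seq I) (a : I -> R) (x : I -> nat -> R) k :
  iter d (geo p) (fun k => \sum_(i <- s) a i * x i k) k =
  \sum_(i <- s) a i * iter d (geo p) (x i) k.
Proof.
elim: d k => //= d IH k; rewrite -geo_sum; exact: eq_geo.
Qed.

Lemma iter_geoZ d a (x : nat -> R) k :
  iter d (geo p) (fun k => a * x k) k = a * iter d (geo p) x k.
Proof.
have := iter_geo_sum d [:: tt] (fun=> a) (fun=> x) k; rewrite big_seq1 => <-.
by apply: eq_iter_geo => j _; rewrite big_seq1.
Qed.

Lemma geo_lin (P : {poly R}) k :
  geo p (fun i => ((1 - p%:P * 'X) * P)`_i) k = P`_k.
Proof.
have co i : ((1 - p%:P * 'X) * P)`_i = P`_i - (if i is i'.+1 then p * P`_i' else 0).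
  rewrite mulrBl mul1r coefB -mulrA coefCM coefXM.
  by case: i => [|i] //=; rewrite mulr0.
elim: k => [|k IH]; first by rewrite geo0 co subr0.
by rewrite geoS IH co subrK.
Qed.

(** Summing geometrically d times divides by (1 - p X)^d. *)
Lemma iter_geo_lin d (P : {poly R}) k :
  iter d (geo p) (fun i => ((1 - p%:P * 'X) ^+ d * P)`_i) k = P`_k.
Proof.
elim: d P k => [|d IH] P k; first by rewrite expr0 mul1r.
rewrite iterS -[RHS]geo_lin; apply: eq_geo => i _.
by rewrite -IH; apply: eq_iter_geo => j _; rewrite exprSr mulrA.
Qed.

Lemma has_sum_iter_geo d x S : 0 < p -> p < 1 -> has_sum x S ->
  has_sum (iter d (geo p) x) (S / (1 - p) ^+ d).
Proof.
move=> p_gt0 p_lt1 hx; elim: d => [|d IH] /=; first by rewrite expr0 divr1.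
by rewrite exprSr invfM mulrA; apply: has_sum_geo.
Qed.

End GeoIter.

Section Coherence.
Variables (R : realType) (p : R) (t : nat -> R).
Hypotheses (p_gt0 : 0 < p) (p_lt1 : p < 1) (t_sum : has_sum t 1).
Variable c : forall n, partition_le n -> R.
Hypothesis c_expands : forall n, expands p (@c n) (series_det t).
Hypothesis c_ge0 : forall n (l : partition_le n), 0 <= c l.

Lemma esum_swap (T U : choiceType) (a : T -> U -> R) :
  (forall x y, 0 <= a x y) ->
  (\esum_(x in [set: T]) \esum_(y in [set: U]) (a x y)%:E =
   \esum_(y in [set: U]) \esum_(x in [set: T]) (a x y)%:E)%E.
Proof.
move=> a_ge0; rewrite !esum_esum; try by move=> *; rewrite lee_fin.
rewrite (reindex_esum ([set: U] `*`` fun=> [set: T]) ([set: T] `*`` fun=> [set: U])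
  (fun z => (z.2, z.1))) //.
split=> //.
- by move=> [x y] [x' y'] _ _ [-> ->].
- by move=> [x y] _ /=; exists (y, x).
Qed.

Lemma esum_partitions n N (F : partition_le n -> R) :
  (forall l, 0 <= F l) -> (forall l, l \notin partitions_below n N -> F l = 0) ->
  (\esum_(l in [set: partition_le n]) (F l)%:E =
   (\sum_(l <- partitions_below n N) F l)%:E)%E.
Proof.
move=> F_ge0 F0; rewrite (esumID [set` partitions_below n N]) => [|l _]; last first.
  by rewrite lee_fin.
rewrite [X in (_ + X)%E]esum1 ?adde0 => [|l [_ /= /negP out]]; last by rewrite F0.
rewrite setTI esum_fset; last 2 first.
- exact: finite_seq.
- by move=> l _; rewrite lee_fin.
by rewrite -fsbig_seq ?uniq_partitions_below // sumEFin.
Qed.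

(** Both sides of the branching identity, multiplied by (1 - p r)^(-n), have
    nonnegative coefficients, so setting r = 1 is allowed; the factor
    (1 - p)^(-n) is then removed. *)
Lemma esum_branch n (mu : partition_le n) (g : R) : 0 <= g ->
  (\esum_(l in [set: partition_le n.+1])
     (g * (c l * branch_prod p 1 n (part l) (part mu)))%:E = (g * c mu)%:E)%E.
Proof.
move=> g_ge0; have q_gt0 : 0 < 1 - p by rewrite subr_gt0.
pose b (l : partition_le n.+1) k := (branch_prod p%:P 'X n (part l) (part mu))`_k.
pose y l := iter n (geo p) (b l).
pose G := g * (1 - p) ^+ n.
have y_sum l : has_sum (fun k => G * (c l * y l k))
    (g * (c l * branch_prod p 1 n (part l) (part mu))).
  rewrite /y /b !branch_prodE; case: ifP => inter; last first.
    have y0 k : iter n (geo p) (fun k => (0 : {poly R})`_k) k = 0.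
      rewrite (@eq_iter_geo _ _ _ _ (fun k => 0 * 0)) => [|j _].
        by rewrite iter_geoZ mul0r.
      by rewrite coef0 mul0r.
    split=> [k|]; first by rewrite y0 !mulr0.
    under eq_fun => N do under eq_bigr => k _ do rewrite y0 !mulr0.
    under eq_fun => N do rewrite big1 //.
    by rewrite !mulr0; exact: cvg_cst.
  set D := (_ - _)%N; set d := descents _ _ _.
  have le_d : (d <= n)%N by rewrite -[leqRHS]card_ord max_card.
  have yE k : iter n (geo p) (fun k => ('X^D * (1 - p%:P * 'X) ^+ d)`_k) k =
      iter (n - d) (geo p) (fun k => (k == D)%:R) k.
    rewrite -[in LHS](subnK le_d) iterD; apply: eq_iter_geo => j _.
    rewrite -coefXn -(iter_geo_lin p d); apply: eq_iter_geo => i _.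
    by rewrite mulrC.
  have -> : g * (c l * (1 ^+ D * (1 - p * 1) ^+ d)) =
     G * (c l * (1 / (1 - p) ^+ (n - d))).
    have nE : (1 - p) ^+ n = (1 - p) ^+ (n - d) * (1 - p) ^+ d by rewrite -exprD subnK.
    rewrite expr1n mul1r mulr1 /G nE.
    by field; rewrite expf_neq0 // gt_eqF.
  apply: has_sumZ; first by rewrite mulr_ge0 ?exprn_ge0 // ltW.
  apply: has_sumZ; first exact: c_ge0.
  rewrite (_ : iter _ _ _ = iter (n - d) (geo p) (fun k => (k == D)%:R)).
    exact/has_sum_iter_geo/has_sum_delta.
  exact/funext.
have t_sum' : has_sum (fun k => G * (c mu * iter n (geo p) t k)) (g * c mu).
  have -> : g * c mu = G * (c mu * (1 / (1 - p) ^+ n)).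
    by rewrite /G; field; rewrite expf_neq0 // gt_eqF.
  apply: has_sumZ; first by rewrite mulr_ge0 ?exprn_ge0 // ltW.
  by apply: has_sumZ; [exact: c_ge0 | exact: has_sum_iter_geo].
rewrite -(has_sum_esum t_sum').
under eq_esum => l _ do rewrite -(has_sum_esum (y_sum l)).
rewrite esum_swap => [|l k]; last exact: (y_sum l).1.
apply: eq_esum => k _; pose N := (psize mu + k).+1.
have outN l : l \notin partitions_below n.+1 N -> (psize mu + k < psize l)%N.
  rewrite mem_partitions_below negb_forall => /existsP[ i ]; rewrite -leqNgt => lei.
  exact: leq_trans lei (part_le_psize _ _).
rewrite (@esum_partitions _ N); first last.
- move=> l /outN lt_l; have -> : y l k = 0; last by rewrite !mulr0.
  rewrite /y (@eq_iter_geo _ _ _ _ (fun k => 0 * 0)) => [|j lej].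
    by rewrite iter_geoZ mul0r.
  by rewrite mul0r /b branch_coef_low // (leq_ltn_trans _ lt_l) // leq_add2l.
- by move=> l; exact: (y_sum l).1.
rewrite -mulr_sumr; congr (G * _)%:E; rewrite -iter_geo_sum -iter_geoZ.
apply: eq_iter_geo => j lej.
rewrite (coordinates_branch (@c_expands n) (@c_expands n.+1)) 1?mulrC //.
by rewrite /N ltnS leq_add2l.
Qed.

(** Coherence is the branching identity at r = 1.  Total masses then agree at
    all levels, because the branching rule for the values at 1 makes the
    transition weights out of a partition sum to 1, and level 0 has mass 1. *)
Lemma coherent_coordinates :
  coherent_system p (fun n (l : partition_le n) => c l * groth1 p l).
Proof.
have g_gt0 n (l : partition_le n) : 0 < groth1 p l by exact: groth1_gt0.
have M_ge0 n (l : partition_le n) : 0 <= c l * groth1 p l.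
  by rewrite mulr_ge0 // ltW.
split=> [n|n mu]; last first.
  rewrite [X in _ = X%:E]mulrC -(esum_branch mu (ltW (g_gt0 _ mu))).
  apply: eq_esum => l _; rewrite groth_skew1E; congr EFin.
  by field; rewrite gt_eqF ?g_gt0.
split=> //; elim: n => [|n IHn].
  have [l0 _] : exists l : partition_le 0, forall i, (i < 0)%N -> part l i = 0%N.
    exact: (@part_mk 0 (fun=> 0%N)).
  have l0E l : l = l0 by apply: part_inj.
  rewrite (_ : [set: _] = [set l0]); last by apply/seteqP; split=> l _ //=; exact: l0E.
  rewrite esum_set1 ?lee_fin //; congr EFin.
  have -> : groth1 p l0 = 1.
    have := groth_mul_den p l0; rewrite /groth_den /groth_num !det_mx00 mulr1.
    by rewrite /groth1 => ->; rewrite meval1.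
  have psize0 : psize l0 = 0%N by rewrite /psize big_ord0.
  rewrite mulr1 (expands_rec l0 (@c_expands 0)) psize0 big_pred0 // subr0.
  by rewrite /series_det det_mx00.
pose a (l : partition_le n.+1) (mu : partition_le n) :=
  groth1 p mu * (c l * branch_prod p 1 n (part l) (part mu)).
have a_ge0 l mu : 0 <= a l mu.
  apply: mulr_ge0; first exact: ltW.
  by apply: mulr_ge0; [exact: c_ge0 | exact: branch_prod1_ge0].
rewrite -IHn; transitivity (\esum_(l in [set: partition_le n.+1])
    \esum_(mu in [set: partition_le n]) (a l mu)%:E)%E.
  apply: eq_esum => l _; rewrite (@esum_partitions _ (part l 0).+1) //.
    congr EFin; rewrite (groth_branch (negbT (lt_eqF p_lt1)) (ltnSn (part l 0))).
    by rewrite mulr_sumr; apply: eq_bigr => mu _; rewrite /a; ring.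
  move=> mu; rewrite mem_partitions_below negb_forall => /existsP[ i ].
  rewrite -leqNgt => lei; rewrite /a /branch_prod (bigD1 i) //= {1}/branch_weight.
  rewrite [(part mu i <= part l i)%N]leqNgt (leq_ltn_trans (part_le l (leq0n i)) lei).
  by rewrite andbF mul0r !mulr0.
rewrite esum_swap //; apply: eq_esum => mu _.
by rewrite esum_branch 1?mulrC // ltW.
Qed.

End Coherence.

(** * Complex power series *)

Section ComplexSeries.
Variable R : realType.
Implicit Types (x y z h : R[i]) (a : nat -> R).

Local Notation to_C := (real_complex R).
Local Notation cnorm := (@Normc.normc R).

Lemma norm_cnorm z : `|z| = to_C (cnorm z).
Proof. by []. Qed.

Lemma cnorm_ge0 z : 0 <= cnorm z.
Proof. by rewrite -lecR -[X in _ <= X]norm_cnorm normr_ge0. Qed.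

Lemma cnormD x y : cnorm (x + y) <= cnorm x + cnorm y.
Proof. by rewrite -lecR rmorphD; exact: (@ler_normD _ R[i]). Qed.

Lemma cnormN x : cnorm (- x) = cnorm x.
Proof. by case: x => b c; rewrite /= !sqrrN. Qed.

Lemma cnormB x y : cnorm (x - y) = cnorm (y - x).
Proof. by rewrite -cnormN opprB. Qed.

Lemma cnormX z k : cnorm (z ^+ k) = cnorm z ^+ k.
Proof.
elim: k => [|k IH]; first by rewrite !expr0 Normc.normc1.
by rewrite !exprS Normc.normcM IH.
Qed.

Lemma cnorm_real (b : R) : cnorm (to_C b) = `|b|.
Proof. by rewrite /= expr0n addr0 sqrtr_sqr. Qed.

Lemma cnorm0 : cnorm 0 = 0.
Proof. exact: Normc.normc0. Qed.

Lemma cnorm_sum (I : Type) (s : seq I) (P : pred I) (w : I -> R[i]) :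
  cnorm (\sum_(i <- s | P i) w i) <= \sum_(i <- s | P i) cnorm (w i).
Proof.
elim/big_rec2: _ => [|i u v _ le_uv]; first by rewrite cnorm0.
by apply: le_trans (cnormD _ _) _; rewrite lerD2l.
Qed.

Lemma Re_le_cnorm z : `|complex.Re z| <= cnorm z.
Proof.
case: z => b c; rewrite /= -sqrtr_sqr ler_sqrt ?addr_ge0 ?sqr_ge0 //.
by rewrite lerDl sqr_ge0.
Qed.

Lemma Im_le_cnorm z : `|complex.Im z| <= cnorm z.
Proof.
case: z => b c; rewrite /= -sqrtr_sqr ler_sqrt ?addr_ge0 ?sqr_ge0 //.
by rewrite lerDr sqr_ge0.
Qed.

Lemma cnorm_le_ReIm z : cnorm z <= `|complex.Re z| + `|complex.Im z|.
Proof.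
have zE : z = to_C (complex.Re z) + 'i%C * to_C (complex.Im z).
  by case: z => b c; simpc.
have cnorm_i : cnorm ('i%C : R[i]) = 1.
  by rewrite /= expr0n expr1n add0r sqrtr1.
rewrite {1}zE; apply: le_trans (cnormD _ _) _.
by rewrite Normc.normcM !cnorm_real cnorm_i mul1r.
Qed.

(** Convergence of complex sequences, stated with real-valued distances so
    that real estimates apply. *)
Definition tendsto (w : nat -> R[i]) (l : R[i]) : Prop :=
  forall e : R, 0 < e -> \forall N \near \oo, cnorm (l - w N) <= e.

Lemma tendsto_bound w l (K : R) : tendsto w l -> (forall N, cnorm (w N) <= K) ->
  cnorm l <= K.
Proof.
move=> wl le_K; apply/ler_addgt0Pr => e e_gt0.
near \oo => N; rewrite -[l](subrK (w N)) [K + e]addrC.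
apply: le_trans (cnormD _ _) _; apply: lerD; last exact: le_K.
by near: N; exact: wl.
Unshelve. all: by end_near. Qed.

Lemma tendstoD w w' l l' : tendsto w l -> tendsto w' l' ->
  tendsto (fun N => w N + w' N) (l + l').
Proof.
move=> wl wl' e e_gt0; have e2 : 0 < e / 2 by rewrite divr_gt0.
near=> N; rewrite opprD addrACA [e]splitr.
apply: le_trans (cnormD _ _) _; rewrite lerD //; near: N.
  exact: wl.
exact: wl'.
Unshelve. all: by end_near. Qed.

Lemma tendstoZ w l c : tendsto w l -> tendsto (fun N => c * w N) (c * l).
Proof.
move=> wl e e_gt0.
have c1 : 0 < cnorm c + 1 by rewrite ltr_wpDl ?cnorm_ge0.
near=> N; rewrite -mulrBr Normc.normcM.
apply: (@le_trans _ _ ((cnorm c + 1) * (e / (cnorm c + 1)))).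
  rewrite ler_pM ?cnorm_ge0 ?lerDl //.
  near: N; apply: wl; exact: divr_gt0.
by rewrite mulrCA divff ?mulr1 // gt_eqF.
Unshelve. all: by end_near. Qed.

Lemma tendstoB w w' l l' : tendsto w l -> tendsto w' l' ->
  tendsto (fun N => w N - w' N) (l - l').
Proof.
move=> wl wl'; rewrite -[- l']mulN1r.
rewrite (_ : (fun N => _) = fun N => w N + (-1) * w' N); last first.
  by apply/funext => N; rewrite mulN1r.
by apply: tendstoD => //; exact: tendstoZ.
Qed.

Lemma tendsto_shift w l : tendsto w l -> tendsto (fun N => w N.+1) l.
Proof.
move=> wl e e_gt0; have [N0 _ hN] := wl e e_gt0.
by exists N0 => // N /= leN; apply: hN => /=; exact: leqW.
Qed.

Lemma tendsto_unique w l l' : tendsto w l -> tendsto w l' -> l = l'.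
Proof.
move=> wl wl'; apply/eqP; rewrite -subr_eq0; apply/eqP/Normc.eq0_normc.
apply/eqP; rewrite eq_le cnorm_ge0 andbT.
apply: (tendsto_bound (tendstoB wl wl')) => N.
by rewrite subrr cnorm0.
Qed.

(** Completeness, obtained from that of the reals for each component. *)
Lemma tendsto_abs_summable (w : nat -> R[i]) (K : R) :
  (forall N, \sum_(j < N) cnorm (w j) <= K) ->
  exists l, tendsto (fun N => \sum_(j < N) w j) l.
Proof.
move=> le_K.
have cvg_part (g : R[i] -> R) : (forall z, `|g z| <= cnorm z) ->
    cvgn (series (g \o w)).
  move=> g_le; apply: normed_cvg; apply: nondecreasing_is_cvgn.
    apply/nondecreasing_seqP => N.
    by rewrite -subr_ge0 /= /series /= big_nat_recr //= addrAC subrr add0r.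
  exists K => _ [N _ <-]; apply: le_trans (le_K N).
  by rewrite /= /series /= big_mkord; apply: ler_sum => j _; exact: g_le.
have cR := cvg_part _ Re_le_cnorm; have cI := cvg_part _ Im_le_cnorm.
pose lR := limn (series (@complex.Re R \o w)).
pose lI := limn (series (@complex.Im R \o w)).
exists (Complex lR lI) => e e_gt0.
have e2 : 0 < e / 2 by rewrite divr_gt0.
have ReS N : complex.Re (\sum_(j < N) w j) = series (@complex.Re R \o w) N.
  by rewrite /series /= big_mkord (big_morph _ (@ReD R) (erefl : complex.Re 0 = 0)).
have ImS N : complex.Im (\sum_(j < N) w j) = series (@complex.Im R \o w) N.
  by rewrite /series /= big_mkord (big_morph _ (@ImD R) (erefl : complex.Im 0 = 0)).
near=> N; apply: le_trans (cnorm_le_ReIm _) _; rewrite [e]splitr lerD //.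
  have -> : complex.Re (Complex lR lI - \sum_(j < N) w j) =
     lR - series (@complex.Re R \o w) N.
    by rewrite -ReS; case: (\sum_(j < N) w j).
  by near: N; move/cvgrPdist_le: cR; apply.
have -> : complex.Im (Complex lR lI - \sum_(j < N) w j) =
     lI - series (@complex.Im R \o w) N.
  by rewrite -ImS; case: (\sum_(j < N) w j).
by near: N; move/cvgrPdist_le: cI; apply.
Unshelve. all: by end_near. Qed.

End ComplexSeries.

(** * Derivatives of power series *)
Section PowerSeries.
Variable R : realType.
Implicit Types (x y z h : R[i]) (a : nat -> R).

Local Notation to_C := (real_complex R).
Local Notation cnorm := (@Normc.normc R).

Definition psum a N z : R[i] := \sum_(j < N) to_C (a j) * z ^+ j.

(** The function f is the sum of the series a on the open disk of radius rho,
    and the bound on the coefficients makes it converge geometrically on any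
    smaller disk. *)
Definition power_series (rho : R) a (f : R[i] -> R[i]) : Prop :=
  [/\ 0 < rho, exists B, forall j, `|a j| * rho ^+ j <= B &
      forall z, cnorm z < rho -> tendsto (psum a ^~ z) (f z)].

Definition deriv_coef a (j : nat) : R := j.+1%:R * a j.+1.

(** Three geometric summations of the sequence (1, 0, 0, ...) give binomial
    coefficients times q^j, which dominate j^2 q^j. *)
Lemma sum_sqr_geom (q : R) : 0 < q -> q < 1 ->
  exists K, forall N, \sum_(j < N) j%:R ^+ 2 * q ^+ j <= K.
Proof.
move=> q_gt0 q_lt1; pose d0 (k : nat) : R := (k == 0)%:R.
have g1 k : geo q d0 k = q ^+ k.
  by elim: k => [|k IH]; rewrite ?geo0 // geoS IH /d0 add0r exprS.
have g2 k : geo q (geo q d0) k = k.+1%:R * q ^+ k.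
  elim: k => [|k IH]; first by rewrite !geo0 mul1r.
  by rewrite geoS IH g1 -natr1 exprS; ring.
have g3 k : 2 * geo q (geo q (geo q d0)) k = k.+1%:R * k.+2%:R * q ^+ k.
  elim: k => [|k IH]; first by rewrite !geo0 expr0 mul1r.
  rewrite geoS mulrDr (mulrCA 2 q) IH g2 -[k.+3%:R]natr1 -[k.+2%:R]natr1 -[k.+1%:R]natr1 exprS.
  ring.
have [g_ge0 g_cvg] := has_sum_iter_geo 3 q_gt0 q_lt1 (has_sum_delta R 0).
have nd : nondecreasing_seq (fun N => \sum_(0 <= k < N) iter 3 (geo q) d0 k).
  by apply/nondecreasing_seqP => N; rewrite big_nat_recr //= lerDl; exact: g_ge0.
exists (2 * (1 / (1 - q) ^+ 3)) => N.
apply: (@le_trans _ _ (2 * \sum_(0 <= k < N) iter 3 (geo q) d0 k)); last first.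
  rewrite ler_wpM2l // -(cvg_lim _ g_cvg) //; apply: nondecreasing_cvgn_le => //.
  by apply/cvg_ex; eexists; exact: g_cvg.
rewrite mulr_sumr big_mkord; apply: ler_sum => k _; rewrite g3.
rewrite ler_wpM2r ?exprn_ge0 ?(ltW q_gt0) // expr2 -!natrM ler_nat; lia.
Qed.

(** Second order Taylor estimate for monomials. *)
Lemma monomial_quadratic (s : R) z h j : 0 < s -> cnorm z <= s -> cnorm (z + h) <= s ->
  cnorm ((z + h) ^+ j - z ^+ j - h * (j%:R * z ^+ j.-1)) * s ^+ 2 <=
  cnorm h ^+ 2 * (j%:R ^+ 2 * s ^+ j).
Proof.
move=> s_gt0 le_z le_zh; have h_ge0 := cnorm_ge0 h.
elim: j => [|j IH].
  by rewrite !expr0 subrr mul0r mulr0 subr0 cnorm0 mul0r expr0n mul0r mulr0.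
have -> : (z + h) ^+ j.+1 - z ^+ j.+1 - h * (j.+1%:R * z ^+ j.+1.-1) =
   (z + h) * ((z + h) ^+ j - z ^+ j - h * (j%:R * z ^+ j.-1)) +
   h ^+ 2 * (j%:R * z ^+ j.-1).
  case: j {IH} => [|j] /=; first by rewrite !expr0 !expr1; ring.
  rewrite -[j.+2%:R]natr1 !exprS; ring.
have bound1 : cnorm (j%:R * z ^+ j.-1) * s ^+ 2 <= j%:R * s ^+ j.+1.
  rewrite Normc.normcM cnormX.
  have -> : cnorm (j%:R : R[i]) = j%:R.
    by rewrite -(rmorph_nat (real_complex R)) cnorm_real ger0_norm.
  case: j {IH} => [|j]; first by rewrite !mul0r.
  rewrite -mulrA ler_wpM2l //=.
  have -> : (s ^+ j.+2 = s ^+ j * s ^+ 2) by rewrite -exprD addn2.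
  by rewrite ler_wpM2r ?exprn_ge0 ?(ltW s_gt0) // lerXn2r ?nnegrE ?cnorm_ge0 ?(ltW s_gt0).
set E := j%:R * z ^+ j.-1 in IH bound1 *.
set D := (z + h) ^+ j - z ^+ j - h * E in IH *.
have split_norm : cnorm ((z + h) * D + h ^+ 2 * E) * s ^+ 2 <=
    cnorm (z + h) * (cnorm D * s ^+ 2) + cnorm h ^+ 2 * (cnorm E * s ^+ 2).
  rewrite [cnorm (z + h) * _]mulrA [cnorm h ^+ 2 * _]mulrA -mulrDl.
  rewrite ler_wpM2r ?exprn_ge0 ?(ltW s_gt0) //.
  by apply: le_trans (cnormD _ _) _; rewrite !Normc.normcM cnormX.
apply: le_trans split_norm _.
have le1 : cnorm (z + h) * (cnorm D * s ^+ 2)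
   <= s * (cnorm h ^+ 2 * (j%:R ^+ 2 * s ^+ j)).
  by rewrite ler_pM ?cnorm_ge0 // mulr_ge0 ?cnorm_ge0 ?exprn_ge0 ?(ltW s_gt0).
have le2 := ler_wpM2l (exprn_ge0 2 h_ge0) bound1.
apply: le_trans (lerD le1 le2) _.
have -> : s * (cnorm h ^+ 2 * (j%:R ^+ 2 * s ^+ j)) +
   cnorm h ^+ 2 * (j%:R * s ^+ j.+1) = cnorm h ^+ 2 * ((j%:R ^+ 2 + j%:R) * s ^+ j.+1).
  by rewrite [s ^+ j.+1]exprS; ring.
rewrite ler_wpM2l ?exprn_ge0 // ler_wpM2r ?exprn_ge0 ?(ltW s_gt0) //.
rewrite -!natrX -natrD ler_nat; lia.
Qed.

Lemma psum_deriv_shift a N z :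
  \sum_(j < N.+1) to_C (a j) * (j%:R * z ^+ j.-1) = psum (deriv_coef a) N z.
Proof.
rewrite big_ord_recl mul0r mulr0 add0r; apply: eq_bigr => j _ /=.
by rewrite /deriv_coef rmorphM rmorph_nat mulrA [to_C _ * _]mulrC.
Qed.

Lemma sum_abs_sqr_bound rho s a : 0 < s -> s < rho ->
  (exists B, forall j, `|a j| * rho ^+ j <= B) ->
  exists K, forall N, \sum_(j < N) `|a j| * (j%:R ^+ 2 * s ^+ j) <= K.
Proof.
move=> s_gt0 lt_s [B leB]; have rho_gt0 := lt_trans s_gt0 lt_s.
have q_gt0 : 0 < s / rho by rewrite divr_gt0.
have q_lt1 : s / rho < 1 by rewrite ltr_pdivrMr // mul1r.
have [K leK] := sum_sqr_geom q_gt0 q_lt1.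
exists (B * K) => N; have B_ge0 : 0 <= B.
  by apply: le_trans (leB 0%N); rewrite mulr_ge0 ?exprn_ge0 // ltW.
apply: le_trans (ler_wpM2l B_ge0 (leK N)); rewrite mulr_sumr; apply: ler_sum => j _.
have -> : s ^+ j = rho ^+ j * (s / rho) ^+ j.
  by rewrite -exprMn mulrCA divff ?mulr1 // gt_eqF.
have -> : `|a j| * (j%:R ^+ 2 * (rho ^+ j * (s / rho) ^+ j)) =
   (`|a j| * rho ^+ j) * (j%:R ^+ 2 * (s / rho) ^+ j) by ring.
by rewrite ler_wpM2r // mulr_ge0 ?exprn_ge0 // ltW.
Qed.

(** The second order estimates of the monomials, weighted by the coefficients,
    are summable on a slightly smaller disk; the partial sums therefore bound
    the error of the linear approximation by a multiple of |h|^2. *)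
Lemma power_series_deriv rho a f z : power_series rho a f -> cnorm z < rho ->
  exists g, tendsto (psum (deriv_coef a) ^~ z) g /\
    exists K d, [/\ 0 <= K, 0 < d & forall h, cnorm h <= d ->
      cnorm (f (z + h) - f z - h * g) <= cnorm h ^+ 2 * K].
Proof.
move=> [rho_gt0 aB f_cvg] lt_z.
pose s := (cnorm z + rho) / 2; pose d := (rho - cnorm z) / 2.
have z_ge0 := cnorm_ge0 z.
have s_gt0 : 0 < s by rewrite /s; lra.
have lt_s : s < rho by rewrite /s; lra.
have le_zs : cnorm z <= s by rewrite /s; lra.
have d_gt0 : 0 < d by rewrite /d; lra.
have [K leK] := sum_abs_sqr_bound s_gt0 lt_s aB.
have K_ge0 : 0 <= K by apply: le_trans (leK 0%N); rewrite big_ord0.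
have [g g_cvg] : exists g, tendsto (psum (deriv_coef a) ^~ z) g.
  apply: (@tendsto_abs_summable _ (fun j => to_C (deriv_coef a j) * z ^+ j) (K / s)) => N.
  rewrite ler_pdivlMr // mulr_suml.
  apply: le_trans (leK N.+1); rewrite big_ord_recl expr0n mul0r mulr0 add0r.
  apply: ler_sum => j _ /=; rewrite Normc.normcM cnormX cnorm_real /deriv_coef normrM.
  rewrite ger0_norm // [_ * `|a _|]mulrC -!mulrA ler_wpM2l //.
  rewrite /bump /= add1n ler_wpM2l // exprSr mulrA ler_wpM2r ?(ltW s_gt0) //.
  apply: (@le_trans _ _ (1 * s ^+ j)).
    by rewrite mul1r lerXn2r // nnegrE // ltW.
  by rewrite ler_wpM2r ?exprn_ge0 ?(ltW s_gt0) // ler1n.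
exists g; split=> //; exists (K / s ^+ 2), d; split=> //.
  by rewrite divr_ge0 // exprn_ge0 // ltW.
move=> h le_h.
have le_zh : cnorm (z + h) <= s.
  by apply: le_trans (cnormD _ _) _; move: le_h; rewrite /s /d; lra.
have E_cvg : tendsto (fun N => psum a N.+1 (z + h) - psum a N.+1 z -
    h * psum (deriv_coef a) N z) (f (z + h) - f z - h * g).
  apply: tendstoB; last exact: tendstoZ.
  apply: tendstoB; apply: (tendsto_shift (w := fun N => psum a N _)); apply: f_cvg => //.
  exact: le_lt_trans le_zh lt_s.
apply: (tendsto_bound E_cvg) => N.
rewrite -psum_deriv_shift /psum mulr_sumr -!sumrB.
apply: le_trans (cnorm_sum _ _ _) _.
rewrite mulrA ler_pdivlMr ?exprn_gt0 // mulr_suml.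
apply: le_trans (ler_wpM2l (exprn_ge0 2 (cnorm_ge0 h)) (leK N.+1)).
rewrite mulr_sumr; apply: ler_sum => j _.
have -> : to_C (a j) * (z + h) ^+ j - to_C (a j) * z ^+ j -
   h * (to_C (a j) * (j%:R * z ^+ j.-1)) =
   to_C (a j) * ((z + h) ^+ j - z ^+ j - h * (j%:R * z ^+ j.-1)) by ring.
rewrite Normc.normcM cnorm_real -mulrA [leRHS]mulrCA ler_wpM2l //.
exact: monomial_quadratic.
Qed.

Lemma power_series_derive1 rho a (f : R[i] -> R[i]) r : power_series rho a f ->
  0 < r -> r < rho ->
  power_series r (deriv_coef a) (derive1 (f : R[i] -> R[i]^o)).
Proof.
move=> fa r_gt0 lt_r; have [rho_gt0 aB _] := fa; split=> //.
  have [K leK] := sum_abs_sqr_bound r_gt0 lt_r aB.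
  exists (K / r) => j; rewrite ler_pdivlMr //; apply: le_trans (leK j.+2).
  rewrite big_ord_recr /= ler_wpDl //.
    by apply: sumr_ge0 => i _; rewrite !mulr_ge0 ?exprn_ge0 // ltW.
  rewrite /deriv_coef normrM ger0_norm // [_ * `|a _|]mulrC -!mulrA ler_wpM2l //.
  by rewrite -exprSr ler_wpM2l // ler_peMl ?exprn_ge0 ?(ltW r_gt0) // ler1n.
move=> z lt_z; have [g [g_cvg [K [d [K_ge0 d_gt0 leK]]]]] :=
  power_series_deriv fa (lt_trans lt_z lt_r).
suff -> : derive1 (f : R[i] -> R[i]^o) z = g by [].
apply: cvg_lim => //; apply/cvgrPdist_le => e e_gt0.
pose e' := complex.Re e.
have eE : e = to_C e' by rewrite /e' RRe_real ?gtr0_real.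
have e'_gt0 : 0 < e' by rewrite -ltcR -eE.
have K1_gt0 : 0 < K + 1 by rewrite ltr_wpDl.
pose m := Num.min d (e' / (K + 1)).
have m_gt0 : 0 < m by rewrite lt_min d_gt0 divr_gt0.
near=> h; have h_neq0 : h != 0 by near: h; exact: nbhs_dnbhs_neq.
have le_h : cnorm h <= m.
  rewrite -lecR -[X in X <= _]norm_cnorm; near: h.
  by apply: (@dnbhs0_le _ (R[i]^o)); rewrite ltcR.
have h_gt0 : 0 < cnorm h.
  rewrite lt_neqAle cnorm_ge0 andbT eq_sym; apply: contra h_neq0.
  by move=> /eqP/Normc.eq0_normc ->.
rewrite norm_cnorm eE lecR.
have -> : g - h^-1 *: (f (h + z) - f z : R[i]^o) =
    - (h^-1 * (f (z + h) - f z - h * g)).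
  by rewrite [h + z]addrC -[_ *: _]/(_ * _) -{1}[g](mulKf h_neq0); ring.
rewrite cnormN Normc.normcM Normc.normcV -ler_pdivlMl ?invr_gt0 // invrK.
apply: le_trans (leK _ _) _; first by apply: le_trans le_h _; rewrite ge_min lexx.
rewrite expr2 -mulrA ler_wpM2l ?(ltW h_gt0) //.
apply: (@le_trans _ _ (e' / (K + 1) * (K + 1))).
  apply: ler_pM; [exact: ltW | by [] | | by rewrite lerDl].
  by apply: le_trans le_h _; rewrite ge_min lexx orbT.
by rewrite divfK ?gt_eqF.
Unshelve. all: by end_near. Qed.

(** Each differentiation halves the disk, which stays a neighbourhood of 0. *)
Lemma power_series_derive1n k rho a (f : R[i] -> R[i]) : power_series rho a f ->
  derive1n k (f : R[i] -> R[i]^o) 0 = to_C (k`!%:R * a k).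
Proof.
elim: k rho a f => [|k IH] rho a f fa.
  have [rho_gt0 _ f_cvg] := fa; rewrite derive1n0 mul1r.
  apply: tendsto_unique (tendsto_shift (f_cvg 0 _)) _; first by rewrite cnorm0.
  move=> e e_gt0; apply: nearW => N; rewrite /psum big_ord_recl expr0 mulr1 big1 => [|j _].
    by rewrite addr0 subrr cnorm0 ltW.
  by rewrite expr0n mulr0.
have r_gt0 : 0 < rho / 2 by case: fa => ? _ _; rewrite divr_gt0.
have lt_r : rho / 2 < rho by lra.
transitivity (derive1n k (derive1 (f : R[i] -> R[i]^o)) 0).
  by rewrite /derive1n iterSr.
rewrite (IH _ _ _ (power_series_derive1 fa r_gt0 lt_r)) /deriv_coef; congr to_C.
by rewrite factS natrM; ring.
Qed.

End PowerSeries.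

(** * Finite products of homographies *)

Section RationalProducts.
Variables (R : realType) (p : R).
Hypotheses (p_gt0 : 0 < p) (p_lt1 : p < 1).
Implicit Types (s : seq (R * R)) (x : R * R) (t : nat -> R) (z : R[i]).

Local Notation to_C := (real_complex R).
Local Notation cnorm := (@Normc.normc R).

(** The factor (1 - x (z - 1)) / (1 - y (z - 1)) is (u - v z) / (1 - a z) for
    these u, v and a. *)
Definition hom_u x : R := (1 + x.1) / (1 + x.2).
Definition hom_v x : R := x.1 / (1 + x.2).
Definition hom_a x : R := x.2 / (1 + x.2).

Definition hom_coef x : nat -> R := homography_coef (hom_u x) (hom_v x) (hom_a x).

Definition rat_coef s : nat -> R :=
  foldr (fun x t => series_mul (hom_coef x) t) (fun k => (k == 0)%:R) s.

Definition rat_coord n s : partition_le n -> R :=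
  foldr (fun x c => pieri_step p (hom_u x) (hom_v x) (hom_a x) c)
    (fun l => (psize l == 0)%:R) s.

Lemma rat_expands n s : expands p (@rat_coord n s) (series_det (rat_coef s)).
Proof. by elim: s => [|x s IH] /=; [exact: expands_one | exact: expands_pieri]. Qed.

Section Factor.
Variable x : R * R.
Hypothesis adm : admissible p x.

Lemma hom_den_gt0 : 0 < 1 + x.2.
Proof. by case: adm => _ _ y_ge0 _; rewrite ltr_pwDl. Qed.

Lemma hom_a_ge0 : 0 <= hom_a x.
Proof. by case: adm => _ _ y_ge0 _; rewrite divr_ge0 // ltW // hom_den_gt0. Qed.

Lemma hom_a_lt1 : 0 < 1 - hom_a x.
Proof.
have d_gt0 := hom_den_gt0; suff -> : 1 - hom_a x = (1 + x.2)^-1 by rewrite invr_gt0.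
by rewrite /hom_a; field; rewrite gt_eqF.
Qed.

Lemma hom_u_ge0 : 0 <= hom_u x.
Proof.
by case: adm => x_ge _ _ _; rewrite divr_ge0 ?(ltW hom_den_gt0) //; lra.
Qed.

Lemma hom_sum : hom_u x - hom_v x = 1 - hom_a x.
Proof.
have d_gt0 := hom_den_gt0.
by rewrite /hom_u /hom_v /hom_a; field; rewrite gt_eqF.
Qed.

Lemma hom_uav_ge0 : 0 <= hom_u x * hom_a x - hom_v x.
Proof.
have d_gt0 := hom_den_gt0; case: adm => _ _ _ le_xy.
have -> : hom_u x * hom_a x - hom_v x = (x.2 - x.1) / (1 + x.2) ^+ 2.
  by rewrite /hom_u /hom_v /hom_a; field; rewrite gt_eqF.
by rewrite divr_ge0 ?exprn_ge0 ?subr_ge0 // ltW.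
Qed.

Lemma hom_upv_ge0 : 0 <= hom_u x * p - hom_v x.
Proof.
have d_gt0 := hom_den_gt0; case: adm => _ le_x _ _.
have -> : hom_u x * p - hom_v x = (p - x.1 * (1 - p)) / (1 + x.2).
  by rewrite /hom_u /hom_v; field; rewrite gt_eqF.
rewrite divr_ge0 ?(ltW d_gt0) // subr_ge0 -ler_pdivlMr // subr_gt0 //.
Qed.

Lemma hom_coef_ge0 k : 0 <= hom_coef x k.
Proof.
case: k => [|k]; first exact: hom_u_ge0.
by rewrite mulr_ge0 ?hom_uav_ge0 // exprn_ge0 // hom_a_ge0.
Qed.

(** The value at z = 1 of the homography is 1. *)
Lemma hom_coef_sum_le1 N : \sum_(k < N) hom_coef x k <= 1.
Proof.
case: N => [|N]; first by rewrite big_ord0.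
rewrite big_ord_recl /= -mulr_sumr -(ler_pM2l hom_a_lt1) mulr1 -hom_sum.
have geom : (1 - hom_a x) * \sum_(k < N) hom_a x ^+ k = 1 - hom_a x ^+ N.
  elim: N => [|N IH]; first by rewrite big_ord0 mulr0 expr0 subrr.
  by rewrite big_ord_recr mulrDr IH exprS; ring.
rewrite [leLHS](_ : _ = (1 - hom_a x) * hom_u x + (hom_u x * hom_a x - hom_v x) *
   ((1 - hom_a x) * \sum_(k < N) hom_a x ^+ k)); last by rewrite hom_sum; ring.
rewrite geom mulrBr mulr1; have := mulr_ge0 hom_uav_ge0 (exprn_ge0 N hom_a_ge0).
set S := _ * _ ^+ N; set w := hom_a x; lra.
Qed.

Lemma pieri_weight_ge0 mu j m :
  0 <= pieri_weight p (hom_u x) (hom_v x) (hom_a x) mu j m.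
Proof.
rewrite /pieri_weight; case: ifP => // _; case: ifP => _; first exact: hom_coef_ge0.
by rewrite !mulr_ge0 ?hom_upv_ge0 ?exprn_ge0 ?hom_a_ge0 // ltW.
Qed.

End Factor.

Lemma series_mul_ge0 (f t : nat -> R) k :
  (forall k, 0 <= f k) -> (forall k, 0 <= t k) -> 0 <= series_mul f t k.
Proof. by move=> f_ge0 t_ge0; apply: sumr_ge0 => i _; exact: mulr_ge0. Qed.

Lemma series_mul_sum (f t : nat -> R) N :
  \sum_(k < N) series_mul f t k = \sum_(i < N) f i * \sum_(m < N - i) t m.
Proof.
elim: N => [|N IH]; first by rewrite !big_ord0.
rewrite big_ord_recr IH /series_mul /= [RHS]big_ord_recr /=.
rewrite [X in _ + X]big_ord_recr /= addrA -big_split /=; congr (_ + _).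
  apply: eq_bigr => i _; rewrite -mulrDr subSn; last exact: ltnW.
  by rewrite big_ord_recr.
by rewrite subnn subSnn big_ord1.
Qed.

Lemma rat_coef_ge0 s k : (forall x, x \in s -> admissible p x) -> 0 <= rat_coef s k.
Proof.
elim: s k => [|x s IH] k adm /=; first exact: ler0n.
apply: series_mul_ge0 => j; first by apply/hom_coef_ge0/adm; rewrite mem_head.
by apply: IH => y ys; apply: adm; rewrite inE ys orbT.
Qed.

Lemma rat_coef_sum_le1 s N : (forall x, x \in s -> admissible p x) ->
  \sum_(k < N) rat_coef s k <= 1.
Proof.
elim: s N => [|x s IH] N adm /=.
  case: N => [|N]; first by rewrite big_ord0.
  by rewrite big_ord_recl big1 ?addr0.
have adm_x : admissible p x by apply: adm; rewrite mem_head.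
have adm_s y : y \in s -> admissible p y.
  by move=> ys; apply: adm; rewrite inE ys orbT.
rewrite series_mul_sum; apply: le_trans (hom_coef_sum_le1 adm_x N).
apply: ler_sum => i _; rewrite -[leRHS]mulr1 ler_wpM2l ?hom_coef_ge0 //.
exact: IH.
Qed.

Lemma rat_coord_ge0 n s (l : partition_le n) :
  (forall x, x \in s -> admissible p x) -> 0 <= rat_coord s l.
Proof.
elim: s l => [|x s IH] l adm /=; first exact: ler0n.
apply: sumr_ge0 => mu _; apply: mulr_ge0.
  by apply: IH => y ys; apply: adm; rewrite inE ys orbT.
apply: prodr_ge0 => j _; apply: pieri_weight_ge0; apply: adm.
exact: mem_head.
Qed.

Lemma rat_coef_le1 s k : (forall x, x \in s -> admissible p x) -> rat_coef s k <= 1.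
Proof.
move=> adm; apply: le_trans (rat_coef_sum_le1 k.+1 adm).
rewrite big_ord_recr lerDr; apply: sumr_ge0 => i _; exact: rat_coef_ge0.
Qed.

Lemma homography_mul_rec (u v a : R) t k :
  series_mul (homography_coef u v a) t k.+1 =
  u * t k.+1 + (a * series_mul (homography_coef u v a) t k - v * t k).
Proof.
rewrite /series_mul big_ord_recl /= subn0; congr (_ + _).
rewrite big_ord_recl [in RHS]big_ord_recl /= !subn0 subSS subn0 expr0 mulr1.
rewrite mulrDr mulr_sumr mulrBl -addrA -addrA; congr (_ + _).
  by rewrite mulrCA mulrA.
rewrite [RHS]addrC; congr (_ + _); apply: eq_bigr => i _ /=.
by rewrite /bump /= !add1n subSS exprS; ring.
Qed.

Lemma psumS t N z : psum t N.+1 z = psum t N z + to_C (t N) * z ^+ N.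
Proof. by rewrite /psum big_ord_recr. Qed.

(** A finite form of (1 - a z) g = (u - v z) f. *)
Lemma psum_homography (u v a : R) t N z :
  let b := if N is N'.+1
           then a * series_mul (homography_coef u v a) t N' - v * t N' else 0 in
  (1 - to_C a * z) * psum (series_mul (homography_coef u v a) t) N z =
  (to_C u - to_C v * z) * psum t N z - to_C b * z ^+ N.
Proof.
elim: N => [|N IH] /=; first by rewrite /psum !big_ord0 rmorph0 !mulr0 mul0r subr0.
rewrite !psumS !mulrDr IH rmorphB !rmorphM /= exprS.
set b := if N is _.+1 then _ else _.
have -> : series_mul (homography_coef u v a) t N = u * t N + b.
  rewrite /b; case: N {IH b} => [|N]; last exact: homography_mul_rec.
  by rewrite /series_mul big_ord1 addr0.
by rewrite rmorphD rmorphM /=; ring.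
Qed.

Lemma hom_factorE x z : admissible p x ->
  (1 - to_C x.1 * (z - 1)) / (1 - to_C x.2 * (z - 1)) =
  (to_C (hom_u x) - to_C (hom_v x) * z) / (1 - to_C (hom_a x) * z).
Proof.
move=> adm; have d_gt0 := hom_den_gt0 adm.
have dC : to_C (1 + x.2) != 0 by rewrite fmorph_eq0 gt_eqF.
have uE : to_C (1 + x.2) * to_C (hom_u x) = 1 + to_C x.1.
  by rewrite -rmorphM /hom_u mulrCA divff ?gt_eqF // mulr1 rmorphD rmorph1.
have vE : to_C (1 + x.2) * to_C (hom_v x) = to_C x.1.
  by rewrite -rmorphM /hom_v mulrCA divff ?gt_eqF // mulr1.
have aE : to_C (1 + x.2) * to_C (hom_a x) = to_C x.2.
  by rewrite -rmorphM /hom_a mulrCA divff ?gt_eqF // mulr1.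
rewrite -[RHS]mul1r -[X in _ = X * _](divff dC) mulrACA -invfM; congr (_ / _).
  by rewrite [RHS]mulrBr uE mulrA vE; ring.
by rewrite [RHS]mulrBr mulr1 mulrA aE rmorphD rmorph1; ring.
Qed.

Lemma cnorm_hom_den x z : admissible p x -> cnorm z <= 1 ->
  1 - hom_a x <= cnorm (1 - to_C (hom_a x) * z).
Proof.
move=> adm le_z; have a_ge0 := hom_a_ge0 adm.
have : cnorm 1 <= cnorm (1 - to_C (hom_a x) * z) + cnorm (to_C (hom_a x) * z).
  by rewrite -{1}[1](subrK (to_C (hom_a x) * z)) cnormD.
rewrite Normc.normc1 Normc.normcM cnorm_real ger0_norm // lerBlDr => /le_trans.
by apply; rewrite lerD2l -[leRHS]mulr1 ler_wpM2l.
Qed.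

(** The remainder after N terms is divided by 1 - a z, bounded away from 0,
    and multiplied by u - v z at each factor, up to a multiple of z^N. *)
Lemma rat_prod_psum s z : (forall x, x \in s -> admissible p x) -> cnorm z <= 1 ->
  exists K, forall N, cnorm (rat_prod s z - psum (rat_coef s) N z) <= K * cnorm z ^+ N.
Proof.
move=> adm le_z; have z_ge0 := cnorm_ge0 z.
elim: s adm => [|x s IH] adm.
  exists 1 => -[|N]; rewrite /rat_prod big_nil /psum.
    by rewrite big_ord0 subr0 Normc.normc1 expr0 mulr1.
  rewrite big_ord_recl expr0 mulr1 big1 => [|j _]; last by rewrite mul0r.
  by rewrite addr0 subrr cnorm0 mul1r exprn_ge0.
have adm_x : admissible p x by apply: adm; rewrite mem_head.
have adm_s y : y \in s -> admissible p y.
  by move=> ys; apply: adm; rewrite inE ys orbT.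
have [K leK] := IH adm_s.
set u := hom_u x; set v := hom_v x; set a := hom_a x.
have a1_gt0 : 0 < 1 - a := hom_a_lt1 adm_x; have a_ge0 : 0 <= a := hom_a_ge0 adm_x.
have den_ge : 1 - a <= cnorm (1 - to_C a * z) := cnorm_hom_den adm_x le_z.
have den_gt0 : 0 < cnorm (1 - to_C a * z) by exact: lt_le_trans a1_gt0 den_ge.
have den_neq0 : 1 - to_C a * z != 0.
  by apply: contraTneq den_gt0 => ->; rewrite cnorm0 ltxx.
exists (((`|u| + `|v|) * K + (a + `|v|)) / (1 - a)) => N.
have -> : rat_prod (x :: s) z = (to_C u - to_C v * z) / (1 - to_C a * z) * rat_prod s z.
  by rewrite /rat_prod big_cons -hom_factorE.
rewrite [leRHS]mulrAC ler_pdivlMr //.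
pose b := if N is N'.+1 then a * rat_coef (x :: s) N' - v * rat_coef s N' else 0.
have b_le : `|b| <= a + `|v|.
  rewrite /b; case: (N) => [|N']; first by rewrite normr0 addr_ge0.
  apply: le_trans (ler_normB _ _) _; rewrite (normrM a) (normrM v) lerD //.
    rewrite (ger0_norm a_ge0) -[leRHS]mulr1 ler_wpM2l // ger0_norm ?rat_coef_le1 //.
    exact: rat_coef_ge0.
  by rewrite -[leRHS]mulr1 ler_wpM2l // ger0_norm ?rat_coef_le1 ?rat_coef_ge0.
have key : (1 - to_C a * z) *
    ((to_C u - to_C v * z) / (1 - to_C a * z) * rat_prod s z - psum (rat_coef (x :: s)) N z)
  = (to_C u - to_C v * z) * (rat_prod s z - psum (rat_coef s) N z) + to_C b * z ^+ N.
  rewrite mulrBr psum_homography -/b mulrA (mulrC (1 - _)) divfK //; ring.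
apply: (@le_trans _ _ (cnorm (1 - to_C a * z) * cnorm ((to_C u - to_C v * z) /
    (1 - to_C a * z) * rat_prod s z - psum (rat_coef (x :: s)) N z))).
  by rewrite mulrC ler_wpM2r ?cnorm_ge0.
rewrite -Normc.normcM key; apply: le_trans (cnormD _ _) _.
rewrite !Normc.normcM cnormX cnorm_real.
rewrite mulrDl lerD //; last by rewrite ler_wpM2r ?exprn_ge0.
rewrite -mulrA ler_pM ?cnorm_ge0 //.
apply: le_trans (cnormD _ _) _; rewrite cnormN Normc.normcM !cnorm_real lerD2l.
by rewrite -[leRHS]mulr1 ler_wpM2l.
Qed.

End RationalProducts.

(** * Uniform limits *)

Section Limits.
Variable R : realType.
Implicit Types (t : nat -> R) (z : R[i]).

Local Notation to_C := (real_complex R).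
Local Notation cnorm := (@Normc.normc R).

Lemma tendsto_shiftn (w : nat -> R[i]) l m :
  tendsto w l -> tendsto (fun N => w (N + m)%N) l.
Proof.
move=> wl e e_gt0; have [N0 _ hN] := wl e e_gt0.
by exists N0 => // N /= leN; apply: hN => /=; exact: leq_trans leN (leq_addr _ _).
Qed.

Lemma tendsto_cst (l : R[i]) : tendsto (fun=> l) l.
Proof. by move=> e e_gt0; apply: nearW => N; rewrite subrr cnorm0 ltW. Qed.

Lemma tendsto_real (u : nat -> R) (l : R) :
  u @ \oo --> l -> tendsto (fun k => to_C (u k)) (to_C l).
Proof.
move=> /cvgrPdist_le ul e e_gt0; apply: filterS (ul e e_gt0) => k.
by rewrite -rmorphB cnorm_real.
Qed.

Lemma tendsto_psum (t : nat -> nat -> R) (L : nat -> R) N z :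
  (forall j, (j < N)%N -> t ^~ j @ \oo --> L j) ->
  tendsto (fun k => psum (t k) N z) (psum L N z).
Proof.
elim: N => [|N IH] tL.
  rewrite /psum big_ord0 (_ : (fun k => _) = fun=> 0); first exact: tendsto_cst.
  by apply/funext => k; rewrite big_ord0.
rewrite psumS (_ : (fun k => _) = fun k => psum (t k) N z + z ^+ N * to_C (t k N)).
  rewrite [_ * z ^+ N]mulrC; apply: tendstoD.
    by apply: IH => j ltj; apply: tL; exact: ltnW.
  by apply/tendstoZ/tendsto_real/tL.
by apply/funext => k; rewrite psumS [_ * z ^+ N]mulrC.
Qed.

Lemma tendsto_geometric (w : nat -> R[i]) l (K r : R) : 0 <= r -> r < 1 ->
  (forall N, cnorm (l - w N) <= K * r ^+ N) -> tendsto w l.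
Proof.
move=> r_ge0 r_lt1 le_w e e_gt0.
have /cvgrPdist_le/(_ e e_gt0) : (fun N => K * r ^+ N) @ \oo --> (0 : R).
  rewrite -[X in _ --> X](mulr0 K); apply: cvgM; first exact: cvg_cst.
  by apply: cvg_expr; rewrite ger0_norm.
apply: filterS => N; rewrite sub0r normrN => h.
exact: le_trans (le_w N) (le_trans (ler_norm _) h).
Qed.

Lemma psum_bound t N z : (forall k, 0 <= t k) -> cnorm z <= 1 ->
  cnorm (psum t N z) <= \sum_(k < N) t k.
Proof.
move=> t_ge0 le_z; apply: le_trans (cnorm_sum _ _ _) _; apply: ler_sum => k _.
rewrite Normc.normcM cnorm_real ger0_norm // cnormX -[leRHS]mulr1 ler_wpM2l //.
by rewrite exprn_ile1 ?cnorm_ge0.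
Qed.

Lemma psum_shift t N M z :
  psum t (M + N) z - psum t N z = z ^+ N * psum (fun k => t (N + k)%N) M z.
Proof.
elim: M => [|M IH]; first by rewrite subrr /psum big_ord0 mulr0.
rewrite addSn !psumS addrAC IH mulrDr; congr (_ + _).
by rewrite addnC exprD; ring.
Qed.

(** The terms after the N-th have absolute value at most |z|^N times their
    coefficients. *)
Lemma psum_tail t l N z : (forall k, 0 <= t k) ->
  (forall N, \sum_(k < N) t k <= 1) -> cnorm z <= 1 -> tendsto (psum t ^~ z) l ->
  cnorm (l - psum t N z) <= cnorm z ^+ N.
Proof.
move=> t_ge0 t_sum le_z l_lim.
apply: (tendsto_bound (w := fun M => psum t (M + N) z - psum t N z)).
  exact: tendstoB (tendsto_shiftn N l_lim) (tendsto_cst _).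
move=> M; rewrite psum_shift Normc.normcM cnormX -[leRHS]mulr1.
rewrite ler_wpM2l ?exprn_ge0 ?cnorm_ge0 //.
apply: le_trans (psum_bound _ _ _) _ => //.
apply: le_trans (t_sum (N + M)%N); rewrite big_split_ord /= lerDr.
by apply: sumr_ge0 => i _; exact: t_ge0.
Qed.

Lemma cvg_finsum (I : Type) (s : seq I) (P : pred I) (u : I -> nat -> R) (l : I -> R) :
  (forall i, u i @ \oo --> l i) ->
  (fun k => \sum_(i <- s | P i) u i k) @ \oo --> \sum_(i <- s | P i) l i.
Proof.
move=> ul; elim: s => [|i s IH].
  by rewrite big_nil; under eq_fun do rewrite big_nil; exact: cvg_cst.
rewrite big_cons; under eq_fun do rewrite big_cons.
by case: ifP => // _; apply: cvgD.
Qed.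

Lemma cvg_finprod (I : Type) (s : seq I) (u : I -> nat -> R) (l : I -> R) :
  (forall i, u i @ \oo --> l i) ->
  (fun k => \prod_(i <- s) u i k) @ \oo --> \prod_(i <- s) l i.
Proof.
move=> ul; elim: s => [|i s IH].
  by rewrite big_nil; under eq_fun do rewrite big_nil; exact: cvg_cst.
by rewrite big_cons; under eq_fun do rewrite big_cons; apply: cvgM.
Qed.

Lemma cvg_series_det (t : nat -> nat -> R) (L : nat -> R) n (e : 'I_n -> nat) :
  (forall j, t ^~ j @ \oo --> L j) ->
  (fun k => series_det (t k) e) @ \oo --> series_det L e.
Proof.
move=> tL; rewrite /series_det /determinant; apply: cvg_finsum => s.
apply: cvgM; first exact: cvg_cst.
rewrite (_ : (fun k => _) = fun k => \prod_(i < n)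
    (if (n.-1 - s i <= e i)%N then t k (e i - (n.-1 - s i))%N else 0)); last first.
  by apply/funext => k; apply: eq_bigr => i _; rewrite mxE.
under [X in _ --> X]eq_bigr do rewrite mxE.
by apply: cvg_finprod => i; case: ifP => _; [exact: tL | exact: cvg_cst].
Qed.

(** The coordinates depend continuously on the coefficients of the series. *)
Lemma expands_limit (p : R) n (c : nat -> partition_le n -> R)
    (t : nat -> nat -> R) (L : nat -> R) :
  (forall k, expands p (c k) (series_det (t k))) ->
  (forall j, t ^~ j @ \oo --> L j) ->
  exists c', (forall l, c ^~ l @ \oo --> c' l) /\ expands p c' (series_det L).
Proof.
move=> Ec tL.
have c_cvg l : cvgn (c ^~ l).
  have [m] := ubnP (psize l); elim: m l => // m IH l; rewrite ltnS => le_m.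
  rewrite (_ : c ^~ l = fun k => series_det (t k) (stair l) -
    \sum_(l' <- partitions_below n (psize l + n) | (psize l' < psize l)%N)
       c k l' * alternant p (part l') (stair l)); last first.
    by apply/funext => k; rewrite {1}(expands_rec l (Ec k)).
  apply: is_cvgB; first by apply/cvg_ex; eexists; exact: cvg_series_det.
  pose c1 l' := limn (c ^~ l').
  apply/cvg_ex; exists (\sum_(l' <- partitions_below n (psize l + n))
     if (psize l' < psize l)%N then c1 l' * alternant p (part l') (stair l) else 0).
  under eq_fun do rewrite big_mkcond.
  apply: cvg_finsum => l'; case: ifP => lt_l; last exact: cvg_cst.
  apply: cvgM; last exact: cvg_cst.
  by apply: IH; exact: leq_trans lt_l le_m.
exists (fun l => limn (c ^~ l)); split=> // M e lt_e.
apply: (@cvg_unique _ _ ((fun k => series_det (t k) e) @ \oo)) => //.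
  rewrite (_ : (fun k => _) = fun k => \sum_(l <- partitions_below n M)
     c k l * alternant p (part l) e).
    by apply: cvg_finsum => l; apply: cvgM => //; exact: cvg_cst.
  by apply/funext => k; rewrite Ec.
exact: cvg_series_det.
Qed.

End Limits.

Section UniformLimit.
Variables (R : realType) (p : R).
Hypotheses (p_gt0 : 0 < p) (p_lt1 : p < 1).

Local Notation to_C := (real_complex R).
Local Notation cnorm := (@Normc.normc R).

Lemma uniform_cnorm (f : nat -> R[i] -> R[i]) (Phi : R[i] -> R[i]) :
  {uniform @unit_cdisk R, (f : nat -> R[i] -> R[i]^o) @ \oo --> (Phi : R[i] -> R[i]^o)} ->
  forall e : R, 0 < e ->
  \forall k \near \oo, forall z, cnorm z <= 1 -> cnorm (Phi z - f k z) <= e.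
Proof.
move=> f_cvg e e_gt0.
have eC_gt0 : 0 < to_C e by rewrite ltcR.
pose P : set {uniform` @unit_cdisk R -> R[i]^o} :=
  [set h | forall z, unit_cdisk z -> `|(Phi z : R[i]^o) - h z| < to_C e].
have nP : nbhs (Phi : {uniform` @unit_cdisk R -> R[i]^o}) P.
  apply/uniform_nbhs; exists [set xy | ball xy.1 (to_C e) xy.2]; split.
    exact: (entourage_ball (R[i]^o) (PosNum eC_gt0)).
  move=> h hball z Dz; have := hball z Dz.
  by rewrite /= -ball_normE.
have nearP : \forall k \near \oo, P (f k) := f_cvg _ nP.
apply: filterS nearP => k Pk z le_z.
have Dz : unit_cdisk z by rewrite /unit_cdisk /= norm_cnorm lecR.
by have := Pk z Dz; rewrite norm_cnorm ltcR => /ltW.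
Qed.

(** Each factor is at least (1 - d) / (1 + y d) at 1 - d, because x >= -1, and
    y >= 0 makes this at least 1 - (1 + y) d. *)
Lemma rat_prod_near1 s : (forall x, x \in s -> admissible p x) ->
  exists2 C, 0 <= C & forall d, 0 <= d -> d <= 1 ->
    1 - C * d <= cnorm (rat_prod s (to_C (1 - d))).
Proof.
elim: s => [|x s IH] adm.
  by exists 0 => // d _ _; rewrite /rat_prod big_nil Normc.normc1 mul0r subr0.
have [x_ge _ y_ge0 _] : admissible p x by apply: adm; rewrite mem_head.
have [y ys|C C_ge0 leC] := IH; first by apply: adm; rewrite inE ys orbT.
exists (1 + x.2 + C) => [|d d_ge0 d_le1]; first by rewrite addr_ge0 ?addr_ge0.
rewrite /rat_prod big_cons Normc.normcM -/(rat_prod s _).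
have den_gt0 : 0 < 1 + x.2 * d by rewrite ltr_pwDl // mulr_ge0.
have -> : (1 - to_C x.1 * (to_C (1 - d) - 1)) / (1 - to_C x.2 * (to_C (1 - d) - 1)) =
    to_C ((1 + x.1 * d) / (1 + x.2 * d)).
  rewrite fmorph_div; congr (_ / _); rewrite -(rmorph1 (real_complex R)).
    by rewrite -!(rmorphB, rmorphM); congr to_C; ring.
  by rewrite -!(rmorphB, rmorphM); congr to_C; ring.
rewrite cnorm_real; set A := `|_|; set B := cnorm _.
have B_ge : 1 - C * d <= B by exact: leC.
have B_ge0 : 0 <= B by exact: cnorm_ge0.
have A_ge0 : 0 <= A by exact: normr_ge0.
have A_ge : 1 - (1 + x.2) * d <= A.
  apply: le_trans (ler_norm _); rewrite ler_pdivlMr //.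
  have : - d <= x.1 * d by rewrite -mulN1r ler_wpM2r.
  have : 0 <= x.2 * d * d by rewrite !mulr_ge0.
  have : 0 <= x.2 * d * (x.2 * d) by rewrite !mulr_ge0.
  by lra.
have [neg|pos1] := leP (1 - (1 + x.2) * d) 0.
  apply: le_trans (mulr_ge0 A_ge0 B_ge0); rewrite mulrDl.
  by have := mulr_ge0 C_ge0 d_ge0; lra.
have [neg|pos2] := leP (1 - C * d) 0.
  apply: le_trans (mulr_ge0 A_ge0 B_ge0); rewrite mulrDl.
  by have := mulr_ge0 (addr_ge0 ler01 y_ge0) d_ge0; lra.
apply: le_trans (ler_pM (ltW pos1) (ltW pos2) A_ge B_ge).
have := mulr_ge0 (mulr_ge0 (addr_ge0 ler01 y_ge0) d_ge0) (mulr_ge0 C_ge0 d_ge0).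
by lra.
Qed.

Variables (Phi : R[i] -> R[i]) (s : nat -> seq (R * R)).
Hypothesis adm : forall k q, q \in s k -> admissible p q.
Hypothesis unif : forall e : R, 0 < e ->
  \forall k \near \oo, forall z, cnorm z <= 1 -> cnorm (Phi z - rat_prod (s k) z) <= e.

Let t k := rat_coef (s k).

Let t_ge0 k j : 0 <= t k j.
Proof. by apply: rat_coef_ge0 => x; exact: adm. Qed.

Let t_sum k N : \sum_(j < N) t k j <= 1.
Proof. by apply: rat_coef_sum_le1 => x; exact: adm. Qed.

Let f_lim z : cnorm z <= 1 -> tendsto (fun k => rat_prod (s k) z) (Phi z).
Proof. by move=> le_z e /unif; apply: filterS => k; apply. Qed.

Let f_psum k z : cnorm z < 1 -> tendsto (psum (t k) ^~ z) (rat_prod (s k) z).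
Proof.
move=> lt_z; have [K leK] := rat_prod_psum (@adm k) (ltW lt_z).
exact: tendsto_geometric (cnorm_ge0 z) lt_z leK.
Qed.

(** The coefficient of order j of a series is, up to an error of order r, its
    value at r minus the lower terms, divided by r^j. *)
Let t_cvg j : cvgn (t ^~ j).
Proof.
elim/ltn_ind: j => j IHj; pose L (i : nat) : R := limn (t ^~ i).
apply/cauchy_cvgP/cauchy_exP => e e_gt0.
pose r := Num.min (1 / 2) (e / 4).
have r_gt0 : 0 < r by rewrite lt_min !divr_gt0.
have r_lt1 : r < 1 by rewrite gt_min; apply/orP; left; lra.
have r_le : r <= e / 4 by rewrite ge_min lexx orbT.
pose z := to_C r.
have z_norm : cnorm z = r by rewrite cnorm_real gtr0_norm.
have ReBr (w : R[i]) (b : R) : complex.Re (w - to_C b) = complex.Re w - b.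
  by case: w.
pose A := Phi z - psum L j z.
have A_lim : tendsto (fun k => rat_prod (s k) z - psum (t k) j z) A.
  apply: tendstoB; first by apply: f_lim; rewrite z_norm ltW.
  by apply: tendsto_psum => i lti; exact: IHj.
exists (complex.Re A / r ^+ j).
have rj_gt0 : 0 < r ^+ j.+1 by rewrite exprn_gt0.
have rj0_gt0 : 0 < r ^+ j by rewrite exprn_gt0.
change (\forall k \near \oo, ball (complex.Re A / r ^+ j) e (t k j)).
near=> k; rewrite -ball_normE /=.
have h1 : cnorm (A - (rat_prod (s k) z - psum (t k) j z)) <= r ^+ j.+1.
  by near: k; exact: A_lim.
have h2 : cnorm (rat_prod (s k) z - psum (t k) j.+1 z) <= r ^+ j.+1.
  rewrite -z_norm; apply: psum_tail => //; first by rewrite z_norm ltW.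
  by apply: f_psum; rewrite z_norm.
have h3 : cnorm (A - to_C (t k j * r ^+ j)) <= 2 * r ^+ j.+1.
  have -> : A - to_C (t k j * r ^+ j) = (A - (rat_prod (s k) z - psum (t k) j z)) +
      (rat_prod (s k) z - psum (t k) j.+1 z).
    by rewrite psumS rmorphM rmorphXn /z; ring.
  by apply: le_trans (cnormD _ _) _; rewrite mulr_natl mulr2n lerD.
have h4 : `|complex.Re A - t k j * r ^+ j| <= 2 * r ^+ j.+1.
  apply: le_trans h3; apply: le_trans (Re_le_cnorm _).
  by rewrite ReBr.
have -> : complex.Re A / r ^+ j - t k j = (complex.Re A - t k j * r ^+ j) / r ^+ j.
  by rewrite mulrBl mulfK // gt_eqF.
rewrite normrM normfV (gtr0_norm rj0_gt0) ltr_pdivrMr //.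
apply: le_lt_trans h4 _; rewrite exprS mulrA ltr_pM2r //; lra.
Unshelve. all: by end_near. Qed.

Let L (j : nat) : R := limn (t ^~ j).

Let t_lim j : t ^~ j @ \oo --> L j.
Proof. exact: t_cvg. Qed.

Let L_ge0 j : 0 <= L j.
Proof. by apply: (cvgr_to_ge (@t_lim j)); apply: nearW. Qed.

Let L_sum_le1 N : \sum_(j < N) L j <= 1.
Proof.
have S_lim := @cvg_finsum _ _ (index_enum 'I_N) predT (fun j k => t k j) L (fun j => @t_lim j).
by apply: (cvgr_to_le S_lim); apply: nearW => k; exact: t_sum.
Qed.

Let Phi_tail N z : cnorm z < 1 -> cnorm (Phi z - psum L N z) <= cnorm z ^+ N.
Proof.
move=> lt_z.
apply: (tendsto_bound (w := fun k => rat_prod (s k) z - psum (t k) N z)).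
  by apply: tendstoB; [apply: f_lim; exact: ltW | apply: tendsto_psum].
by move=> k; apply: psum_tail => //; [exact: ltW | exact: f_psum].
Qed.

Let Phi_psum z : cnorm z < 1 -> tendsto (psum L ^~ z) (Phi z).
Proof.
move=> lt_z; apply: (tendsto_geometric (K := 1) (cnorm_ge0 z) lt_z) => N.
by rewrite mul1r; exact: Phi_tail.
Qed.

Let taylorE k : taylor_coef Phi k = to_C (L k).
Proof.
have Phi_series : power_series 1 L Phi.
  split=> //; exists 1 => j; rewrite expr1n mulr1 ger0_norm //.
  apply: le_trans (L_sum_le1 j.+1); rewrite big_ord_recr lerDr.
  by apply: sumr_ge0 => i _; exact: L_ge0.
rewrite /taylor_coef (power_series_derive1n k Phi_series) rmorphM rmorph_nat.
by rewrite mulrC mulKf // pnatr_eq0 -lt0n fact_gt0.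
Qed.

(** No mass is lost in the limit, because convergence is uniform up to z = 1:
    a single approximating product forces the limit to be close to 1 at a
    point 1 - d, and the sum of the coefficients is at least that value. *)
Let L_sum : has_sum L 1.
Proof.
have S_nd : nondecreasing_seq (fun N => \sum_(0 <= j < N) L j).
  by apply/nondecreasing_seqP => N; rewrite big_nat_recr //= lerDl.
have S_cvg : cvgn (fun N => \sum_(0 <= j < N) L j).
  apply: nondecreasing_is_cvgn => //; exists 1 => _ [N _ <-].
  by rewrite big_mkord.
split=> //; suff <- : limn (fun N => \sum_(0 <= j < N) L j) = 1 by [].
set S := limn _; have S_ge N : \sum_(j < N) L j <= S.
  by rewrite -(big_mkord predT); exact: nondecreasing_cvgn_le.
apply/eqP; rewrite eq_le; apply/andP; split.
  by apply: limr_le => //; apply: nearW => N; rewrite big_mkord.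
apply/ler_addgt0Pr => e e_gt0; have e2 : 0 < e / 2 by rewrite divr_gt0.
near \oo => k.
have Phi_k z : cnorm z <= 1 -> cnorm (Phi z - rat_prod (s k) z) <= e / 2.
  by move: z; near: k; exact: unif.
have [C C_ge0 leC] := rat_prod_near1 (@adm k).
have C1_gt0 : 0 < C + 1 by rewrite ltr_wpDl.
pose d := Num.min (1 / 2) (e / 2 / (C + 1)).
have d_gt0 : 0 < d by rewrite lt_min !divr_gt0.
have d_lt1 : d < 1 by rewrite gt_min; apply/orP; left; lra.
have Cd_le : C * d <= e / 2.
  apply: (@le_trans _ _ ((C + 1) * (e / 2 / (C + 1)))).
    by apply: ler_pM => //; [exact: ltW | rewrite lerDl | rewrite ge_min lexx orbT].
  by rewrite mulrCA divff ?mulr1 // gt_eqF.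
pose z := to_C (1 - d).
have z_norm : cnorm z = 1 - d by rewrite cnorm_real ger0_norm // subr_ge0 ltW.
have lt_z : cnorm z < 1 by rewrite z_norm; lra.
have f_ge : 1 - C * d <= cnorm (rat_prod (s k) z) by apply: leC; exact: ltW.
have Phi_le : cnorm (Phi z) <= S.
  apply: (tendsto_bound (Phi_psum lt_z)) => N.
  by apply: le_trans (psum_bound _ _ (ltW lt_z)) (S_ge N).
have := Phi_k z (ltW lt_z); rewrite cnormB => Phi_near.
have := cnormD (rat_prod (s k) z - Phi z) (Phi z); rewrite subrK.
by lra.
Unshelve. all: by end_near. Qed.

Lemma coherent_uniform_limit :
  exists M : forall n, partition_le n -> R,
    (forall n (l : partition_le n), MPhi p Phi l = to_C (M n l)) /\
    coherent_system p M.
Proof.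
have coord n : exists c : partition_le n -> R,
    (forall l, 0 <= c l) /\ expands p c (series_det L).
  have [c [c_lim Ec]] := expands_limit (fun k => @rat_expands _ p n (s k)) (fun j => @t_lim j).
  exists c; split=> // l; apply: (cvgr_to_ge (c_lim l)); apply: nearW => k.
  by apply: rat_coord_ge0 => // x; exact: adm.
pose c n := sval (cid (coord n)).
have cP n : (forall l, 0 <= c n l) /\ expands p (c n) (series_det L).
  exact: svalP (cid (coord n)).
exists (fun n l => c n l * groth1 p l); split=> [n l|].
  by apply: MPhiE taylorE _ _ => //; exact: (cP n).2.
exact: (coherent_coordinates p_gt0 p_lt1 L_sum (fun n => (cP n).2)
  (fun n => (cP n).1)).
Qed.

End UniformLimit.

Local Open Scope complex_scope.

Theorem theoremA (R : realType) (p : R) (p_gt0 : 0 < p) (p_lt1 : p < 1)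
    (Phi : R[i] -> R[i]) (PhiF : calF p Phi) :
  exists M : forall n, partition_le n -> R,
    (forall n (l : partition_le n), MPhi p Phi l = (M n l)%:C) /\
    coherent_system p M.
Proof.
have [s [adm unif]] := PhiF.
exact: (coherent_uniform_limit p_gt0 p_lt1 adm (uniform_cnorm unif)).
Qed.
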